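(* Let $\omega$ and $\mu$ be solutions of, respectively, the Sinh-Gordon equation $\Delta\omega=-8\sinh\omega$ and the Liouville equation $\Delta\mu=-e^{\mu}$ on an open simply connected domain $U\subseteq\mathbb{C}$, and let $p:U\to\mathbb{S}^3$ be the associated minimal surface with complex coordinate $z=u+Iv$ such that $\sigma(\partial z,\partial z)=-1$. Let $$V=\{(z,t)\mid z\in U,\ t\in\mathbb{R},\ e^{\omega+\mu}-2-2\cos(4t)>0\}$$ and let $\Lambda$ be a (smooth) solution on $V$ of $$\left(\frac{2\sqrt3\,e^{\omega}}{\tan\Lambda}-2\sin(2t)\right)^2=e^{\omega+\mu}-2-2\cos(4t)$$ (in particular $\tan\Lambda$ is finite and nonzero on $V$). Then there exists a Lagrangian immersion $f:V\to\mathbb{S}^3\times\mathbb{S}^3$, $x=(z,t)\mapsto(p(x),q(x))$ with $p(z,t)=p(z)$, into the nearly Kähler $\mathbb{S}^3\times\mathbb{S}^3$, where $q$ is determined by $$\frac{\partial q}{\partial t}=-\frac{\sqrt3}{2\sqrt3\,e^{\omega}-2\sin(2t)\tan\Lambda}\;q\,(\alpha_2\times\alpha_3),$$ $$\frac{\partial q}{\partial u}=\frac18\Big(e^{-\omega}\Big(\mu_v+\omega_v-\frac{(\mu_u+\omega_u)\cos(2t)\tan\Lambda}{\sqrt3\,e^{\omega}-\sin(2t)\tan\Lambda}\Big)q\,(\alpha_2\times\alpha_3)-4\big(\sqrt3\cot\Lambda\cos(2t)-1\big)q\,\alpha_2-4\sqrt3\sin(2t)\cot\Lambda\;q\,\alpha_3\Big),$$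 $$\frac{\partial q}{\partial v}=\frac18\Big(-e^{-\omega}\Big(\mu_u+\omega_u+\frac{(\mu_v+\omega_v)\cos(2t)\tan\Lambda}{\sqrt3\,e^{\omega}-\sin(2t)\tan\Lambda}\Big)q\,(\alpha_2\times\alpha_3)-4\sqrt3\cot\Lambda\sin(2t)\;q\,\alpha_2+4\big(1+\sqrt3\cos(2t)\cot\Lambda\big)q\,\alpha_3\Big),$$ with $\alpha_2=\bar p\,p_u$ and $\alpha_3=\bar p\,p_v$.
   Context: $\mathbb{S}^3$ is the set of unit quaternions in $\mathbb{H}$. Products are quaternionic products, $\bar p$ is the quaternionic conjugate, and for imaginary quaternions $\alpha,\beta$ the cross product $\alpha\times\beta$ is the imaginary part of $\alpha\beta$ (the usual vector product on $\mathrm{Im}\,\mathbb{H}\cong\mathbb{R}^3$). $\Delta=\partial_u^2+\partial_v^2$ is the Euclidean Laplacian on $\mathbb{C}=\mathbb{R}^2$ with $z=u+Iv$, where $I$ is the complex unit (distinct from the quaternion units). Put $\partial z=\tfrac12(\partial u-I\partial v)$, and extend everything $I$-linearly. The minimal surface associated to a solution $\omega$ of the Sinh-Gordon equation is the (unique up to congruence) minimal immersion $p:U\to\mathbb{S}^3$ such that: - $\langle p_u,p_u\rangle=\langle p_v,p_v\rangle=2e^{\omega}$ and $\langle p_u,p_v\rangle=0$; - $\sigma(\partial z,\partial z)=-1$, where $\sigma$ is the component of the second fundamental form in the direction of the unit normal $N=p\,\dfrac{\alpha_2\times\alpha_3}{2e^{\omega}}$, with $\alpha_2=\bar p\,p_u$,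 $\alpha_3=\bar p\,p_v$. Equivalently, $p_{zz}=\omega_zp_z-N$ and $p_{z\bar z}=-e^{\omega}p$. Tangent vectors of $\mathbb{S}^3\times\mathbb{S}^3$ at $(p,q)$ are pairs $(U',V')$. The nearly Kähler structure is $J(U',V')_{(p,q)}=\tfrac{1}{\sqrt3}(2pq^{-1}V'-U',\,-2qp^{-1}U'+V')$ with metric $g(Z,Z')=\tfrac12(\langle Z,Z'\rangle+\langle JZ,JZ'\rangle)$, where $\langle\cdot,\cdot\rangle$ is the Euclidean product metric. An immersion of a $3$-manifold is Lagrangian if $J$ maps tangent vectors to normal vectors (with respect to $g$). *)

(* Defs.v *)
From HB Require Import structures.
From mathcomp Require Import all_boot all_order all_algebra.
From mathcomp Require Import complex.
From mathcomp Require Import all_classical all_reals all_analysis.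

Set Implicit Arguments.
Unset Strict Implicit.
Unset Printing Implicit Defensive.

Import Order.TTheory GRing.Theory Num.Theory.
Import numFieldNormedType.Exports.

Local Open Scope classical_set_scope.
Local Open Scope ring_scope.

Section Smoothness.
Context {R : realType} {E F : normedModType R}.

(* For an open set A and a finite-dimensional E, asking for the iterated
   derivatives in all directions is the same as asking for the iterated partial
   derivatives. *)
Fixpoint Ck (k : nat) (A : set E) (f : E -> F) : Prop :=
  (forall x, A x -> {for x, continuous f}) /\
  if k is k'.+1 then
    forall v, (forall x, A x -> derivable f x v) /\ Ck k' A ('D_v f)
  else True.

Definition smooth_on (A : set E) (f : E -> F) : Prop := forall k, Ck k A f.

Definition immersion_on (A : set E) (f : E -> F) : Prop :=
  smooth_on A f /\ forall x, A x -> injective (fun v : E => 'D_v f x).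

End Smoothness.

Section Domains.
Context {R : realType} {T : topologicalType}.

Definition domain (A : set T) : Prop := [/\ open A, A !=set0 & connected A].

Let I01 : set R := `[0, 1]%classic.

Definition path_in (A : set T) (x y : T) (c : R -> T) : Prop :=
  [/\ {within I01, continuous c}, c @` I01 `<=` A, c 0 = x & c 1 = y].

Definition null_homotopic_in (A : set T) (x : T) (c : R -> T) : Prop :=
  exists h : R * R -> T,
    [/\ {within I01 `*` I01, continuous h}, h @` (I01 `*` I01) `<=` A,
        (forall s, I01 s -> h (0, s) = c s),
        (forall s, I01 s -> h (1, s) = x) &
        (forall r, I01 r -> h (r, 0) = x /\ h (r, 1) = x)].

Definition simply_connected (A : set T) : Prop :=
  (forall x y, A x -> A y -> exists c, path_in A x y c) /\
  (forall x c, A x -> path_in A x x c -> null_homotopic_in A x c).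

End Domains.

Arguments simply_connected R {T} A.

(* The row (a, b, c, d) stands for a + b i + c j + d k. *)
Notation quat R := 'rV[R]_4.

Section Quaternions.
Context {R : realType}.

Implicit Types x y : quat R.

Definition mkquat (a b c d : R) : quat R := \row_(i < 4) [:: a; b; c; d]`_i.

Definition qre x : R := x 0 0.
Definition qi x : R := x 0 1.
Definition qj x : R := x 0 2.
Definition qk x : R := x 0 3.

Definition qmul x y : quat R := mkquat
  (qre x * qre y - qi x * qi y - qj x * qj y - qk x * qk y)
  (qre x * qi y + qi x * qre y + qj x * qk y - qk x * qj y)
  (qre x * qj y - qi x * qk y + qj x * qre y + qk x * qi y)
  (qre x * qk y + qi x * qj y - qj x * qi y + qk x * qre y).

Definition qconj x : quat R := mkquat (qre x) (- qi x) (- qj x) (- qk x).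
Definition qim x : quat R := mkquat 0 (qi x) (qj x) (qk x).
Definition qdot x y : R := \sum_i x 0 i * y 0 i.
Definition qinv x : quat R := (qdot x x)^-1 *: qconj x.
Definition qcross x y : quat R := qim (qmul x y).

Definition S3 : set (quat R) := [set x | qdot x x = 1].

End Quaternions.

Arguments S3 R : clear implicits.
Notation "x ** y" := (qmul x y) (at level 40, left associativity) : ring_scope.

(* C is identified with R * R, z = u + I v being (u, v). *)
Section PlanarEquations.
Context {R : realType}.

Definition e_u : R * R := (1, 0).
Definition e_v : R * R := (0, 1).

Definition pd_u {F : normedModType R} (f : R * R -> F) : R * R -> F := 'D_e_u f.
Definition pd_v {F : normedModType R} (f : R * R -> F) : R * R -> F := 'D_e_v f.

Definition laplacian (f : R * R -> R) (z : R * R) : R :=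
  pd_u (pd_u f) z + pd_v (pd_v f) z.

Definition sinhR (x : R) : R := (expR x - expR (- x)) / 2.
Definition cot (x : R) : R := cos x / sin x.

Definition sinh_gordon (U : set (R * R)) (omega : R * R -> R) : Prop :=
  smooth_on U omega /\ forall z, U z -> laplacian omega z = - 8 * sinhR (omega z).

Definition liouville (U : set (R * R)) (mu : R * R -> R) : Prop :=
  smooth_on U mu /\ forall z, U z -> laplacian mu z = - expR (mu z).

End PlanarEquations.

Section Surfaces.
Context {R : realType}.
Implicit Types (p : R * R -> quat R) (omega : R * R -> R) (z X Y : R * R).

Definition alpha2 p z : quat R := qconj (p z) ** pd_u p z.
Definition alpha3 p z : quat R := qconj (p z) ** pd_v p z.

Definition unit_normal omega p z : quat R :=
  p z ** ((2 * expR (omega z))^-1 *: qcross (alpha2 p z) (alpha3 p z)).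

(* Orthogonal projection onto the tangent space of S3 at a unit quaternion a. *)
Definition tan_proj (a w : quat R) : quat R := w - qdot w a *: a.

(* Component along the unit normal N of the second fundamental form of p in S3,
   for constant vector fields X and Y on the plane: the Levi-Civita connection
   of S3 is the tangential projection of the Euclidean derivative. *)
Definition second_ff omega p z X Y : R :=
  qdot (tan_proj (p z) ('D_X ('D_Y p) z)) (unit_normal omega p z).

Definition first_ff p z X Y : R := qdot ('D_X p z) ('D_Y p z).

Definition mean_curvature omega p z : R :=
  let I := first_ff p z in
  let II := second_ff omega p z in
  (II e_u e_u * I e_v e_v - 2 * (II e_u e_v * I e_u e_v) + II e_v e_v * I e_u e_u)
  / (2 * (I e_u e_u * I e_v e_v - I e_u e_v ^+ 2)).

(* A complexified tangent vector X1 + I X2 is the pair (X1, X2); the value of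
   the complex bilinear extension of B is a complex number Re + I Im. *)
Definition complexify (B : R * R -> R * R -> R)
    (X Y : (R * R) * (R * R)) : R[i] :=
  Complex (B X.1 Y.1 - B X.2 Y.2) (B X.1 Y.2 + B X.2 Y.1).

Definition partial_z : (R * R) * (R * R) := (2^-1 *: e_u, - (2^-1 *: e_v)).

Definition associated_minimal_surface (U : set (R * R)) omega p : Prop :=
  [/\ immersion_on U p, (forall z, U z -> S3 R (p z)),
      (forall z, U z -> mean_curvature omega p z = 0),
      (forall z, U z ->
        [/\ qdot (pd_u p z) (pd_u p z) = 2 * expR (omega z),
            qdot (pd_v p z) (pd_v p z) = 2 * expR (omega z) &
            qdot (pd_u p z) (pd_v p z) = 0]) &
      (forall z, U z -> complexify (second_ff omega p z) partial_z partial_z = -1)].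

End Surfaces.

Section NearlyKahler.
Context {R : realType}.
Implicit Types Z W : quat R * quat R.

Definition nkJ (x Z : quat R * quat R) : quat R * quat R :=
  ((Num.sqrt 3)^-1 *: (2 *: (x.1 ** qinv x.2 ** Z.2) - Z.1),
   (Num.sqrt 3)^-1 *: (- (2 *: (x.2 ** qinv x.1 ** Z.1)) + Z.2)).

Definition euclid2 Z W : R := qdot Z.1 W.1 + qdot Z.2 W.2.

Definition nkg (x Z W : quat R * quat R) : R :=
  2^-1 * (euclid2 Z W + euclid2 (nkJ x Z) (nkJ x W)).

Definition lagrangian_immersion (V : set ((R * R) * R))
    (f : (R * R) * R -> quat R * quat R) : Prop :=
  [/\ immersion_on V f,
      (forall x, V x -> S3 R (f x).1 /\ S3 R (f x).2) &
      (forall x, V x -> forall X Y : (R * R) * R,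
         nkg (f x) (nkJ (f x) ('D_X f x)) ('D_Y f x) = 0)].

End NearlyKahler.

Section System.
Context {R : realType}.
Variables (omega mu : R * R -> R) (p : R * R -> quat R).
Variable Lambda : (R * R) * R -> R.

Definition lift_domain (U : set (R * R)) : set ((R * R) * R) :=
  [set x | U x.1 /\ 0 < expR (omega x.1 + mu x.1) - 2 - 2 * cos (4 * x.2)].

(* tan vanishes where cos does, so finiteness of tan is a separate clause. *)
Definition angle_equation (V : set ((R * R) * R)) : Prop :=
  forall x, V x -> let: (z, t) := x in
    [/\ cos (Lambda x) != 0, tan (Lambda x) != 0 &
        (2 * Num.sqrt 3 * expR (omega z) / tan (Lambda x) - 2 * sin (2 * t)) ^+ 2
        = expR (omega z + mu z) - 2 - 2 * cos (4 * t)].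

Definition q_system (V : set ((R * R) * R)) (q : (R * R) * R -> quat R) : Prop :=
  forall x, V x -> let: (z, t) := x in
    let s3 := Num.sqrt 3 in
    let L := Lambda x in
    let ew := expR (omega z) in
    let a2 := alpha2 p z in
    let a3 := alpha3 p z in
    let a23 := qcross a2 a3 in
    let su := pd_u mu z + pd_u omega z in
    let sv := pd_v mu z + pd_v omega z in
    let D := s3 * ew - sin (2 * t) * tan L in
    [/\ 'D_((0, 0), 1) q x
        = - (s3 / (2 * s3 * ew - 2 * sin (2 * t) * tan L)) *: (q x ** a23),
        'D_(e_u, 0) q x
        = 8^-1 *: ((expR (- omega z) * (sv - su * cos (2 * t) * tan L / D))
                     *: (q x ** a23)
                   - (4 * (s3 * cot L * cos (2 * t) - 1)) *: (q x ** a2)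
                   - (4 * s3 * sin (2 * t) * cot L) *: (q x ** a3)) &
        'D_(e_v, 0) q x
        = 8^-1 *: (- (expR (- omega z) * (su + sv * cos (2 * t) * tan L / D))
                     *: (q x ** a23)
                   - (4 * s3 * cot L * sin (2 * t)) *: (q x ** a2)
                   + (4 * (1 + s3 * cos (2 * t) * cot L)) *: (q x ** a3))].

End System.

(* Main.v *)
Require Import Defs.
From HB Require Import structures.
From mathcomp Require Import all_boot all_order all_algebra.
From mathcomp Require Import all_classical all_reals all_analysis.
From mathcomp Require Import complex ring lra.

Import Order.TTheory GRing.Theory Num.Theory.
Import numFieldNormedType.Exports.

Set Implicit Arguments.
Unset Strict Implicit.
Unset Printing Implicit Defensive.

Local Open Scope classical_set_scope.
Local Open Scope ring_scope.

(** Left translations by p and q identify tangent vectors with pairs of imaginary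
    quaternions, and in the frame alpha2, alpha3, nu = alpha2 alpha3 of the minimal
    surface the system reads D q = q W, where W is a form in u, v and t with values in
    the imaginary quaternions. Lambda enters W only through the root
      S = 2 sqrt 3 e^omega / tan Lambda - 2 sin 2t,  S^2 = e^(omega + mu) - 4 cos^2 2t,
    which is smooth and nowhere 0 on V, so that its sign eps is locally constant.

    As V can have any topology, the system is first reduced to one on U. Put
    th = t - atan (2 cos 2t / S) / 2 and let r = cos th - sin th n be the rotation
    about the unit vector n = e^-omega nu / 2. The change of gauge by r takes W to a
    connection A du + B dv on U that depends on t only through eps, that is
    A r + r_u = r W_u, B r + r_v = r W_v and r_t = r W_t (rotation_u, rotation_v,
    rotation_t; the trigonometry is in half_angle). By the equations of
    Gauss and Weingarten (weingarten, weingarten_normal) the curvature of this connection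
    has only one component, along nu, and it is the sum of the Sinh-Gordon and
    Liouville equations (conn_flat). As U is simply connected, there is a parallel
    section q0 with values in the unit quaternions for each sign (flat_section), and
    q = q0 r solves the system where S has the sign eps.

    A parallel section is constructed near a point by transport along a horizontal
    and then a vertical line (local_parallel), which takes linear differential
    equations (linear_ODE) only, and is continued over U by a monodromy theorem for
    local systems of functions (monodromy). It is smooth because its
    derivatives are products of itself with A and B.

    The map f = (p, q) sends the direction X to (p A_X, q B_X), where A_X has the
    components of X along alpha2 and alpha3 and B_X = W(X). It is an immersion since
    alpha2 and alpha3 are independent and W_t is a nonzero multiple of nu. Up to a
    constant, g(J f_X, f_Y) is <B_X, A_Y> - <A_X, B_Y> (nk_form), which vanishes because the
    component of W_u along alpha3 equals that of W_v along alpha2 and W_t is normal.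
    Finally the difference of two solutions is multiplied on the right by imaginary
    quaternions when it is differentiated, so that it has constant length. *)

(** * Directional derivatives *)

Section DirectionalDerivatives.
Context {R : realType} {E : normedModType R}.

Lemma is_derive_line (W : normedModType R) (f : E -> W) (x v : E) (h : R) df :
  is_derive (x + h *: v) v f df <-> is_derive h 1 (fun t : R => f (x + t *: v)) df.
Proof.
have eq_rate (k : R) : k^-1 *: ((f \o shift (x + h *: v)) (k *: v) - f (x + h *: v))
    = k^-1 *: (((fun t : R => f (x + t *: v)) \o shift h) (k *: 1) - f (x + h *: v)).
  congr (_ *: (f _ - _)).
  by rewrite /= [k *: 1]mulr1 scalerDl addrCA.
have E1 : derivable f (x + h *: v) v = derivable (fun t : R => f (x + t *: v)) h 1.
  by rewrite /derivable (funext eq_rate).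
have E2 : 'D_v f (x + h *: v) = 'D_1 (fun t : R => f (x + t *: v)) h.
  by rewrite /derive (funext eq_rate).
split=> -[d1 d2].
  by split; [rewrite -E1 | rewrite -E2].
by split; [rewrite E1 | rewrite E2].
Qed.

Lemma is_derive_line0 (W : normedModType R) (f : E -> W) (x v : E) df :
  is_derive x v f df <-> is_derive (0 : R) 1 (fun t : R => f (x + t *: v)) df.
Proof. by rewrite -is_derive_line scale0r addr0. Qed.

Lemma is_derive_comp1 (phi : R -> R) (f : E -> R) (x v : E) a b :
  is_derive (f x) 1 phi a -> is_derive x v f b ->
  is_derive x v (phi \o f) (a * b).
Proof.
move=> dphi /is_derive_line0 df; apply/is_derive_line0.
by apply: is_derive1_comp; rewrite scale0r addr0.
Qed.

Lemma is_derive_scale (W : normedModType R) (f : E -> W) (x v : E) (c : R) df :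
  is_derive x v f df -> is_derive x (c *: v) f (c *: df).
Proof.
have [-> _|c0 [dfx dfE]] := eqVneq c 0; first by rewrite !scale0r; exact: is_derive0.
suff H : h^-1 *: ((f \o shift x) (h *: (c *: v)) - f x) @[h --> 0^'] --> c *: df.
  by split; [apply/cvg_ex; exists (c *: df) | apply: cvg_lim].
have -> : (fun h : R => h^-1 *: ((f \o shift x) (h *: (c *: v)) - f x)) =
    (fun h : R => c *: ((h * c)^-1 *: ((f \o shift x) ((h * c) *: v) - f x))).
  apply/funext => h; rewrite !scalerA invfM; congr (_ *: _).
  by rewrite mulrCA mulfV // mulr1.
apply: cvgZr.
have /cvgrPdist_lt Hd : h^-1 *: ((f \o shift x) (h *: v) - f x) @[h --> 0^'] --> df.
  by rewrite -dfE; exact: dfx.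
apply/cvgrPdist_lt => e /Hd[d /= d0 Hde]; exists (d / `|c|) => /=.
  by rewrite divr_gt0 // normr_gt0.
move=> h; rewrite /= !sub0r !normrN => hd h0; apply: Hde.
  by rewrite /= sub0r normrN normrM -ltr_pdivlMr ?normr_gt0.
by rewrite mulf_neq0.
Qed.

Lemma MVT_line (f df : E -> R) (x v : E) :
  (forall h : R, 0 <= h <= 1 -> is_derive (x + h *: v) v f (df (x + h *: v))) ->
  exists2 c : R, 0 < c < 1 & f (x + v) - f x = df (x + c *: v).
Proof.
move=> dfl.
pose g (t : R) := f (x + t *: v).
have dg (t : R) : 0 <= t <= 1 -> is_derive t 1 g (df (x + t *: v)).
  by move=> /dfl /is_derive_line.
have [||c cI] := @MVT R g (fun t => df (x + t *: v)) 0 1 ltr01.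
- by move=> t /andP[t0 t1]; apply: dg; rewrite !ltW.
- by apply: derivable_within_continuous => t; rewrite in_itv /= => /dg[].
- rewrite /g scale1r scale0r addr0 subr0 mulr1 => ->; exists c => //.
Qed.

Lemma MVT_bound (f : E -> R) (x v : E) (M : R) :
  (forall h : R, 0 <= h <= 1 -> derivable f (x + h *: v) v) ->
  (forall h : R, 0 <= h <= 1 -> `|'D_v f (x + h *: v)| <= M) ->
  `|f (x + v) - f x| <= M.
Proof.
move=> df bf; have [|c /andP[c0 c1] ->] := @MVT_line f ('D_v f) x v.
  by move=> h h01; apply: derivableP; apply: df.
by apply: bf; rewrite !ltW.
Qed.

(** A step h (v + w) is a step h w followed by a step h v; the mean value theorem
    turns the latter into a value of the derivative along v near x, whence the
    continuity hypothesis. *)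
Lemma is_derive_dirD (f : E -> R) (x v w : E) :
  (\forall y \near x, derivable f y v) -> {for x, continuous ('D_v f)} ->
  derivable f x w -> is_derive x (v + w) f ('D_v f x + 'D_w f x).
Proof.
move=> dv cv dw.
suff H : h^-1 *: ((f \o shift x) (h *: (v + w)) - f x) @[h --> 0^'] --> 'D_v f x + 'D_w f x.
  by split; [apply/cvg_ex; exists ('D_v f x + 'D_w f x) | apply: cvg_lim].
have -> : (fun h : R => h^-1 *: ((f \o shift x) (h *: (v + w)) - f x)) =
    (fun h : R => h^-1 *: ((f \o shift x) (h *: (v + w)) - (f \o shift x) (h *: w)))
    + (fun h : R => h^-1 *: ((f \o shift x) (h *: w) - f x)).
  by apply/funext => h; rewrite [RHS]/GRing.add /= -scalerDr addrA subrK.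
apply: cvgD; last exact: dw.
apply/cvgrPdist_lt => e e0.
have near_e : \forall y \near x, derivable f y v /\ `|'D_v f x - 'D_v f y| < e.
  move/cvgrPdist_lt : cv => /(_ _ e0) cv.
  by near=> y; split; near: y.
have [d /= d0 Hd] := (nbhs_ballP _ _).1 near_e.
have vw0 : 0 < `|v| + `|w| + 1 by rewrite ltr_wpDl // addr_ge0.
exists (d / (`|v| + `|w| + 1)) => /=; first by rewrite divr_gt0.
move=> h; rewrite /= sub0r normrN => hd h0.
have inball (c : R) : 0 <= c <= 1 -> ball x d (x + h *: w + c *: (h *: v)).
  move=> /andP[c0 c1]; rewrite -ball_normE /= -addrA opprD addNKr normrN.
  rewrite ltr_pdivlMr // in hd; apply: le_lt_trans hd.
  rewrite (le_trans (ler_normD _ _)) // !normrZ (ger0_norm c0).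
  have hv0 : 0 <= `|h| * `|v| by rewrite mulr_ge0.
  have := ler_wpM2r hv0 c1; have := normr_ge0 h; move: (`|h|) (`|v|) hv0 => a b.
  by lra.
have [h' h'01|c /andP[c0 c1]] := @MVT_line f (fun y => h *: 'D_v f y) (x + h *: w) (h *: v).
  have [dfy _] := Hd _ (inball _ h'01).
  exact: is_derive_scale (derivableP dfy).
rewrite /=; have -> : f (h *: (v + w) + x) = f (x + h *: w + h *: v).
  by congr f; rewrite scalerDr addrC [h *: v + _]addrC addrA.
rewrite [h *: w + x]addrC => ->; rewrite [_^-1 *: _]scalerA mulVf // scale1r.
by have [|_] := Hd _ (inball c _); rewrite ?ltW.
Unshelve. all: by end_near. Qed.

Lemma is_derive_mxP m n (f : E -> 'M[R]_(m, n)) x v df :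
  is_derive x v f df <-> forall i j, is_derive x v (fun y => f y i j) (df i j).
Proof.
split=> [[dfx <-] i j|dfx].
  rewrite derive_mx // mxE; apply: derivableP.
  by apply: (derivable_mxP _ _ _).1.
have dfx' : derivable f x v by apply/derivable_mxP => i j; case: (dfx i j).
split=> //; rewrite derive_mx //; apply/matrixP => i j; rewrite mxE.
by case: (dfx i j).
Qed.

End DirectionalDerivatives.

(** * Calculus of smooth functions *)

Section SmoothCalculus.
Context {R : realType} {E : normedModType R}.
Implicit Types (F : normedModType R) (A : set E) (k : nat).

Lemma near_eq_continuous (T U : topologicalType) (f g : T -> U) x :
  (\near x, f x = g x) -> {for x, continuous f} -> {for x, continuous g}.
Proof.
move=> fg cf; have cf' : f @ x --> g x by rewrite -(nbhs_singleton fg).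
by apply: cvg_trans cf'; exact: near_eq_cvg.
Qed.

Lemma Ck_eq F k A (f g : E -> F) : open A -> (forall x, A x -> f x = g x) ->
  Ck k A f -> Ck k A g.
Proof.
move=> oA; have nfg f' g' x : (forall x, A x -> f' x = g' x) -> A x -> \near x, f' x = g' x.
  by move=> fg Ax; near=> y; apply: fg; near: y; exact: open_nbhs_nbhs.
elim: k f g => [|k IH] f g fg.
  by case=> cf _; split=> // x Ax; apply: (near_eq_continuous (nfg _ _ _ _ fg Ax)); exact: cf.
case=> cf df; split=> [x Ax|v].
  by apply: (near_eq_continuous (nfg _ _ _ _ fg Ax)); exact: cf.
have [dfv Cf] := df v; split=> [x Ax|].
  exact: near_eq_derivable (nfg _ _ _ _ fg Ax) (dfv x Ax).
by apply: IH Cf => x Ax; apply: near_eq_derive; exact: (nfg _ _ _ _ fg).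
Unshelve. all: by end_near. Qed.

Lemma CkW F k A (f : E -> F) : Ck k.+1 A f -> Ck k A f.
Proof.
elim: k f => [|k IH] f [cf df]; split=> // v; have [? Cf] := df v.
by split=> //; exact: IH.
Qed.

Lemma Ck_sub F k A B (f : E -> F) : B `<=` A -> Ck k A f -> Ck k B f.
Proof.
move=> BA; elim: k f => [|k IH] f [cf df]; first by split=> // x /BA /cf.
split=> [x /BA /cf //|v].
by have [dfv Cf] := df v; split=> [x /BA /dfv //|]; exact: IH.
Qed.

Lemma smooth_derivable F A (f : E -> F) v x : smooth_on A f -> A x -> derivable f x v.
Proof. by move=> /(_ 1%N) [_ /(_ v) [dfv _]] /dfv. Qed.

Lemma smooth_is_derive F A (f : E -> F) v x :
  smooth_on A f -> A x -> is_derive x v f ('D_v f x).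
Proof. by move=> sf Ax; apply: derivableP; apply: smooth_derivable sf Ax. Qed.

Lemma smooth_continuous F A (f : E -> F) x :
  smooth_on A f -> A x -> {for x, continuous f}.
Proof. by move=> /(_ 0%N) [cf _] /cf. Qed.

Lemma open_pos A (f : E -> R) : open A -> smooth_on A f -> open [set x | A x /\ 0 < f x].
Proof.
move=> oA sf; rewrite openE => x [Ax fx].
have h1 : nbhs x A by exact: open_nbhs_nbhs.
have h2 : nbhs x (fun y => 0 < f y).
  have cf : {for x, continuous f} by exact: smooth_continuous sf Ax.
  exact: (cf _ (lt_nbhsr fx)).
have h3 : nbhs x (fun y => A y /\ 0 < f y) by exact: (filterI h1 h2).
exact: h3.
Qed.

Lemma smooth_derive F A (f : E -> F) v : smooth_on A f -> smooth_on A ('D_v f).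
Proof. by move=> sf k; have [_ /(_ v) []] := sf k.+1. Qed.

Lemma smooth_eq F A (f g : E -> F) : open A -> (forall x, A x -> f x = g x) ->
  smooth_on A f -> smooth_on A g.
Proof. by move=> oA fg sf k; apply: Ck_eq (sf k). Qed.

Lemma smooth_sub F A B (f : E -> F) : B `<=` A -> smooth_on A f -> smooth_on B f.
Proof. by move=> BA sf k; apply: Ck_sub (sf k). Qed.

Lemma Ck_cst F k A (a : F) : Ck k A (fun=> a).
Proof.
elim: k a => [|k IH] a; first by split=> // x _; exact: cvg_cst.
split=> [x _|v]; first exact: cvg_cst.
split=> [x _|]; first exact: derivable_cst.
by rewrite (_ : 'D_v _ = fun=> 0); [exact: IH | apply/funext => x; rewrite derive_cst].
Qed.

Lemma CkD F k A (f g : E -> F) : open A -> Ck k A f -> Ck k A g ->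
  Ck k A (fun x => f x + g x).
Proof.
move=> oA; elim: k f g => [|k IH] f g [cf df] [cg dg].
  by split=> // x Ax; apply: cvgD; [exact: cf | exact: cg].
split=> [x Ax|v]; first by apply: cvgD; [exact: cf | exact: cg].
have [dfv Cf] := df v; have [dgv Cg] := dg v; split=> [x Ax|].
  by apply: derivableD; [exact: dfv | exact: dgv].
apply: Ck_eq (IH _ _ Cf Cg) => // x Ax.
by rewrite deriveD; [|exact: dfv | exact: dgv].
Qed.

Lemma CkM k A (f g : E -> R) : open A -> Ck k A f -> Ck k A g ->
  Ck k A (fun x => f x * g x).
Proof.
move=> oA; elim: k f g => [|k IH] f g Hf Hg.
  case: Hf Hg => cf _ [cg _].
  by split=> // x Ax; apply: cvgM; [exact: cf | exact: cg].
have Wf := CkW Hf; have Wg := CkW Hg; case: Hf Hg => cf df [cg dg].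
split=> [x Ax|v]; first by apply: cvgM; [exact: cf | exact: cg].
have [dfv Cf] := df v; have [dgv Cg] := dg v; split=> [x Ax|].
  by apply: derivableM; [exact: dfv | exact: dgv].
apply: Ck_eq (CkD oA (IH _ _ Wf Cg) (IH _ _ Wg Cf)) => // x Ax.
by rewrite deriveM; [|exact: dfv | exact: dgv].
Qed.

(** By induction on k: the chain rule along lines expresses the derivative of the
    composite as a product to which the induction hypothesis applies. *)
Lemma Ck_comp1 k A (D : set R) (phi : R -> R) (f : E -> R) : open A ->
  (forall x, A x -> D (f x)) -> Ck k D phi -> Ck k A f -> Ck k A (fun x => phi (f x)).
Proof.
move=> oA AD; elim: k phi f AD => [|k IH] phi f AD Hp Hf.
  case: Hp Hf => cp _ [cf _]; split=> // x Ax.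
  by apply: (continuous_comp (cf x Ax)); apply: cp; exact: AD.
have Wf := CkW Hf; case: Hp Hf => cp /(_ 1) [dp Cp] [cf df].
split=> [x Ax|v].
  by apply: (continuous_comp (cf x Ax)); apply: cp; exact: AD.
have [dfv Cf] := df v.
have dphif x : A x -> is_derive x v (phi \o f) ('D_1 phi (f x) * 'D_v f x).
  move=> Ax; apply: is_derive_comp1; apply: derivableP.
    by apply: dp; exact: AD.
  exact: dfv.
split=> [x /dphif[] //|].
apply: Ck_eq (CkM oA (IH _ _ AD Cp Wf) Cf) => // x /dphif [_ <-] //.
Qed.

Lemma smooth_cst F A (a : F) : smooth_on A (fun=> a).
Proof. by move=> k; exact: Ck_cst. Qed.

Lemma smoothD F A (f g : E -> F) : open A -> smooth_on A f -> smooth_on A g ->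
  smooth_on A (fun x => f x + g x).
Proof. by move=> oA sf sg k; apply: CkD. Qed.

Lemma smoothM A (f g : E -> R) : open A -> smooth_on A f -> smooth_on A g ->
  smooth_on A (fun x => f x * g x).
Proof. by move=> oA sf sg k; apply: CkM. Qed.

Lemma smoothN A (f : E -> R) : open A -> smooth_on A f -> smooth_on A (fun x => - f x).
Proof.
move=> oA sf; apply: (@smooth_eq _ _ (fun x => -1 * f x)) => //.
  by move=> x _; rewrite mulN1r.
by apply: smoothM => //; exact: smooth_cst.
Qed.

Lemma smoothB A (f g : E -> R) : open A -> smooth_on A f -> smooth_on A g ->
  smooth_on A (fun x => f x - g x).
Proof. by move=> oA sf sg; apply: smoothD => //; exact: smoothN. Qed.

Lemma smooth_comp1 A D (phi : R -> R) (f : E -> R) : open A -> smooth_on D phi ->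
  (forall x, A x -> D (f x)) -> smooth_on A f -> smooth_on A (fun x => phi (f x)).
Proof. by move=> oA sp AD sf k; apply: Ck_comp1 AD (sp k) (sf k). Qed.

Lemma Ck_mxP m n k A (f : E -> 'M[R]_(m, n)) : open A ->
  Ck k A f <-> forall i j, Ck k A (fun x => f x i j).
Proof.
move=> oA; have contP x (g : E -> 'M[R]_(m, n)) :
    {for x, continuous g} <-> forall i j, {for x, continuous (fun y => g y i j)}.
  split=> [cg i j|cg].
    exact: (continuous_comp cg (@coord_continuous _ _ _ i j _)).
  apply/cvgrPdist_lt => e e0; near=> y.
  rewrite /Num.Def.normr /= mx_normrE; apply: bigmax_lt => //= -[i j] _ /=.
  rewrite !mxE; move: i j; near: y.
  apply: filter_forall => i; apply: filter_forall => j.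
  by move/cvgrPdist_lt : (cg i j) => /(_ _ e0).
elim: k f => [|k IH] f.
  split=> [[cf _] i j|Hf]; split=> // x Ax; first by apply: (contP _ _).1; exact: cf.
  by apply/contP => i j; have [cf _] := Hf i j; exact: cf.
split=> [[cf df] i j|Hf].
  split=> [x Ax|v]; first by apply: (contP _ _).1; exact: cf.
  have [dfv /IH Cf] := df v; split=> [x /dfv /derivable_mxP //|].
  apply: Ck_eq (Cf i j) => // x Ax.
  by rewrite derive_mx ?mxE //; exact: dfv.
split=> [x Ax|v]; first by apply/contP => i j; have [cf _] := Hf i j; exact: cf.
have dfv x : A x -> derivable f x v.
  by move=> Ax; apply/derivable_mxP => i j; have [_ /(_ v) [d _]] := Hf i j; exact: d.
split=> //; apply/IH => i j; have [_ /(_ v) [_ Cf]] := Hf i j.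
by apply: Ck_eq Cf => // x Ax; rewrite derive_mx ?mxE //; exact: dfv.
Unshelve. all: by end_near. Qed.

Lemma smooth_mxP m n A (f : E -> 'M[R]_(m, n)) : open A ->
  smooth_on A f <-> forall i j, smooth_on A (fun x => f x i j).
Proof.
move=> oA; split=> [sf i j k|sf k]; first by have /(Ck_mxP _ _ oA) := sf k; exact.
by apply/(Ck_mxP _ _ oA) => i j; exact: sf.
Qed.

Lemma smooth_deriveD A (f : E -> R) v w x : open A -> smooth_on A f -> A x ->
  'D_(v + w) f x = 'D_v f x + 'D_w f x.
Proof.
move=> oA sf Ax; have [|||_ ->//] := @is_derive_dirD R E f x v w.
- by near=> y; apply: (@smooth_derivable _ A _ v y sf); near: y; exact: open_nbhs_nbhs.
- by apply: (smooth_continuous (smooth_derive v sf)).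
- exact: smooth_derivable sf Ax.
Unshelve. all: by end_near. Qed.

Lemma smooth_deriveZ F A (f : E -> F) (c : R) v x : smooth_on A f -> A x ->
  'D_(c *: v) f x = c *: 'D_v f x.
Proof.
by move=> sf Ax; have [_ ->//] := is_derive_scale c (smooth_is_derive v sf Ax).
Qed.

End SmoothCalculus.

(** Both the points where P holds and those where it fails are relatively open.
    Uniqueness of continuations, induction over the unit interval and the
    constancy of functions with zero derivative are all reduced to this. *)
Lemma connected_locally_constant (T : topologicalType) (D : set T) (P : T -> Prop) :
  connected D ->
  (forall x, D x -> \forall y \near within D (nbhs x), P y <-> P x) ->
  forall x y, D x -> D y -> P x -> P y.
Proof.
move=> cD lP x y Dx Dy Px.
pose B := [set z | D z /\ P z].
suff BD : B = D by have [] : B y by rewrite BD.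
apply: cD; first by exists x.
- exists (interior [set z | D z -> P z]); first exact: open_interior.
  apply/seteqP; split=> z [Dz]; last by move=> /interior_subset /(_ Dz); split.
  move=> Pz; split=> //; have : nbhs z (fun u => D u -> (P u <-> P z)) := lP z Dz.
  by rewrite /interior /=; apply: filterS => u Pu Du; apply/(Pu Du).
- exists (~` interior [set z | D z -> ~ P z]).
    by apply: open_closedC; exact: open_interior.
  apply/seteqP; split=> z [Dz].
    by move=> Pz; split=> //= /interior_subset /(_ Dz).
  move=> nPz; split=> //; apply: contrapT => nP; apply: nPz.
  have : nbhs z (fun u => D u -> (P u <-> P z)) := lP z Dz.
  by rewrite /interior /=; apply: filterS => u Pu Du /(Pu Du).
Qed.

Section SmoothExamples.
Context {R : realType}.

Lemma Ck_comp_linear (E E' F : normedModType R) (L : E' -> E) k (A : set E) (f : E -> F) :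
  (forall (h : R) v x, L (h *: v + x) = h *: L v + L x) -> continuous L ->
  Ck k A f -> Ck k (L @^-1` A) (fun x => f (L x)).
Proof.
move=> lL cL; elim: k f => [|k IH] f [cf df].
  split=> // x Ax; exact: (continuous_comp (cL x) (cf _ Ax)).
split=> [x Ax|v]; first exact: (continuous_comp (cL x) (cf _ Ax)).
have [dfv Cf] := df (L v).
have rateE x : (fun h : R => h^-1 *: (((fun x => f (L x)) \o shift x) (h *: v) - f (L x)))
    = (fun h : R => h^-1 *: ((f \o shift (L x)) (h *: L v) - f (L x))).
  by apply/funext => h /=; rewrite lL.
split=> [x Ax|]; first by rewrite /derivable rateE; exact: (dfv _ Ax).
rewrite (_ : 'D_v _ = fun x => 'D_(L v) f (L x)); first exact: (IH _ Cf).
by apply/funext => x; rewrite /derive rateE.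
Qed.

Lemma smooth_fst (E1 E2 F : normedModType R) (A : set E1) (f : E1 -> F) :
  smooth_on A f -> smooth_on [set x : E1 * E2 | A x.1] (fun x => f x.1).
Proof. by move=> sf k; apply: (Ck_comp_linear (L := fst)) (sf k) => //; move=> x; exact: cvg_fst. Qed.

Lemma smooth_snd (E1 E2 F : normedModType R) (A : set E2) (f : E2 -> F) :
  smooth_on A f -> smooth_on [set x : E1 * E2 | A x.2] (fun x => f x.2).
Proof. by move=> sf k; apply: (Ck_comp_linear (L := snd)) (sf k) => //; move=> x; exact: cvg_snd. Qed.

Lemma derive_comp_fst (E1 E2 F : normedModType R) (f : E1 -> F) (v x : E1 * E2) :
  'D_v (fun x => f x.1) x = 'D_(v.1) f x.1.
Proof. by []. Qed.

Lemma is_derive_comp_fst (E1 E2 F : normedModType R) (f : E1 -> F) (v x : E1 * E2) df :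
  is_derive x.1 v.1 f df -> is_derive x v (fun x => f x.1) df.
Proof. by move=> [d1 d2]; split. Qed.

Lemma is_derive_comp_snd (E1 E2 F : normedModType R) (f : E2 -> F) (v x : E1 * E2) df :
  is_derive x.2 v.2 f df -> is_derive x v (fun x => f x.2) df.
Proof. by move=> [d1 d2]; split. Qed.

Lemma is_derive_pair (E F G : normedModType R) (f : E -> F) (g : E -> G) x v df dg :
  is_derive x v f df -> is_derive x v g dg ->
  is_derive x v (fun y => (f y, g y)) (df, dg).
Proof.
move=> [df1 dfE] [dg1 dgE].
suff H : (fun h : R => h^-1 *: (((fun y => (f y, g y)) \o shift x) (h *: v) - (f x, g x)))
    @ 0^' --> (df, dg).
  by split; [apply/cvg_ex; exists (df, dg) | apply: cvg_lim].
by rewrite -dfE -dgE; apply: (cvg_pair df1 dg1).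
Qed.

Lemma smooth_pair (E F G : normedModType R) (A : set E) (f : E -> F) (g : E -> G) :
  open A -> smooth_on A f -> smooth_on A g -> smooth_on A (fun y => (f y, g y)).
Proof.
move=> oA sf sg k; elim: k f g sf sg => [|k IH] f g sf sg.
  by split=> // x Ax; exact: (cvg_pair (smooth_continuous sf Ax) (smooth_continuous sg Ax)).
split=> [x Ax|v]; first exact: (cvg_pair (smooth_continuous sf Ax) (smooth_continuous sg Ax)).
have dp x : A x -> is_derive x v (fun y => (f y, g y)) ('D_v f x, 'D_v g x).
  by move=> Ax; apply: is_derive_pair; exact: smooth_is_derive Ax.
split=> [x /dp[]//|].
apply: Ck_eq (IH _ _ (smooth_derive v sf) (smooth_derive v sg)) => // x /dp[_ ->] //.
Qed.

(** The derivatives along other directions are multiples of the one along 1, so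
    that a formula for the derivative in the same class settles everything. *)
Lemma Ck1 k (D : set R) (phi phi' : R -> R) : open D ->
  (forall x, D x -> is_derive x 1 phi (phi' x)) -> Ck k D phi' -> Ck k.+1 D phi.
Proof.
move=> oD dphi Cphi.
have dphiv v x : D x -> is_derive x v phi (v * phi' x).
  by move=> /dphi /(is_derive_scale v); rewrite [_ *: 1]mulr1.
split=> [x /dphi[d _]|v]; first exact/differentiable_continuous/derivable1_diffP.
split=> [x /(dphiv v) []//|].
by apply: Ck_eq (CkM oD (Ck_cst k D v) Cphi) => // x /(dphiv v) [_ ->].
Qed.

Lemma smooth_id (D : set R) : open D -> smooth_on D (fun x : R => x).
Proof.
move=> oD [|k]; first by split=> // x _; exact: cvg_id.
by apply: (@Ck1 _ _ _ (fun=> 1)) => //; exact: Ck_cst.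
Qed.

Lemma smooth_expR : smooth_on [set: R] expR.
Proof.
elim=> [|k IH]; first by split=> // x _; exact: continuous_expR.
by apply: Ck1 IH => // ; exact: openT.
Qed.

Lemma smooth_cos_sin : smooth_on [set: R] cos /\ smooth_on [set: R] sin.
Proof.
suff H k : Ck k [set: R] cos /\ Ck k [set: R] sin by split=> k; case: (H k).
elim: k => [|k [Cc Cs]].
  by split; split=> // x _; [exact: continuous_cos | exact: continuous_sin].
split; last by apply: Ck1 Cc => //; exact: openT.
apply: (@Ck1 _ _ _ (fun x => (-1) * sin x)); first exact: openT.
  by move=> x _; rewrite mulN1r; exact: is_derive_cos.
by apply: CkM => //; [exact: openT | exact: Ck_cst].
Qed.

Lemma smooth_inv : smooth_on [set x : R | x != 0] (fun x => x^-1).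
Proof.
have oD : open [set x : R | x != 0] by exact: open_neq.
elim=> [|k IH]; first by split=> // x /= x0; exact: inv_continuous.
apply: (@Ck1 _ _ _ (fun x => -1 * (x^-1 * x^-1))) => //.
  move=> x /= x0; have H := is_deriveV x0 (is_derive_id x (1 : R)).
  by apply: is_derive_eq H _; rewrite [_ *: 1]mulr1 mulN1r -expr2 exprVn.
by apply: CkM => //; [exact: Ck_cst | exact: CkM].
Qed.

Lemma smooth_atan : smooth_on [set: R] atan.
Proof.
case=> [|k]; first by split=> // x _; exact: continuous_atan.
apply: (@Ck1 _ _ _ (fun x => (1 + x * x)^-1)); first exact: openT.
have sq : smooth_on [set: R] (fun x => 1 + x * x).
  apply: smoothD; [exact: openT | exact: smooth_cst |].
  by apply: smoothM; try apply: smooth_id; exact: openT.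
have H := @Ck_comp1 R R k [set: R] _ _ _ openT _ (smooth_inv k) (sq k).
apply: H => x _ /=.
by rewrite gt_eqF // ltr_wpDr // -expr2 sqr_ge0.
Qed.

(** Two applications of the mean value theorem. The left-hand side is symmetric in
    v and w, so that the two mixed derivatives agree at points close to x. *)
Lemma second_difference (E : normedModType R) (A : set E) (f : E -> R) v w x (h : R) :
  smooth_on A f -> 0 < h ->
  (forall a b : R, 0 <= a <= h -> 0 <= b <= h -> A (x + a *: v + b *: w)) ->
  exists a b : R, [/\ 0 <= a <= h, 0 <= b <= h &
    f (x + h *: v + h *: w) - f (x + h *: v) - f (x + h *: w) + f x
      = h ^+ 2 * 'D_w ('D_v f) (x + a *: v + b *: w)].
Proof.
move=> sf h0 inA.
have scale_le (c : R) : 0 <= c <= 1 -> 0 <= c * h <= h.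
  by move=> /andP[c0 c1]; have := ltW h0; nra.
have hh : 0 <= h <= h by rewrite lexx ltW.
pose g y := f (y + h *: w) - f y.
have inA0 a : 0 <= a <= h -> A (x + a *: v).
  by move=> ah; have := inA a 0 ah; rewrite scale0r addr0 lexx ltW //; exact.
have dshift y : A (y + h *: w) ->
    is_derive y (h *: v) (fun y => f (y + h *: w)) ('D_(h *: v) f (y + h *: w)).
  move=> /(smooth_is_derive (h *: v) sf) /is_derive_line0 H; apply/is_derive_line0.
  rewrite (_ : (fun t : R => f (y + t *: (h *: v) + h *: w)) =
    (fun t : R => f (y + h *: w + t *: (h *: v)))) //.
  by apply/funext => t; rewrite addrAC.
have [c ch0|c c01 Hc] := @MVT_line R E g
    (fun y => 'D_(h *: v) f (y + h *: w) - 'D_(h *: v) f y) x (h *: v).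
  apply: is_deriveB; first by apply: dshift; rewrite scalerA; apply: inA => //; exact: scale_le.
  by apply: (smooth_is_derive _ sf); rewrite scalerA; apply: inA0; exact: scale_le.
have ach : 0 <= c * h <= h by apply: scale_le; lra.
have [b bh0|b b01 Hb] := @MVT_line R E ('D_v f) ('D_(h *: w) ('D_v f))
    (x + c *: (h *: v)) (h *: w).
  apply: (smooth_is_derive _ (smooth_derive v sf)).
  by rewrite !scalerA; apply: inA => //; exact: scale_le.
have bch : 0 <= b * h <= h by apply: scale_le; lra.
exists (c * h), (b * h); split=> //.
have -> : f (x + h *: v + h *: w) - f (x + h *: v) - f (x + h *: w) + f x =
    g (x + h *: v) - g x by rewrite /g; ring.
move: Hc Hb; rewrite !scalerA => -> Hb.
rewrite !(smooth_deriveZ _ _ sf) -?scalerBr ?Hb; last 2 first.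
- exact: inA0.
- exact: inA.
rewrite (smooth_deriveZ _ _ (smooth_derive v sf)); last exact: inA.
by rewrite scalerA expr2.
Qed.

Lemma continuous_coincide (E : normedModType R) (g1 g2 : E -> R) x :
  {for x, continuous g1} -> {for x, continuous g2} ->
  (forall d : R, 0 < d -> exists y1 y2, [/\ ball x d y1, ball x d y2 & g1 y1 = g2 y2]) ->
  g1 x = g2 x.
Proof.
move=> /cvgrPdist_lt c1 /cvgrPdist_lt c2 H.
apply/eqP; rewrite -subr_eq0 -normr_eq0; apply/eqP; apply: le_anti; rewrite normr_ge0 andbT.
apply/ler_addgt0Pl => e e0; rewrite addr0.
have e2 : 0 < e / 2 by rewrite divr_gt0.
have nearx : nbhs x (fun y => `|g1 x - g1 y| < e / 2 /\ `|g2 x - g2 y| < e / 2).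
  exact: filterI (c1 _ e2) (c2 _ e2).
have [d /= d0 Hd] := (nbhs_ballP _ _).1 nearx.
have [y1 [y2 [/Hd [b1 _] /Hd [_ b2] g12]]] := H _ d0.
rewrite -(subrK (g1 y1) (g1 x)) -addrA (le_trans (ler_normD _ _)) //.
by move: b1 b2; rewrite /= -g12 [`|g2 x - _|]distrC; lra.
Qed.

Lemma derive_comm (E : normedModType R) (A : set E) (f : E -> R) v w x :
  open A -> smooth_on A f -> A x -> 'D_w ('D_v f) x = 'D_v ('D_w f) x :> R.
Proof.
move=> oA sf Ax.
have cont u1 u2 : {for x, continuous ('D_u1 ('D_u2 f))}.
  by apply: (smooth_continuous (smooth_derive u1 (smooth_derive u2 sf))).
apply: (continuous_coincide (cont w v) (cont v w)) => d0 d00.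
have [r /= r0 Hr] := (nbhs_ballP _ _).1 (open_nbhs_nbhs (conj oA Ax)).
pose d := Num.min r d0.
have d_gt0 : 0 < d by rewrite lt_min r0.
have vw0 : 0 < `|v| + `|w| + 1 by rewrite ltr_wpDl // addr_ge0.
pose h := d / 2 / (`|v| + `|w| + 1).
have h0 : 0 < h by rewrite !divr_gt0.
have inb a b : 0 <= a <= h -> 0 <= b <= h -> ball x d (x + a *: v + b *: w).
  move=> /andP[a0 ah] /andP[b0 bh]; rewrite -ball_normE /= -addrA opprD addNKr normrN.
  rewrite (le_lt_trans (ler_normD _ _)) // !normrZ !ger0_norm //.
  have : h * (`|v| + `|w| + 1) = d / 2 by rewrite /h divfK // gt_eqF.
  have := ler_wpM2r (normr_ge0 v) ah; have := ler_wpM2r (normr_ge0 w) bh.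
  by rewrite mulrDr mulr1 mulrDr; lra.
have inA a b : 0 <= a <= h -> 0 <= b <= h -> A (x + a *: v + b *: w).
  move=> ah bh; apply: Hr; apply: le_ball (inb a b ah bh).
  by rewrite ge_min lexx.
have ind a b : 0 <= a <= h -> 0 <= b <= h -> ball x d0 (x + a *: v + b *: w).
  move=> ah bh; apply: le_ball (inb a b ah bh).
  by rewrite ge_min lexx orbT.
have [a [b [ah bh E1]]] := second_difference sf h0 inA.
have [|b' [a' [bh' ah' E2]]] := @second_difference E A f w v x h sf h0.
  by move=> b' a' bh' ah'; rewrite addrAC; exact: inA.
exists (x + a *: v + b *: w), (x + b' *: w + a' *: v); split; first exact: ind.
  by rewrite addrAC; exact: ind.
have h2 : h ^+ 2 != 0 by rewrite expf_neq0 // gt_eqF.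
have E12 : f (x + h *: v + h *: w) - f (x + h *: v) - f (x + h *: w) + f x =
    f (x + h *: w + h *: v) - f (x + h *: w) - f (x + h *: v) + f x.
  by rewrite [x + h *: w + _]addrAC; ring.
move: E1 E2; rewrite E12 => ->; exact: mulfI.
Qed.

Lemma derive0_connected (E : normedModType R) (A C : set E) (f : E -> R) :
  open A -> (forall x v, A x -> is_derive x v f 0) -> C `<=` A -> connected C ->
  forall x y, C x -> C y -> f y = f x.
Proof.
move=> oA df CA cC x y Cx Cy.
apply: (connected_locally_constant (P := fun z => f z = f x) cC _ Cx Cy) => // z Cz.
apply: (@cvg_within _ (nbhs z)).
have [r /= r0 Hr] := (nbhs_ballP _ _).1 (open_nbhs_nbhs (conj oA (CA _ Cz))).
apply/nbhs_ballP; exists r => // u zu /=.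
suff -> : f u = f z by [].
apply/eqP; rewrite -subr_eq0 -[u](subrK z) [u - z + z]addrC.
have [h /andP[h0 h1]|c _ ->//] := @MVT_line R E f (fun=> 0) z (u - z).
apply: df; apply: Hr; rewrite -ball_normE /= opprD addNKr normrN normrZ.
rewrite -ball_normE /= in zu; rewrite distrC in zu; apply: le_lt_trans zu.
by rewrite ger0_norm // ler_piMl.
Qed.

End SmoothExamples.

(** * Monodromy of local systems *)

Section Intervals.
Context {R : realType}.

(** The retraction of the line onto the interval from a to b, by which functions on
    the interval are extended. *)
Definition clamp (a b t : R) : R := Num.max a (Num.min b t).

Lemma clamp_in a b t : a <= b -> a <= clamp a b t <= b.
Proof. by move=> ab; rewrite /clamp le_max lexx /= ge_max ab ge_min lexx. Qed.

Lemma clampE a b t : a <= t <= b -> clamp a b t = t.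
Proof. by move=> /andP[at_ tb]; rewrite /clamp min_r // max_r. Qed.

Lemma clamp_continuous a b : continuous (clamp a b).
Proof.
move=> t; have cmin : {for t, continuous (fun t : R => Num.min b t)}.
  by apply: continuous_min; [exact: cvg_cst | exact: cvg_id].
by apply: continuous_max cmin; exact: cvg_cst.
Qed.

Lemma clamp_dist c r t : 0 < r -> `|clamp (c - r) (c + r) t - c| <= r.
Proof. by move=> r0; rewrite ler_distl clamp_in //; lra. Qed.

Lemma between_dist (c r t s : R) : `|t - c| < r ->
  Num.min c t <= s <= Num.max c t -> `|s - c| < r.
Proof.
rewrite !ltr_distl ge_min le_max => /andP[h1 h2].
by move=> /andP[/orP[?|?] /orP[?|?]]; lra.
Qed.

Lemma between_dist_le (c r t s : R) : `|t - c| <= r ->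
  Num.min c t <= s <= Num.max c t -> `|s - c| <= r.
Proof.
rewrite !ler_distl ge_min le_max => /andP[h1 h2].
by move=> /andP[/orP[?|?] /orP[?|?]]; lra.
Qed.

Lemma segment_between (a t h : R) : 0 <= h <= 1 ->
  Num.min a t <= a + h * (t - a) <= Num.max a t.
Proof. by move=> h01; rewrite ge_min le_max; have [at_|ta] := leP a t; nra. Qed.

End Intervals.

Section Monodromy.
Context {R : realType} {T : normedModType R} {F : Type}.
Variables (U : set T) (P : T -> (T -> F) -> Prop).

Let solves (B : set T) (S : T -> F) := forall x, B x -> P x S.

(** Convexity: unlike connectedness it passes to intersections, which makes two
    local solutions comparable on the whole overlap of their domains. *)
Definition segment_closed (B : set T) :=
  forall y z (t : R), B y -> B z -> 0 <= t <= 1 -> B (y + t *: (z - y)).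

(** Read P x S as: S solves a given problem at x. The problem depends on germs
    only, its solutions on a convex open set are determined by one value, and
    near each point of U every value is attained; in other words the germs of
    solutions form a local system on U with fibre F. *)
Definition locally_trivial : Prop :=
  [/\ forall x S S', (\near x, S x = S' x) -> P x S -> P x S',
      forall B S S' y z, open B -> segment_closed B -> solves B S -> solves B S' ->
        B y -> B z -> S y = S' y -> S z = S' z &
      forall x, U x -> exists B, [/\ open B, segment_closed B, B x, B `<=` U &
        forall y a, B y -> exists2 S, solves B S & S y = a]].

Hypothesis trivP : locally_trivial.

Let solves_sub B B' S : B' `<=` B -> solves B S -> solves B' S.
Proof. by move=> B'B sS x /B'B /sS. Qed.

Let segment_closedI B B' : segment_closed B -> segment_closed B' ->
  segment_closed (B `&` B').
Proof. by move=> sB sB' y z t [By B'y] [Bz B'z] t01; split; [exact: sB | exact: sB']. Qed.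

(** The value of g at s is the value at c s of some solution defined near c s.
    These solutions need not agree when c comes back to the same point: g is a
    function of the parameter, not of the point. *)
Definition lift (X : topologicalType) (D : set X) (c : X -> T) (g : X -> F) :=
  forall s, D s -> exists B S, [/\ open B, segment_closed B, B (c s), solves B S &
    \forall s' \near within D (nbhs s), g s' = S (c s')].

Definition continuous_in (X Y : topologicalType) (D : set X) (c : X -> Y) :=
  forall s, D s -> c @ within D (nbhs s) --> c s.

Section Lifts.
Context {X : topologicalType}.
Implicit Types (D : set X) (c : X -> T) (g : X -> F).

Lemma near_within_self D (s : X) (Q : X -> Prop) : D s ->
  (\forall s' \near within D (nbhs s), Q s') -> Q s.
Proof. by move=> Ds H; apply: (nbhs_singleton H). Qed.

Lemma near_within_sub D D' (s : X) (Q : X -> Prop) : D' `<=` D ->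
  (\forall s' \near within D (nbhs s), Q s') -> \forall s' \near within D' (nbhs s), Q s'.
Proof.
move=> DD' H; have H' : nbhs s (fun s' => D s' -> Q s') := H.
by apply: (filterS _ H') => s' Qs' /DD'.
Qed.

Lemma near_within_open D c (s : X) (B : set T) : continuous_in D c -> D s -> open B ->
  B (c s) -> \forall s' \near within D (nbhs s), B (c s').
Proof. by move=> cc Ds oB Bcs; exact: (cc s Ds B (open_nbhs_nbhs (conj oB Bcs))). Qed.

Lemma near_within_D D (s : X) : \forall s' \near within D (nbhs s), D s'.
Proof. by apply: (@filterE _ (nbhs s)) => ?. Qed.

Lemma lift_unique D c g g' s0 : connected D -> continuous_in D c ->
  lift D c g -> lift D c g' -> D s0 -> g s0 = g' s0 -> forall s, D s -> g s = g' s.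
Proof.
move=> cD cc lg lg' Ds0 gg' s Ds.
apply: (connected_locally_constant (P := fun s => g s = g' s) cD _ Ds0 Ds) => // {}s {}Ds.
have [B [S [oB sB Bs SB nS]]] := lg s Ds.
have [B' [S' [oB' sB' Bs' SB' nS']]] := lg' s Ds.
have gS := near_within_self Ds nS; have gS' := near_within_self Ds nS'.
have nB := near_within_open cc Ds oB Bs; have nB' := near_within_open cc Ds oB' Bs'.
near=> u; have -> : g u = S (c u) by near: u.
have -> : g' u = S' (c u) by near: u.
have Bu : B (c u) by near: u.
have B'u : B' (c u) by near: u.
have [_ uniq _] := trivP.
have S1 : solves (B `&` B') S by apply: solves_sub SB; exact: subIsetl.
have S2 : solves (B `&` B') S' by apply: solves_sub SB'; exact: subIsetr.
have oI := openI oB oB'; have sI := segment_closedI sB sB'.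
by rewrite gS gS'; split; apply: (uniq _ _ _ _ _ oI sI S1 S2).
Unshelve. all: by end_near. Qed.

Lemma lift_sub D D' c g : D' `<=` D -> lift D c g -> lift D' c g.
Proof.
move=> DD' lg s /DD' /lg[B [S [oB sB Bs SB nS]]]; exists B, S; split=> //.
exact: near_within_sub nS.
Qed.

Lemma lift_eq D c c' g : (forall s, D s -> c s = c' s) -> lift D c g -> lift D c' g.
Proof.
move=> cc' lg s Ds; have [B [S [oB sB Bs SB nS]]] := lg s Ds.
exists B, S; split=> //; first by rewrite -cc'.
have nD := near_within_D D s.
by apply: filterS2 nD nS => s' Ds' ->; rewrite cc'.
Qed.

Lemma lift_solution D c B S : open B -> segment_closed B -> solves B S ->
  (forall s, D s -> B (c s)) -> lift D c (S \o c).
Proof.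
by move=> oB sB SB cB s Ds; exists B, S; split; [| |exact: cB| |exact: nearW].
Qed.

Definition liftable D c := forall s a, D s -> exists2 g, lift D c g & g s = a.

Lemma liftable_sub D D' c : D' `<=` D -> liftable D c -> liftable D' c.
Proof.
move=> DD' gD s a D's; have [g lg gs] := gD s a (DD' _ D's).
by exists g => //; exact: lift_sub lg.
Qed.

Lemma liftable_local D c s : continuous_in D c -> D s -> U (c s) ->
  exists2 N, nbhs s N & forall D', D' `<=` D -> D' `<=` N -> liftable D' c.
Proof.
move=> cc Ds Us; have [_ _ /(_ _ Us) [B [oB sB Bs _ surj]]] := trivP.
exists [set u | D u -> B (c u)]; first exact: near_within_open cc Ds oB Bs.
move=> D' D'D D'N u a D'u; have Bu := D'N _ D'u (D'D _ D'u).
have [S SB Sa] := surj _ a Bu; exists (S \o c) => //.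
by apply: lift_solution SB _ => // v D'v; apply: D'N => //; exact: D'D.
Qed.

(** Two lifts that agree at m agree on the connected intersection, and define a map
    on the union. At a point of both pieces the two local solutions coincide on a
    convex set; a point outside one of the pieces stays away from it, as the
    pieces are closed. *)
Lemma liftable_glue D1 D2 c m : closed D1 -> closed D2 -> connected (D1 `&` D2) ->
  D1 m -> D2 m -> continuous_in (D1 `|` D2) c ->
  liftable D1 c -> liftable D2 c -> liftable (D1 `|` D2) c.
Proof.
suff H A1 A2 s a : closed A1 -> closed A2 -> connected (A1 `&` A2) ->
    A1 m -> A2 m -> continuous_in (A1 `|` A2) c ->
    liftable A1 c -> liftable A2 c -> A1 s -> exists2 g, lift (A1 `|` A2) c g & g s = a.
  move=> c1 c2 c12 m1 m2 cc g1 g2 s a [D1s|D2s]; first exact: H.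
  by rewrite setUC; apply: H => //; rewrite 1?setIC 1?setUC.
move=> c1 c2 c12 m1 m2 cc lA1 lA2 A1s.
have [g1 lg1 g1s] := lA1 s a A1s; have [g2 lg2 g2m] := lA2 m (g1 m) m2.
have g12 u : A1 u -> A2 u -> g1 u = g2 u.
  move=> A1u A2u; apply: (lift_unique (D := A1 `&` A2) (s0 := m) c12 _ (g := g1)) => //.
  - move=> v [A1v A2v]; have := cc v (or_introl A1v); apply: cvg_trans.
    by move=> Q /= H; apply: (near_within_sub (D := A1 `|` A2)) H => w [? ?]; left.
  - exact: lift_sub lg1.
  - exact: lift_sub lg2.
exists (fun u => if `[< A1 u >] then g1 u else g2 u); last by rewrite asboolT.
have gE2 u : A2 u -> (if `[< A1 u >] then g1 u else g2 u) = g2 u.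
  by move=> A2u; case: asboolP => // A1u; exact: g12.
have away (A : set X) u : closed A -> ~ A u -> nbhs u (~` A).
  by move=> cA nA; apply: open_nbhs_nbhs; split=> //; exact: closed_openC.
move=> u Du; have [A1u|nA1u] := pselect (A1 u); last first.
  have A2u : A2 u by case: Du.
  have [B [S [oB sB Bs SB nS]]] := lg2 u A2u; exists B, S; split=> //.
  have nS' : nbhs u (fun v => A2 v -> g2 v = S (c v)) := nS.
  have aw := away _ _ c1 nA1u.
  apply: filterS2 aw nS' => v nA1v gv [//|A2v].
  by rewrite gE2 // gv.
have [B [S [oB sB Bs SB nS]]] := lg1 u A1u; exists B, S; split=> //.
have nS' : nbhs u (fun v => A1 v -> g1 v = S (c v)) := nS.
have [A2u|nA2u] := pselect (A2 u); last first.
  have aw := away _ _ c2 nA2u. apply: filterS2 aw nS' => v nA2v gv [A1v|//].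
  by rewrite asboolT // gv.
have [B' [S' [oB' sB' Bs' SB' nS2]]] := lg2 u A2u.
have nS2' : nbhs u (fun v => A2 v -> g2 v = S' (c v)) := nS2.
have nB := near_within_open cc Du oB Bs; have nB' := near_within_open cc Du oB' Bs'.
have SS' : S (c u) = S' (c u).
  by rewrite -(near_within_self A1u nS) -(near_within_self A2u nS2) g12.
have nI : nbhs u (fun v => (A1 `|` A2) v -> B (c v) /\ B' (c v)).
  have nB1 : nbhs u (fun v => (A1 `|` A2) v -> B (c v)) := nB.
  have nB2 : nbhs u (fun v => (A1 `|` A2) v -> B' (c v)) := nB'.
  by apply: filterS2 nB1 nB2 => v Bv B'v Dv; split; [exact: Bv | exact: B'v].
apply: (filterS _ (filterI nS' (filterI nS2' nI))) => v [g1v [g2v BBv]] A12v.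
have [A1v|nA1v] := pselect (A1 v); first by rewrite asboolT // g1v.
have A2v : A2 v by case: A12v.
rewrite gE2 // g2v //; have [Bv B'v] := BBv A12v.
have [_ uniq _] := trivP; symmetry.
apply: (uniq (B `&` B') S S' (c u)) => //.
- exact: openI.
- exact: segment_closedI.
- by apply: solves_sub SB; exact: subIsetl.
- by apply: solves_sub SB'; exact: subIsetr.
Qed.

End Lifts.

Lemma lift_comp (X X' : topologicalType) (D : set X) (D' : set X') (c : X -> T)
    (k : X -> F) (phi : X' -> X) : continuous phi -> (forall s, D' s -> D (phi s)) ->
  lift D c k -> lift D' (c \o phi) (k \o phi).
Proof.
move=> cphi DD' lk s D's; have [B [S [oB sB Bs SB nS]]] := lk _ (DD' _ D's).
exists B, S; split=> //.
have nS' : nbhs (phi s) (fun v => D v -> k v = S (c v)) := nS.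
have H : nbhs s (fun u => D (phi u) -> k (phi u) = S (c (phi u))) := cphi s _ nS'.
by apply: (filterS _ H) => u Hu D'u; exact: Hu (DD' _ D'u).
Qed.

(** The points b with Q 0 b form an open and closed subset of the interval. *)
Lemma interval_induction (Q : R -> R -> Prop) :
  (forall a b c, 0 <= a -> a <= b -> b <= c -> c <= 1 -> Q a b -> Q b c -> Q a c) ->
  (forall a b a' b', 0 <= a -> a <= a' -> a' <= b' -> b' <= b -> b <= 1 ->
     Q a b -> Q a' b') ->
  (forall x, 0 <= x <= 1 -> exists2 d, 0 < d &
     forall a b, 0 <= a -> b <= 1 -> x - d < a -> a <= b -> b < x + d -> Q a b) ->
  Q 0 1.
Proof.
move=> Qadd Qsub Qloc.
have lc (x : R) : `[0, 1]%classic x ->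
    \forall y \near within `[0, 1]%classic (nbhs x), Q 0 y <-> Q 0 x.
  rewrite /= in_itv /= => x01; have [d d0 Qd] := Qloc x x01.
  case/andP: (x01) => x0 x1.
  suff H : nbhs x (fun y => `[0, 1]%classic y -> (Q 0 y <-> Q 0 x)) by exact: H.
  apply/nbhs_ballP; exists d => // y; rewrite -ball_normE /= => xyd.
  rewrite in_itv /= => /andP[y0 y1]; move: xyd; rewrite ltr_distl => /andP[xd yd].
  have [xy|/ltW yx] := leP x y; split=> H.
  - exact: (Qsub 0 y).
  - by apply: (Qadd _ x) => //; apply: Qd => //; lra.
  - by apply: (Qadd _ y) => //; apply: Qd => //; lra.
  - exact: (Qsub 0 x).
have Q00 : Q 0 0.
  have [d d0 Qd] := Qloc 0 (introT andP (conj (lexx 0) ler01)).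
  by apply: Qd => //; lra.
by apply: (connected_locally_constant (@segment_connected R 0 1) lc _ _ Q00);
  rewrite /= in_itv /= ?lexx ?ler01.
Qed.

Let seg (a b : R) : set R := `[a, b]%classic.

Let segE a b x : seg a b x = (a <= x <= b) :> Prop.
Proof. by rewrite /seg /= in_itv. Qed.

Let closed_seg a b : closed (seg a b).
Proof. exact: interval_closed. Qed.

Let rect (a b c d : R) := [set x : R * R | a <= x.1 <= b /\ c <= x.2 <= d].

Let closed_rect a b c d : closed (rect a b c d).
Proof.
have -> : rect a b c d = fst @^-1` `[a, b]%classic `&` snd @^-1` `[c, d]%classic.
  by apply/seteqP; split=> x /=; rewrite !in_itv.
by apply: closedI; apply: closed_comp => //;
  try exact: interval_closed; move=> ? _; [exact: cvg_fst | exact: cvg_snd].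
Qed.

Let connected_line (phi : R -> R * R) a b : continuous phi ->
  connected (phi @` seg a b).
Proof.
move=> cphi; apply: connected_continuous_connected; first exact: segment_connected.
exact: continuous_subspaceT.
Qed.

Let continuous_in_sub (X Y : topologicalType) (D D' : set X) (c : X -> Y) :
  D' `<=` D -> continuous_in D c -> continuous_in D' c.
Proof.
move=> D'D cc s D's; apply: cvg_trans (cc s (D'D _ D's)).
by move=> Q /= H; apply: (near_within_sub D'D) H.
Qed.

Let pairl_continuous (x : R) : continuous (fun y : R => (x, y)).
Proof.
move=> y; have h1 : (fun=> x) @ y --> x by exact: cvg_cst.
have h2 : id @ y --> y by exact: cvg_id.
exact: (cvg_pair h1 h2).
Qed.

Let pairr_continuous (y : R) : continuous (fun x : R => (x, y)).
Proof.
move=> x; have h1 : (fun=> y) @ x --> y by exact: cvg_cst.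
have h2 : id @ x --> x by exact: cvg_id.
exact: (cvg_pair h2 h1).
Qed.

(** Short pieces stay in one trivializing set, and consecutive pieces meet in one
    point. *)
Lemma path_liftable (c : R -> T) : continuous_in (seg 0 1) c ->
  c @` (seg 0 1) `<=` U -> liftable (seg 0 1) c.
Proof.
move=> cc cU; apply: (interval_induction (Q := fun a b => liftable (seg a b) c)).
- move=> a b d a0 ab bd d1 Qab Qbd.
  have -> : (seg a d) = (seg a b) `|` (seg b d).
    apply/seteqP; split=> x; rewrite ?/setU ?/setI /= !segE; last by case; lra.
    by move=> /andP[ax xd]; have [xb|bx] := leP x b; [left | right]; rewrite ?ax ?xd ?xb ?(ltW bx).
  apply: (@liftable_glue _ _ _ _ b); try exact: closed_seg.
  + have -> : (seg a b) `&` (seg b d) = [set b].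
      apply/seteqP; split=> x; rewrite ?/setU ?/setI /= !segE; last by move=> ->; rewrite !lexx ab bd.
      by case=> /andP[_ xb] /andP[bx _]; apply: le_anti; rewrite xb bx.
    exact: connected1.
  + by rewrite segE lexx ab.
  + by rewrite segE lexx bd.
  + apply: continuous_in_sub cc => x; rewrite ?/setU ?/setI /= !segE; case; lra.
  + exact: Qab.
  + exact: Qbd.
- move=> a b a' b' a0 aa' ab' bb' b1 Qab.
  apply: (liftable_sub (D := (seg a b))).
    by move=> x; rewrite ?/setU ?/setI /= !segE; lra.
  exact: Qab.
- move=> x x01; have x01' : (seg 0 1) x by rewrite segE.
  have [|N nN HN] := liftable_local cc x01'; first by apply: cU; exists x.
  have [d /= d0 Hd] := (nbhs_ballP _ _).1 nN; exists d => // a b a0 b1 xa ab xb.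
  apply: HN => y /=; rewrite !segE; first by lra.
  by move=> yab; apply: Hd; rewrite -ball_normE /= ltr_distl; lra.
Qed.

(** The square is cut into vertical strips, and each strip into small rectangles;
    consecutive pieces meet in a segment. *)
Lemma homotopy_liftable (h : R * R -> T) :
  continuous_in (seg 0 1 `*` (seg 0 1)) h ->
  h @` (seg 0 1 `*` (seg 0 1)) `<=` U ->
  liftable (seg 0 1 `*` (seg 0 1)) h.
Proof.
have -> : (seg 0 1) `*` (seg 0 1) = rect 0 1 0 1.
  by apply/seteqP; split=> x; rewrite ?/setU ?/setI /= !segE.
move=> ch hU.
apply: (interval_induction (Q := fun a b => liftable (rect a b 0 1) h)).
- move=> a b d a0 ab bd d1 Qab Qbd.
  have -> : rect a d 0 1 = rect a b 0 1 `|` rect b d 0 1.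
    apply/seteqP; split=> x /=; last by case=> -[]; rewrite /rect /=; lra.
    by move=> [/andP[ax xd] x2]; have [xb|bx] := leP x.1 b; [left | right];
      rewrite /rect /= ?ax ?xd ?xb ?(ltW bx).
  apply: (@liftable_glue _ _ _ _ (b, 0)); try exact: closed_rect.
  + have -> : rect a b 0 1 `&` rect b d 0 1 = (fun y => (b, y)) @` (seg 0 1).
      apply/seteqP; split=> [[x y] [[/= /andP[_ xb] y01] [/= /andP[bx _] _]]|z [y]].
        by exists y; rewrite /= ?segE //; congr pair; apply: le_anti; rewrite xb bx.
      by rewrite segE => y01 <-; split; rewrite /rect /= y01 ?ab ?bd lexx.
    exact: connected_line.
  + by rewrite /rect /= lexx ab ler01 lexx.
  + by rewrite /rect /= lexx bd ler01 lexx.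
  + by apply: continuous_in_sub ch => x [] []; rewrite /rect /=; lra.
  + exact: Qab.
  + exact: Qbd.
- move=> a b a' b' a0 aa' ab' bb' b1 Qab.
  apply: (liftable_sub (D := rect a b 0 1)); last exact: Qab.
  by move=> x []; rewrite /rect /=; lra.
move=> x x01; pose J d : set (R * R) := rect (Num.max 0 (x - d)) (Num.min 1 (x + d)) 0 1.
pose strip d c c' := rect (Num.max 0 (x - d)) (Num.min 1 (x + d)) c c'.
have maxmin d : 0 < d -> Num.max 0 (x - d) <= x <= Num.min 1 (x + d).
  by move=> d0; rewrite ge_max le_min; lra.
have strip_sub d c c' : 0 <= c -> c' <= 1 -> strip d c c' `<=` rect 0 1 0 1.
  by move=> c0 c1 y []; rewrite /rect /= ge_max le_min; lra.
suff [d d0 Hd] : exists2 d, 0 < d & liftable (strip d 0 1) h.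
  exists d => // a b a0 b1 xa ab xb; apply: liftable_sub Hd => y [].
  by rewrite /strip /rect /= ge_max le_min; lra.
apply: (interval_induction (Q := fun c c' =>
  exists2 d, 0 < d & liftable (strip d c c') h)).
- move=> a b c a0 ab bc c1 [d1 d10 Hd1] [d2 d20 Hd2].
  pose d := Num.min d1 d2; have d0 : 0 < d by rewrite lt_min d10.
  have [dd1 dd2] : d <= d1 /\ d <= d2 by split; rewrite ge_min lexx ?orbT.
  exists d => //.
  have -> : strip d a c = strip d a b `|` strip d b c.
    apply/seteqP; split=> y /=; last by case=> -[]; rewrite /strip /rect /=; lra.
    by move=> [y1 /andP[ay yc]]; have [yb|yb] := leP y.2 b; [left | right];
      rewrite /strip /rect /= ?ay ?yc ?yb ?(ltW yb).
  apply: (@liftable_glue _ _ _ _ (x, b)); try exact: closed_rect.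
  + have -> : strip d a b `&` strip d b c = (fun y => (y, b)) @`
        (seg (Num.max 0 (x - d)) (Num.min 1 (x + d))).
      apply/seteqP; split=> [[u v] [[/= uI /andP[_ vb]] [_ /= /andP[bv _]]]|z [y]].
        by exists u; rewrite /= ?segE //; congr pair; apply: le_anti; rewrite vb bv.
      by rewrite segE => yI <-; split; rewrite /strip /rect /= yI ?ab ?bc lexx.
    exact: connected_line.
  + by rewrite /strip /rect /= maxmin // lexx ab.
  + by rewrite /strip /rect /= maxmin // lexx bc.
  + apply: continuous_in_sub ch => y [] /strip_sub; apply; lra.
  + by apply: liftable_sub Hd1 => y []; rewrite /strip /rect /= !ge_max !le_min; lra.
  + by apply: liftable_sub Hd2 => y []; rewrite /strip /rect /= !ge_max !le_min; lra.
- move=> a b a' b' a0 aa' ab' bb' b1 [d d0 Hd].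
  exists d => //; apply: liftable_sub Hd => y [].
  by rewrite /strip /rect /=; lra.
move=> y y01; have xyI : rect 0 1 0 1 (x, y) by [].
have [|N nN HN] := liftable_local ch xyI; first by apply: hU; exists (x, y).
have [d /= d0 Hd] := (nbhs_ballP _ _).1 nN; exists d => // a b a0 b1 ya ab yb.
exists (d / 2); first by rewrite divr_gt0.
apply: HN => z /=; first by apply: strip_sub.
move=> [z1 z2]; apply: Hd; split; rewrite -ball_normE /= ltr_distl.
  by move: z1; rewrite ge_max le_min; lra.
by lra.
Qed.

Let within_continuous_in (X Y : topologicalType) (D : set X) (c : X -> Y) :
  {within D, continuous c} -> continuous_in D c.
Proof. by move/subspace_continuousP. Qed.

Let continuous_continuous_in (X Y : topologicalType) (D : set X) (c : X -> Y) :
  continuous c -> continuous_in D c.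
Proof. by move=> cc s Ds; apply: cvg_within_filter; exact: cc. Qed.

Let lift_cst (X : topologicalType) (D : set X) x (a : F) : U x ->
  lift D (fun=> x) (fun=> a).
Proof.
move=> Ux s Ds; have [_ _ /(_ _ Ux) [B [oB sB Bx _ surj]]] := trivP.
by have [S SB Sx] := surj _ a Bx; exists B, S; split=> //; apply: nearW => ?.
Qed.

Let lift_end (c : R -> T) g g' : continuous_in (seg 0 1) c ->
  lift (seg 0 1) c g -> lift (seg 0 1) c g' -> g 0 = g' 0 -> g 1 = g' 1.
Proof.
move=> cc lg lg' g0; apply: (lift_unique _ cc lg lg' _ g0).
- exact: segment_connected.
- by rewrite segE lexx ler01.
- by rewrite segE lexx ler01.
Qed.

(** The lift of the homotopy is constant along the three sides of the square that
    go to the base point. *)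
Lemma null_homotopic_lift x (c : R -> T) g : continuous_in (seg 0 1) c ->
  null_homotopic_in U x c -> U x -> lift (seg 0 1) c g -> g 1 = g 0.
Proof.
move=> cc [h [ch hU h0 h1 hb]] Ux lg.
have I0 : seg 0 1 0 by rewrite segE lexx ler01.
have I1 : seg 0 1 1 by rewrite segE lexx ler01.
have [|H lH H00] := homotopy_liftable (within_continuous_in ch) hU (s := (0, 0)) (g 0).
  by split; exact: I0.
have cst_side (phi : R -> R * R) : continuous phi ->
    (forall s, seg 0 1 s -> (`[0, 1]%classic `*` `[0, 1]%classic) (phi s)) ->
    (forall s, seg 0 1 s -> h (phi s) = x) -> H (phi 0) = H (phi 1).
  move=> cphi phiI hphi; symmetry.
  have l1 := lift_eq hphi (lift_comp cphi phiI lH).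
  have l2 := lift_cst (D := seg 0 1) (H (phi 0)) Ux.
  apply: (lift_end _ l1 l2) => //.
  by apply: continuous_continuous_in => ?; exact: cvg_cst.
have top := cst_side _ (@pairr_continuous 1).
have bot := cst_side _ (@pairr_continuous 0).
have right := cst_side _ (@pairl_continuous 1).
have l0 : lift (seg 0 1) c (H \o pair 0).
  apply: lift_eq (lift_comp (@pairl_continuous 0) _ lH).
  - by move=> s sI /=; rewrite h0.
  - by move=> s sI; split; [exact: I0 | exact: sI].
rewrite (lift_end cc lg l0) /=; last by rewrite H00.
rewrite top; last 2 first.
- by move=> s sI; split; [exact: sI | exact: I1].
- by move=> s sI; have [] := hb s sI.
rewrite -H00 bot; last 2 first.
- by move=> s sI; split; [exact: sI | exact: I0].
- by move=> s sI; have [] := hb s sI.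
by rewrite right.
Qed.

Let clamp01 : R -> R := clamp 0 1.

Let clamp_le0 s : s <= 0 -> clamp01 s = 0.
Proof. by move=> s0; rewrite /clamp01 /clamp max_l // ge_min s0 orbT. Qed.

Let clamp_ge1 s : 1 <= s -> clamp01 s = 1.
Proof. by move=> s1; rewrite /clamp01 /clamp min_l // max_r. Qed.

Let clamp_in01 s : seg 0 1 (clamp01 s).
Proof. by rewrite segE clamp_in. Qed.

Let comp_clamp_continuous (c : R -> T) : continuous_in (seg 0 1) c ->
  continuous (c \o clamp01).
Proof.
move=> cc s; have cl := (@clamp_continuous R 0 1 s : {for s, continuous clamp01}).
move=> Q /= HQ.
have H : nbhs (clamp01 s) (fun u => seg 0 1 u -> Q (c u)) := cc _ (clamp_in01 s) Q HQ.
have H' : nbhs s (fun u => seg 0 1 (clamp01 u) -> Q (c (clamp01 u))) := cl _ H.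
by apply: (filterS _ H') => u Hu; exact: (Hu (clamp_in01 u)).
Qed.

(** The concatenation of c1 and c2, written as a sum so that its continuity is
    that of a sum: each summand is constant on one of the halves. *)
Let concat (c1 c2 : R -> T) (s : R) : T :=
  c1 (clamp01 (2 * s)) + (c2 (clamp01 (2 * s - 1)) - c1 1).

Let concat_continuous c1 c2 : continuous_in (seg 0 1) c1 ->
  continuous_in (seg 0 1) c2 -> continuous (concat c1 c2).
Proof.
move=> cc1 cc2 s.
have c1s : {for s, continuous (fun s : R => 2 * s)}.
  by apply: cvgM; [exact: cvg_cst | exact: cvg_id].
have c2s : {for s, continuous (fun s : R => 2 * s - 1)}.
  by apply: cvgB; [exact: c1s | exact: cvg_cst].
have d1 := continuous_comp c1s (@comp_clamp_continuous _ cc1 _).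
have d2 := continuous_comp c2s (@comp_clamp_continuous _ cc2 _).
by apply: (cvgD d1); apply: cvgB; [exact: d2 | exact: cvg_cst].
Qed.

Let concat_left c1 c2 s : c1 1 = c2 0 -> 0 <= s <= 1 -> concat c1 c2 (s / 2) = c1 s.
Proof.
move=> c12 s01; rewrite /concat mulrC divfK // /clamp01 clampE // -/clamp01 clamp_le0; last by lra.
by rewrite -c12 subrr addr0.
Qed.

Let concat_right c1 c2 s : 0 <= s <= 1 -> concat c1 c2 ((1 + s) / 2) = c2 s.
Proof.
move=> s01; rewrite /concat mulrC divfK // clamp_ge1; last by lra.
by rewrite addrAC subrr add0r /clamp01 clampE // addrC subrK.
Qed.

Let concat_in (A : set T) c1 c2 : c1 1 = c2 0 ->
  (forall s, seg 0 1 s -> A (c1 s)) -> (forall s, seg 0 1 s -> A (c2 s)) ->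
  forall s, seg 0 1 s -> A (concat c1 c2 s).
Proof.
move=> c12 A1 A2 s; rewrite segE => s01.
have [s1|s1] := leP s (1 / 2).
  have -> : s = (2 * s) / 2 by rewrite mulrC mulKf.
  by rewrite concat_left //; [apply: A1; rewrite segE; lra | lra].
have -> : s = (1 + (2 * s - 1)) / 2 by lra.
by rewrite concat_right //; [apply: A2; rewrite segE; lra | lra].
Qed.

Let half_continuous (a b : R) : continuous (fun s : R => (a + b * s) / 2).
Proof.
move=> s; apply: cvgM; last exact: cvg_cst.
by apply: cvgD; [exact: cvg_cst | apply: cvgM; [exact: cvg_cst | exact: cvg_id]].
Qed.

(** The two halves of k lift the two paths, and the first half is g1 by uniqueness. *)
Let lift_concat c1 c2 g1 k : c1 1 = c2 0 -> continuous_in (seg 0 1) c1 ->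
  lift (seg 0 1) c1 g1 -> lift (seg 0 1) (concat c1 c2) k -> k 0 = g1 0 ->
  exists k2, [/\ lift (seg 0 1) c2 k2, k2 0 = g1 1 & k2 1 = k 1].
Proof.
move=> c12 cc1 lg1 lk k0.
have l1 : lift (seg 0 1) c1 (k \o (fun s => (0 + 1 * s) / 2)).
  apply: lift_eq (lift_comp (@half_continuous 0 1) _ lk).
    by move=> s; rewrite segE /= add0r mul1r; exact: concat_left.
  by move=> s; rewrite !segE; lra.
have l2 : lift (seg 0 1) c2 (k \o (fun s => (1 + 1 * s) / 2)).
  apply: lift_eq (lift_comp (@half_continuous 1 1) _ lk).
    by move=> s; rewrite segE /= mul1r; exact: concat_right.
  by move=> s; rewrite !segE; lra.
exists (k \o (fun s => (1 + 1 * s) / 2)); split=> //=.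
  rewrite (lift_end cc1 lg1 l1) /= ?mul1r ?mulr0 ?addr0 ?add0r ?mul0r //.
by congr k; lra.
Qed.

(** The value at x is transported from x0 along any path: two paths to x give the
    same value, since the first one followed by the reverse of the second is a
    null-homotopic loop. Near x the function so obtained is a local solution,
    because a path to x may be prolonged by segments in a convex neighbourhood. *)
Theorem monodromy x0 a : simply_connected R U -> U x0 ->
  exists G, (forall x, U x -> P x G) /\ G x0 = a.
Proof.
move=> [connU loopU] Ux0.
have pathP x y c : path_in U x y c ->
    [/\ continuous_in (seg 0 1) c, forall s, seg 0 1 s -> U (c s), c 0 = x & c 1 = y].
  move=> [/within_continuous_in cc cU c0 c1]; split=> // s sI.
  by apply: cU; exists s.
have path_of x y c : continuous c -> (forall s, seg 0 1 s -> U (c s)) ->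
    c 0 = x -> c 1 = y -> path_in U x y c.
  move=> cc cU c0 c1; split=> //; first exact: continuous_subspaceT.
  by move=> _ [s sI <-]; exact: cU.
have I0 : seg 0 1 0 by rewrite segE lexx ler01.
have lift_path x y c b : path_in U x y c -> exists2 g, lift (seg 0 1) c g & g 0 = b.
  move=> /pathP[cc cU _ _]; apply: path_liftable => //.
  by move=> _ [s sI <-]; exact: cU.
(* The loop l follows c and comes back along c'; its lift k closes up. *)
have end_unique x c c' g g' : path_in U x0 x c -> path_in U x0 x c' ->
    lift (seg 0 1) c g -> lift (seg 0 1) c' g' -> g 0 = a -> g' 0 = a -> g 1 = g' 1.
  move=> pc pc' lg lg' g0 g'0.
  have [cc cU c0 c1] := pathP _ _ _ pc; have [cc' cU' c0' c1'] := pathP _ _ _ pc'.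
  pose r s := (2 + (-2) * s) / 2 : R.
  have rE s : r s = 1 - s by rewrite /r; lra.
  have cr : continuous r by exact: half_continuous.
  have rI s : seg 0 1 s -> seg 0 1 (r s) by rewrite !segE rE; lra.
  pose l := concat c (c' \o r).
  have cr' : continuous_in (seg 0 1) (c' \o r).
    move=> s sI Q HQ; have H : nbhs (r s) (fun u => seg 0 1 u -> Q (c' u)) := cc' _ (rI _ sI) Q HQ.
    have H' : nbhs s (fun u => seg 0 1 (r u) -> Q (c' (r u))) := cr s _ H.
    by apply: (filterS _ H') => u Hu uI; exact: Hu (rI _ uI).
  have c12 : c 1 = (c' \o r) 0 by rewrite /= rE subr0 c1 c1'.
  have lx0 : l 0 = x0.
    by have := concat_left c12 (introT andP (conj (lexx 0) ler01)); rewrite mul0r c0.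
  have lx1 : l 1 = x0.
    have := concat_right c (c' \o r) (introT andP (conj ler01 (lexx 1))).
    by rewrite -/l divff //= rE subrr c0'.
  have pl : path_in U x0 x0 l.
    apply: path_of => //; first exact: concat_continuous.
    by apply: (@concat_in U c (c' \o r)) => // s sI; exact: (cU' _ (rI _ sI)).
  have [k lk k0] := lift_path _ _ _ a pl.
  have [k2 [lk2 k20 k21]] := lift_concat c12 cc lg lk (etrans k0 (esym g0)).
  have k1 : k 1 = a.
    have [cl _ _ _] := pathP _ _ _ pl.
    by rewrite (null_homotopic_lift cl (loopU _ _ Ux0 pl) Ux0 lk).
  have lk2r : lift (seg 0 1) c' (k2 \o r).
    apply: lift_eq (lift_comp cr _ lk2) => // s sI /=.
    by congr c'; rewrite !rE; lra.
  have := lift_end cc' lk2r lg'; rewrite /= !rE subr0 subrr k20 => -> //.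
  by rewrite k21 k1.
have /choice[G GP] : forall x, exists b, U x ->
    exists c g, [/\ path_in U x0 x c, lift (seg 0 1) c g, g 0 = a & g 1 = b].
  move=> x; have [Ux|nUx] := pselect (U x); last by exists a.
  have [c pc] := connU _ _ Ux0 Ux; have [g lg g0] := lift_path _ _ _ a pc.
  by exists (g 1) => _; exists c, g.
have GE x c g : U x -> path_in U x0 x c -> lift (seg 0 1) c g -> g 0 = a -> G x = g 1.
  move=> Ux pc lg g0; have [c' [g' [pc' lg' g'0 <-]]] := GP x Ux.
  exact: end_unique pc' pc lg' lg g'0 g0.
exists G; split=> [x Ux|]; last first.
  have pc : path_in U x0 x0 (fun _ : R => x0).
    have cc : continuous (fun _ : R => x0) by move=> ?; exact: cvg_cst.
    exact: (path_of _ _ _ cc).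
  by rewrite (GE _ _ _ Ux0 pc (lift_cst a Ux0)).
have [germ _ /(_ _ Ux) [B [oB sB Bx BU surj]]] := trivP.
have [S SB Sx] := surj x (G x) Bx.
apply: (germ _ S); last exact: SB.
have nB : nbhs x B by exact: open_nbhs_nbhs.
apply: filterS nB => y By; have Uy := BU _ By.
have [c [g [pc lg g0 g1]]] := GP x Ux; have [cc cU c0 c1] := pathP _ _ _ pc.
pose e s := x + s *: (y - x) : T.
have ce : continuous e.
  move=> s; apply: cvgD; first exact: cvg_cst.
  by apply: cvgZl; exact: cvg_id.
have eB s : seg 0 1 s -> B (e s) by rewrite segE => s01; exact: sB.
have e0 : c 1 = e 0 by rewrite /e scale0r addr0.
have e1 : e 1 = y by rewrite /e scale1r addrC subrK.
have pl : path_in U x0 y (concat c e).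
  apply: path_of; first by apply: concat_continuous => //; exact: continuous_continuous_in.
  - by apply: (@concat_in U c e) => // s sI; exact: (BU _ (eB _ sI)).
  - by have := concat_left e0 (introT andP (conj (lexx 0) ler01)); rewrite mul0r c0.
  - have := concat_right c e (introT andP (conj ler01 (lexx 1))).
    by rewrite divff // e1.
have [k lk k0] := lift_path _ _ _ a pl.
have [k2 [lk2 k20 k21]] := lift_concat e0 cc lg lk (etrans k0 (esym g0)).
rewrite (GE _ _ _ Uy pl lk k0) -k21.
have lS : lift (seg 0 1) e (S \o e) := (lift_solution oB sB SB eB).
have ce' : continuous_in (seg 0 1) e by exact: continuous_continuous_in.
have := lift_end ce' lS lk2; rewrite /= e1 => -> //.
by rewrite k20 g1 -Sx -e0 c1.
Qed.

End Monodromy.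

(** * The algebra of quaternions *)

Section QuaternionAlgebra.
Context {R : realType}.
Implicit Types x y z : quat R.

Lemma quatP x y : qre x = qre y -> qi x = qi y -> qj x = qj y -> qk x = qk y -> x = y.
Proof.
move=> h0 h1 h2 h3; apply/rowP => i.
have : i \in enum 'I_4 by rewrite mem_enum.
by case: i => -[|[|[|[|]]]] // lt _;
  [move: h0 | move: h1 | move: h2 | move: h3]; rewrite /qre /qi /qj /qk;
  congr (x 0 _ = y 0 _); apply: val_inj.
Qed.

Lemma mkquatE (a b c d : R) : (qre (mkquat a b c d) = a) * (qi (mkquat a b c d) = b) *
  (qj (mkquat a b c d) = c) * (qk (mkquat a b c d) = d).
Proof. by rewrite /qre /qi /qj /qk !mxE. Qed.

Lemma quatDE x y : (qre (x + y) = qre x + qre y) * (qi (x + y) = qi x + qi y) *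
  (qj (x + y) = qj x + qj y) * (qk (x + y) = qk x + qk y).
Proof. by rewrite /qre /qi /qj /qk !mxE. Qed.

Lemma quatNE x : (qre (- x) = - qre x) * (qi (- x) = - qi x) *
  (qj (- x) = - qj x) * (qk (- x) = - qk x).
Proof. by rewrite /qre /qi /qj /qk !mxE. Qed.

Lemma quatZE (a : R) x : (qre (a *: x) = a * qre x) * (qi (a *: x) = a * qi x) *
  (qj (a *: x) = a * qj x) * (qk (a *: x) = a * qk x).
Proof. by rewrite /qre /qi /qj /qk !mxE. Qed.

Lemma quat0E : (qre (0 : quat R) = 0) * (qi (0 : quat R) = 0) *
  (qj (0 : quat R) = 0) * (qk (0 : quat R) = 0).
Proof. by rewrite /qre /qi /qj /qk !mxE. Qed.

Definition quatE := (mkquatE, quatDE, quatNE, quatZE, quat0E).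

Lemma qdotE x y : qdot x y = qre x * qre y + qi x * qi y + qj x * qj y + qk x * qk y.
Proof.
rewrite /qdot !big_ord_recl big_ord0 addr0 !addrA /qre /qi /qj /qk.
by congr (_ + x 0 _ * y 0 _ + x 0 _ * y 0 _ + x 0 _ * y 0 _); apply: val_inj.
Qed.

Definition qone : quat R := mkquat 1 0 0 0.

Local Ltac quat_ring := apply: quatP; rewrite /qmul ?/qconj ?/qone ?qdotE !quatE; ring.

Lemma qmulA x y z : x ** (y ** z) = x ** y ** z.
Proof. quat_ring. Qed.
Lemma qmulDl x y z : (x + y) ** z = x ** z + y ** z.
Proof. quat_ring. Qed.
Lemma qmulDr x y z : x ** (y + z) = x ** y + x ** z.
Proof. quat_ring. Qed.
Lemma qmulZl (a : R) x y : (a *: x) ** y = a *: (x ** y).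
Proof. quat_ring. Qed.
Lemma qmulZr (a : R) x y : x ** (a *: y) = a *: (x ** y).
Proof. quat_ring. Qed.
Lemma qmulNl x y : (- x) ** y = - (x ** y).
Proof. quat_ring. Qed.
Lemma qmulNr x y : x ** (- y) = - (x ** y).
Proof. quat_ring. Qed.
Lemma qmul1q x : qone ** x = x.
Proof. quat_ring. Qed.
Lemma qmulq1 x : x ** qone = x.
Proof. quat_ring. Qed.
Lemma qmul0q x : 0 ** x = 0.
Proof. quat_ring. Qed.
Lemma qmulq0 x : x ** 0 = 0.
Proof. quat_ring. Qed.
Lemma qconjM x y : qconj (x ** y) = qconj y ** qconj x.
Proof. quat_ring. Qed.
Lemma qconjK x : qconj (qconj x) = x.
Proof. by apply: quatP; rewrite /qconj !quatE; ring. Qed.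
Lemma qmul_conj x : x ** qconj x = qdot x x *: qone.
Proof. quat_ring. Qed.
Lemma qconj_mul x : qconj x ** x = qdot x x *: qone.
Proof. quat_ring. Qed.
Lemma qdotC x y : qdot x y = qdot y x.
Proof. by rewrite !qdotE; ring. Qed.
Lemma qdotDl x y z : qdot (x + y) z = qdot x z + qdot y z.
Proof. by rewrite !qdotE !quatE; ring. Qed.
Lemma qdotZl (a : R) x y : qdot (a *: x) y = a * qdot x y.
Proof. by rewrite !qdotE !quatE; ring. Qed.
Lemma qdotNl x y : qdot (- x) y = - qdot x y.
Proof. by rewrite !qdotE !quatE; ring. Qed.
Lemma qdotDr x y z : qdot x (y + z) = qdot x y + qdot x z.
Proof. by rewrite !qdotE !quatE; ring. Qed.
Lemma qdotZr (a : R) x y : qdot x (a *: y) = a * qdot x y.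
Proof. by rewrite !qdotE !quatE; ring. Qed.
Lemma qdotNr x y : qdot x (- y) = - qdot x y.
Proof. by rewrite !qdotE !quatE; ring. Qed.
Lemma qdot_mull x y z : qdot (x ** y) (x ** z) = qdot x x * qdot y z.
Proof. by rewrite !qdotE /qmul !quatE; ring. Qed.
Lemma qdot_conj x y : qdot x y = qre (qconj x ** y).
Proof. by rewrite !qdotE /qmul /qconj !quatE; ring. Qed.

Lemma qdot_eq0 x : qdot x x = 0 -> x = 0.
Proof.
by rewrite qdotE => H; apply: quatP; rewrite !quatE; apply/eqP; rewrite -sqrf_eq0;
  apply/eqP; nra.
Qed.

Lemma quat_coord_le x i : `|x 0 i| <= `|x|.
Proof.
rewrite [leRHS]/Num.Def.normr /= mx_normrE.
exact: (le_bigmax _ (fun ij : 'I_1 * 'I_4 => `|x ij.1 ij.2|) (0, i)).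
Qed.

Lemma quat_norm_le x (M : R) : `|qre x| <= M -> `|qi x| <= M -> `|qj x| <= M ->
  `|qk x| <= M -> `|x| <= M.
Proof.
move=> h0 h1 h2 h3; rewrite [leLHS]/Num.Def.normr /= mx_normrE.
apply: bigmax_le => [|[i j] _ /=]; first exact: le_trans h0.
rewrite ord1; case: j => -[|[|[|[|]]]] // lt;
  [move: h0 | move: h1 | move: h2 | move: h3]; apply: le_trans;
  by rewrite le_eqVlt; apply/orP; left; apply/eqP; congr (`|x 0 _|); apply: val_inj.
Qed.

(** The norm of row vectors is the maximum of the coordinates, and each coordinate
    of a product is a sum of four products. *)
Lemma qmul_norm x y : `|x ** y| <= 4 * `|x| * `|y|.
Proof.
have H (a b : 'I_4) : - (`|x| * `|y|) <= x 0 a * y 0 b <= `|x| * `|y|.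
  by rewrite -ler_norml normrM ler_pM // quat_coord_le.
have -> : 4 * `|x| * `|y| = 4 * (`|x| * `|y|) by ring.
move: (`|x| * `|y|) H => M H.
have := (H 0 0, H 0 1, H 0 2%R, H 0 3%R).
have := (H 1 0, H 1 1, H 1 2%R, H 1 3%R).
have := (H 2%R 0, H 2%R 1, H 2%R 2%R, H 2%R 3%R).
have := (H 3%R 0, H 3%R 1, H 3%R 2%R, H 3%R 3%R).
rewrite -![x 0 0]/(qre x) -![x 0 1]/(qi x) -![x 0 2%R]/(qj x) -![x 0 3%R]/(qk x).
rewrite -![y 0 0]/(qre y) -![y 0 1]/(qi y) -![y 0 2%R]/(qj y) -![y 0 3%R]/(qk y).
move=> [[[/andP[? ?] /andP[? ?]] /andP[? ?]] /andP[? ?]].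
move=> [[[/andP[? ?] /andP[? ?]] /andP[? ?]] /andP[? ?]].
move=> [[[/andP[? ?] /andP[? ?]] /andP[? ?]] /andP[? ?]].
move=> [[[/andP[? ?] /andP[? ?]] /andP[? ?]] /andP[? ?]].
by apply: quat_norm_le; rewrite /qmul !quatE ler_norml; lra.
Qed.

End QuaternionAlgebra.

(** * Calculus of quaternion-valued functions *)

Section QuaternionEstimates.
Context {R : realType}.

Lemma is_derive_quatP (E : normedModType R) (f : E -> quat R) x v df :
  is_derive x v f df <-> forall j, is_derive x v (fun y => f y 0 j) (df 0 j).
Proof.
rewrite is_derive_mxP; split=> [H j|H i j]; first exact: H.
by rewrite ord1; exact: H.
Qed.

Lemma quat_MVT (E : normedModType R) (f df : E -> quat R) (x v : E) (M : R) :
  (forall h : R, 0 <= h <= 1 -> is_derive (x + h *: v) v f (df (x + h *: v))) ->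
  (forall h : R, 0 <= h <= 1 -> `|df (x + h *: v)| <= M) ->
  `|f (x + v) - f x| <= M.
Proof.
move=> dfP bf.
have H j : `|f (x + v) 0 j - f x 0 j| <= M.
  apply: (MVT_bound (f := fun y => f y 0 j)) => h h01.
    by have /is_derive_quatP /(_ j) [] := dfP h h01.
  have /is_derive_quatP /(_ j) [_ ->] := dfP h h01.
  by apply: le_trans (bf h h01); exact: quat_coord_le.
by apply: quat_norm_le; rewrite /qre /qi /qj /qk !mxE; exact: H.
Qed.

Lemma quat_MVT1 (f df : R -> quat R) (a t M : R) :
  (forall s, Num.min a t <= s <= Num.max a t -> is_derive s 1 f (df s)) ->
  (forall s, Num.min a t <= s <= Num.max a t -> `|df s| <= M) ->
  `|f t - f a| <= M * `|t - a|.
Proof.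
move=> dfP bf.
have inI (h : R) := @segment_between R a t h.
have -> : t = a + (t - a) by rewrite addrC subrK.
have -> : a + (t - a) - a = t - a by rewrite addrC addKr.
apply: (quat_MVT (df := fun s => (t - a) *: df s)) => h h01.
  have := is_derive_scale (t - a) (dfP _ (inI h h01)); rewrite [_ *: 1]mulr1; exact.
by rewrite normrZ mulrC ler_wpM2r //; apply: bf; exact: inI.
Qed.

(** The integral over [a, x] is meaningful for x > a only, whence the half-line; the
    constant is then adjusted so that the value at b is 0. *)
Lemma antiderivative (f : R -> R) (a b : R) : continuous f ->
  exists F : R -> R, F b = 0 /\ forall t, a < t -> is_derive t 1 F (f t).
Proof.
move=> cf.
pose G (x : R) := (\int[lebesgue_measure]_(s in `[a, x]) f s)%R.
exists (fun x => G x - G b); split=> [|t at_]; first by rewrite subrr.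
have tt : t < t + 1 by lra.
have intf : lebesgue_measure.-integrable `[a, t + 1] (EFin \o f).
  apply: continuous_compact_integrable; first exact: segment_compact.
  exact: continuous_subspaceT.
have [dG GE] := continuous_FTC1_closed tt intf at_ (cf t).
have dGt : is_derive t 1 G (f t).
  by split; [exact: dG | rewrite -derive1E; exact: GE].
have := is_deriveB dGt (is_derive_cst (G b) t 1); rewrite subr0; exact.
Qed.

Lemma quat_antiderivative (f : R -> quat R) (a b : R) : continuous f ->
  exists F : R -> quat R, F b = 0 /\ forall t, a < t -> is_derive t 1 F (f t).
Proof.
move=> cf.
have /choice[F FP] : forall j : 'I_4, exists F : R -> R,
    F b = 0 /\ forall t, a < t -> is_derive t 1 F (f t 0 j).
  move=> j; apply: antiderivative => t.
  exact: (continuous_comp (cf t) (@coord_continuous _ _ _ 0 j _)).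
exists (fun t => \row_j F j t); split=> [|t at_].
  by apply/rowP => j; rewrite !mxE; case: (FP j).
apply/is_derive_quatP => j; have [_ /(_ t at_)] := FP j.
by rewrite (_ : (fun y => _) = F j) //; apply/funext => y; rewrite mxE.
Qed.

Lemma geometric_limit (y : nat -> R) : (forall n, `|y n.+1 - y n| <= 2^-1 ^+ n) ->
  exists z, forall n, `|z - y n| <= 2 * 2^-1 ^+ n.
Proof.
move=> Hy.
have cvgy : cvgn y.
  have -> : y = (fun n => y 0%N + series (telescope y) n).
    by apply/funext => n; rewrite -eq_sum_telescope.
  apply: is_cvgD; first exact: is_cvg_cst.
  apply: normed_cvg; apply: (@series_le_cvg _ _ (geometric 1 2^-1)).
  - by move=> n /=.
  - by move=> n /=; rewrite mul1r exprn_ge0.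
  - by move=> n /=; rewrite mul1r; exact: Hy.
  - by apply: is_cvg_geometric_series; rewrite ger0_norm //; lra.
exists (limn y) => n.
have tail k : `|y (n + k)%N - y n| <= 2 * 2^-1 ^+ n - 2 * 2^-1 ^+ (n + k).
  elim: k => [|k IH]; first by rewrite addn0 !subrr normr0.
  rewrite addnS -(subrK (y (n + k)%N) (y (n + k).+1)) -addrA.
  rewrite (le_trans (ler_normD _ _)) //; have := Hy (n + k)%N; move: IH.
  by rewrite exprS; lra.
apply/ler_addgt0Pl => e e0.
have /cvgrPdist_lt /(_ _ e0) [N _ HN] := cvgy.
have := HN (n + N)%N (leq_addl _ _); have := tail N.
have : 0 <= 2 * 2^-1 ^+ (n + N) :> R by rewrite mulr_ge0 // exprn_ge0.
rewrite /= -[limn y - y n](subrKA (y (n + N)%N)) => h1 h2 h3.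
by rewrite (le_trans (ler_normD _ _)) //; lra.
Qed.

Lemma quat_geometric_limit (y : nat -> quat R) :
  (forall n, `|y n.+1 - y n| <= 2^-1 ^+ n) ->
  exists z, forall n, `|z - y n| <= 2 * 2^-1 ^+ n.
Proof.
move=> Hy.
have /choice[z Hz] : forall j : 'I_4, exists z, forall n, `|z - y n 0 j| <= 2 * 2^-1 ^+ n.
  move=> j; apply: geometric_limit => n; apply: le_trans (Hy n).
  by have := quat_coord_le (y n.+1 - y n) j; rewrite !mxE.
exists (\row_j z j) => n.
by apply: quat_norm_le; rewrite /qre /qi /qj /qk !mxE; exact: Hz.
Qed.

End QuaternionEstimates.

Section QuaternionCalculus.
Context {R : realType} {E : normedModType R}.
Implicit Types (f g : E -> quat R) (x v : E).

Lemma ord4_ind (Q : 'I_4 -> Prop) : Q 0 -> Q 1 -> Q 2%R -> Q 3%R -> forall j, Q j.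
Proof.
move=> q0 q1 q2 q3 [[|[|[|[|//]]]] lt];
  [move: q0 | move: q1 | move: q2 | move: q3]; congr Q; exact: val_inj.
Qed.

Lemma is_derive_qP f x v df : is_derive x v f df <->
  [/\ is_derive x v (fun y => qre (f y)) (qre df), is_derive x v (fun y => qi (f y)) (qi df),
      is_derive x v (fun y => qj (f y)) (qj df) & is_derive x v (fun y => qk (f y)) (qk df)].
Proof.
rewrite is_derive_quatP; split=> [H|[h0 h1 h2 h3]]; first by split; exact: H.
exact: ord4_ind.
Qed.

Lemma continuous_qP (T : topologicalType) (f : T -> quat R) (x : T) : {for x, continuous f} <->
  [/\ {for x, continuous (fun y => qre (f y))}, {for x, continuous (fun y => qi (f y))},
      {for x, continuous (fun y => qj (f y))} & {for x, continuous (fun y => qk (f y))}].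
Proof.
split=> [cf|[h0 h1 h2 h3]].
  by split; exact: (continuous_comp cf (@coord_continuous _ _ _ 0 _ _)).
apply/cvgrPdist_le => e e0.
move/cvgrPdist_le : h0 => /(_ _ e0) h0; move/cvgrPdist_le : h1 => /(_ _ e0) h1.
move/cvgrPdist_le : h2 => /(_ _ e0) h2; move/cvgrPdist_le : h3 => /(_ _ e0) h3.
by near=> y; apply: quat_norm_le; rewrite !quatE; near: y; [exact: h0|exact: h1|exact: h2|exact: h3].
Unshelve. all: by end_near. Qed.

Lemma is_derive_qmul f g x v df dg : is_derive x v f df -> is_derive x v g dg ->
  is_derive x v (fun y => f y ** g y) (df ** g x + f x ** dg).
Proof.
move=> /is_derive_qP[f0 f1 f2 f3] /is_derive_qP[g0 g1 g2 g3].
apply/is_derive_qP; split; rewrite /qmul !quatE; under eq_fun do rewrite !quatE;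
  [have H := is_deriveB (is_deriveB (is_deriveB (is_deriveM f0 g0) (is_deriveM f1 g1))
     (is_deriveM f2 g2)) (is_deriveM f3 g3)
  |have H := is_deriveB (is_deriveD (is_deriveD (is_deriveM f0 g1) (is_deriveM f1 g0))
     (is_deriveM f2 g3)) (is_deriveM f3 g2)
  |have H := is_deriveD (is_deriveD (is_deriveB (is_deriveM f0 g2) (is_deriveM f1 g3))
     (is_deriveM f2 g0)) (is_deriveM f3 g1)
  |have H := is_deriveD (is_deriveB (is_deriveD (is_deriveM f0 g3) (is_deriveM f1 g2))
     (is_deriveM f2 g1)) (is_deriveM f3 g0)];
  by apply: is_derive_eq H _; rewrite /GRing.scale /=; ring.
Qed.

Lemma is_derive_qscale (k : E -> R) f x v dk df : is_derive x v k dk -> is_derive x v f df ->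
  is_derive x v (fun y => k y *: f y) (dk *: f x + k x *: df).
Proof.
move=> k0 /is_derive_qP[f0 f1 f2 f3].
apply/is_derive_qP; split; rewrite !quatE; under eq_fun do rewrite !quatE;
  [have H := is_deriveM k0 f0|have H := is_deriveM k0 f1|have H := is_deriveM k0 f2
  |have H := is_deriveM k0 f3]; by apply: is_derive_eq H _; rewrite /GRing.scale /=; ring.
Qed.

Lemma is_derive_qconj f x v df : is_derive x v f df ->
  is_derive x v (fun y => qconj (f y)) (qconj df).
Proof.
move=> /is_derive_qP[f0 f1 f2 f3]; apply/is_derive_qP.
by split; rewrite /qconj !quatE; under eq_fun do rewrite !quatE; try exact: is_deriveN.
Qed.

Lemma is_derive_qdot f g x v df dg : is_derive x v f df -> is_derive x v g dg ->
  is_derive x v (fun y => qdot (f y) (g y)) (qdot df (g x) + qdot (f x) dg).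
Proof.
move=> /is_derive_qP[f0 f1 f2 f3] /is_derive_qP[g0 g1 g2 g3].
under eq_fun do rewrite qdotE; rewrite !qdotE.
have H := is_deriveD (is_deriveD (is_deriveD (is_deriveM f0 g0) (is_deriveM f1 g1))
    (is_deriveM f2 g2)) (is_deriveM f3 g3).
by apply: is_derive_eq H _; rewrite /GRing.scale /=; ring.
Qed.

Lemma qmul_continuous (T : topologicalType) (f g : T -> quat R) (x : T) :
  {for x, continuous f} -> {for x, continuous g} ->
  {for x, continuous (fun y => f y ** g y)}.
Proof.
move=> /continuous_qP[f0 f1 f2 f3] /continuous_qP[g0 g1 g2 g3].
have C (h h' : T -> R) : {for x, continuous h} -> h =1 h' -> {for x, continuous h'}.
  by move=> ch /funext <-.
apply/continuous_qP; split.
- apply: (C _ _ (cvgB (cvgB (cvgB (cvgM f0 g0) (cvgM f1 g1)) (cvgM f2 g2)) (cvgM f3 g3))).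
  by move=> y; rewrite /qmul !quatE.
- apply: (C _ _ (cvgB (cvgD (cvgD (cvgM f0 g1) (cvgM f1 g0)) (cvgM f2 g3)) (cvgM f3 g2))).
  by move=> y; rewrite /qmul !quatE.
- apply: (C _ _ (cvgD (cvgD (cvgB (cvgM f0 g2) (cvgM f1 g3)) (cvgM f2 g0)) (cvgM f3 g1))).
  by move=> y; rewrite /qmul !quatE.
- apply: (C _ _ (cvgD (cvgB (cvgD (cvgM f0 g3) (cvgM f1 g2)) (cvgM f2 g1)) (cvgM f3 g0))).
  by move=> y; rewrite /qmul !quatE.
Qed.

Section Smooth.
Variable A : set E.
Hypothesis oA : open A.

Lemma smooth_qP f : smooth_on A f <->
  [/\ smooth_on A (fun y => qre (f y)), smooth_on A (fun y => qi (f y)),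
      smooth_on A (fun y => qj (f y)) & smooth_on A (fun y => qk (f y))].
Proof.
rewrite smooth_mxP //; split=> [H|[h0 h1 h2 h3] i]; first by split; exact: H.
by rewrite ord1; exact: ord4_ind.
Qed.

Lemma CkB k (f g : E -> R) : Ck k A f -> Ck k A g -> Ck k A (fun x => f x - g x).
Proof.
move=> Cf Cg; have H := CkD oA Cf (CkM oA (Ck_cst k A (-1 : R)) Cg).
by apply: Ck_eq H => // x _; rewrite mulN1r.
Qed.

Lemma Ck_qP k f : Ck k A f <->
  [/\ Ck k A (fun y => qre (f y)), Ck k A (fun y => qi (f y)),
      Ck k A (fun y => qj (f y)) & Ck k A (fun y => qk (f y))].
Proof.
rewrite Ck_mxP //; split=> [H|[h0 h1 h2 h3] i]; first by split; exact: H.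
by rewrite ord1; exact: ord4_ind.
Qed.

Lemma Ck_qmul k f g : Ck k A f -> Ck k A g -> Ck k A (fun y => f y ** g y).
Proof.
move=> /Ck_qP[f0 f1 f2 f3] /Ck_qP[g0 g1 g2 g3].
have H := CkM oA.
by apply/Ck_qP; split; rewrite /qmul; under eq_fun do rewrite !quatE;
  do ?[first [apply: CkB | apply: CkD] => //]; exact: CkM.
Qed.

Lemma Ck_qscale k (a : E -> R) f : Ck k A a -> Ck k A f -> Ck k A (fun y => a y *: f y).
Proof.
move=> Ca /Ck_qP[f0 f1 f2 f3].
by apply/Ck_qP; split; under eq_fun do rewrite !quatE; exact: CkM.
Qed.

Lemma smooth_qmul f g : smooth_on A f -> smooth_on A g -> smooth_on A (fun y => f y ** g y).
Proof. by move=> sf sg k; exact: Ck_qmul. Qed.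

Lemma smooth_qscale (a : E -> R) f : smooth_on A a -> smooth_on A f ->
  smooth_on A (fun y => a y *: f y).
Proof. by move=> sa sf k; exact: Ck_qscale. Qed.

Lemma smooth_qconj f : smooth_on A f -> smooth_on A (fun y => qconj (f y)).
Proof.
move=> /smooth_qP[f0 f1 f2 f3]; apply/smooth_qP.
by split; rewrite /qconj; under eq_fun do rewrite !quatE; try exact: smoothN.
Qed.

Lemma smooth_qim f : smooth_on A f -> smooth_on A (fun y => qim (f y)).
Proof.
move=> /smooth_qP[f0 f1 f2 f3]; apply/smooth_qP.
by split; rewrite /qim; under eq_fun do rewrite !quatE; [exact: smooth_cst| | |].
Qed.

Lemma smooth_q_deriveD f v w x : smooth_on A f -> A x ->
  'D_(v + w) f x = 'D_v f x + 'D_w f x :> quat R.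
Proof.
move=> sf Ax; have := (smooth_mxP f oA).1 sf => sfij.
have dv u : derivable f x u by exact: smooth_derivable sf Ax.
rewrite !derive_mx //; apply/matrixP => i j; rewrite !mxE.
exact: smooth_deriveD (sfij i j) Ax.
Qed.

Lemma derive_comm_q f v w x : smooth_on A f -> A x -> 'D_w ('D_v f) x = 'D_v ('D_w f) x :> quat R.
Proof.
move=> sf Ax; have := (smooth_mxP f oA).1 sf => sfij.
have D2 u u' i j : ('D_u' ('D_u f) x) i j = 'D_u' ('D_u (fun y => f y i j)) x.
  rewrite derive_mx ?mxE; last exact: smooth_derivable (smooth_derive u sf) Ax.
  apply: near_eq_derive; near=> y.
  rewrite derive_mx ?mxE //; apply: (@smooth_derivable _ _ _ A) => //.
  by near: y; exact: open_nbhs_nbhs.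
apply/matrixP => i j; apply: etrans (D2 _ _ _ _) _; apply: etrans (esym (D2 _ _ _ _)).
exact: derive_comm (sfij i j) Ax.
Unshelve. all: by end_near. Qed.

End Smooth.
End QuaternionCalculus.

(** * Linear differential equations *)

Section PicardIteration.
Context {R : realType}.

Lemma norm_qone : `|qone : quat R| <= 1.
Proof. by apply: quat_norm_le; rewrite /qone !quatE ?normr1 ?normr0. Qed.

(** Picard iteration. The iterates are extended as constants beyond the interval of
    radius delta, so that they are continuous functions on the line with uniform
    estimates; the bound on 8 M delta makes the iteration contract by 1/2, the
    factor 4 of the norm of a product included. *)
Lemma linear_ODE (B : R -> quat R) (b delta M : R) :
  0 < delta -> continuous B -> (forall t, `|B t| <= M) -> 8 * M * delta <= 1 ->
  exists y : R -> quat R, y b = qone /\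
    forall t, `|t - b| < delta -> is_derive t 1 y (y t ** B t).
Proof.
move=> d0 cB bB Md.
have M0 : 0 <= M by apply: le_trans (bB b).
pose cl := clamp (b - delta) (b + delta).
have cl_in t : `|cl t - b| <= delta by exact: clamp_dist.
have clE t : `|t - b| <= delta -> cl t = t by rewrite ler_distl; exact: clampE.
have ccl : continuous cl by exact: clamp_continuous.
have /choice[op opP] : forall f : R -> quat R, exists F : R -> quat R,
    continuous f -> F b = 0 /\ forall t, b - delta - 1 < t -> is_derive t 1 F (f t).
  move=> f; have [cf|ncf] := pselect (continuous f); last by exists (fun=> 0).
  by have [F FP] := quat_antiderivative (b - delta - 1) b cf; exists F.
pose T (y : R -> quat R) t := qone + op (fun s => y s ** B s) (cl t).
have cyB y : continuous y -> continuous (fun s => y s ** B s).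
  by move=> cy t; apply: qmul_continuous; [exact: cy | exact: cB].
have cT y : continuous y -> continuous (T y).
  move=> cy t; apply: cvgD; first exact: cvg_cst.
  have [_ dop] := opP _ (cyB _ cy).
  have copt : {for cl t, continuous (op (fun s => y s ** B s))}.
    apply/differentiable_continuous/derivable1_diffP.
    have [|//] := dop (cl t).
    by have := cl_in t; rewrite ler_distl; lra.
  exact: (continuous_comp (ccl t) copt).
have inI t s : Num.min b (cl t) <= s <= Num.max b (cl t) -> `|s - b| <= delta.
  exact: between_dist_le (cl_in t).
have MVTop f t K : continuous f -> (forall s, `|s - b| <= delta -> `|f s| <= K) ->
    `|op f (cl t)| <= K * delta.
  move=> cf bf; have [F0 dF] := opP _ cf.
  have := quat_MVT1 (f := op f) (df := f) (a := b) (t := cl t) (M := K).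
  rewrite F0 subr0 => H; apply: le_trans (H _ _) _.
  - by move=> s /inI; rewrite ler_distl => ?; apply: dF; lra.
  - by move=> s /inI; exact: bf.
  - apply: ler_wpM2l; last exact: cl_in.
    by apply: le_trans (bf b _); rewrite // subrr normr0 ltW.
have opB f g t : continuous f -> continuous g ->
    (forall K, (forall s, `|s - b| <= delta -> `|f s - g s| <= K) ->
      `|op f (cl t) - op g (cl t)| <= K * delta).
  move=> cf cg K bfg.
  have [F0 dF] := opP _ cf; have [G0 dG] := opP _ cg.
  have := quat_MVT1 (f := op f - op g) (df := f - g) (a := b) (t := cl t) (M := K).
  rewrite !fctE F0 G0 !subr0 => H; apply: le_trans (H _ _) _.
  - move=> s /inI; rewrite ler_distl => sI.
    by apply: is_deriveB; [apply: dF | apply: dG]; lra.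
  - by move=> s /inI; exact: bfg.
  - apply: ler_wpM2l; last exact: cl_in.
    by apply: le_trans (bfg b _); rewrite // subrr normr0 ltW.
have contr y z K t : continuous y -> continuous z ->
    (forall s, `|y s - z s| <= K) -> `|T y t - T z t| <= K / 2.
  move=> cy cz yz; have K0 : 0 <= K by apply: le_trans (yz b).
  rewrite /T opprD addrACA subrr add0r.
  apply: le_trans (opB _ _ _ (cyB _ cy) (cyB _ cz) (4 * K * M) _) _.
    move=> s _; rewrite -qmulNl -qmulDl (le_trans (qmul_norm _ _)) //.
    by rewrite ler_pM // ler_wpM2l.
  by have := ler_wpM2l K0 Md; lra.
pose y n := iter n T (fun=> qone).
have cy n : continuous (y n).
  by elim: n => [|n IH]; [move=> t; exact: cvg_cst | exact: cT].
have dy n t : `|y n.+1 t - y n t| <= 2^-1 ^+ n.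
  elim: n t => [|n IH] t; last by rewrite exprSr; exact: (contr _ _ _ t (cy n.+1) (cy n) IH).
  rewrite expr0 /= {1}/T addrC addKr.
  apply: le_trans (MVTop _ _ (4 * M) (cyB _ (cy 0%N)) _) _; last by lra.
  move=> s _; rewrite (le_trans (qmul_norm _ _)) // ler_pM //.
  by rewrite -[leRHS]mulr1 ler_wpM2l // norm_qone.
have /choice[z zP] : forall t, exists z, forall n, `|z - y n t| <= 2 * 2^-1 ^+ n.
  by move=> t; apply: quat_geometric_limit => n; exact: dy.
have small e : 0 < e -> exists n, 2 * 2^-1 ^+ n < e :> R.
  move=> e0; have : (fun n => 2^-1 ^+ n) @ \oo --> (0 : R).
    by apply: cvg_expr; rewrite ger0_norm //; lra.
  have e2 : 0 < e / 2 by rewrite divr_gt0.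
  move=> /cvgrPdist_lt /(_ _ e2) [N _ /(_ N (leqnn N))].
  rewrite /= sub0r normrN ger0_norm ?exprn_ge0 // => H; exists N; lra.
have cz : continuous z.
  move=> t; apply/cvgrPdist_lt => e e0.
  have [n Hn] := small (e / 3) (divr_gt0 e0 (ltr0n _ 3)).
  have /cvgrPdist_lt /(_ (e / 3) (divr_gt0 e0 (ltr0n _ 3))) := cy n t.
  apply: filterS => s Hs.
  have h1 := zP t n; have h2 := zP s n.
  have d1 := ler_distD (y n t) (z t) (z s); have d2 := ler_distD (y n s) (y n t) (z s).
  by move: Hs h1 h2 d1 d2; rewrite /= [`|y n s - z s|]distrC; lra.
have zT t : z t = T z t.
  apply/eqP; rewrite -subr_eq0 -normr_eq0; apply/eqP; apply: le_anti; rewrite normr_ge0 andbT.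
  apply/ler_addgt0Pl => e e0; rewrite addr0.
  have [n Hn] := small (e / 2) (divr_gt0 e0 (ltr0n _ 2)).
  rewrite -(subrK (y n.+1 t) (z t)) -addrA (le_trans (ler_normD _ _)) //.
  have h1 := zP t n.+1; have p0 : 0 <= 2^-1 ^+ n :> R by rewrite exprn_ge0.
  have h2 : `|y n.+1 t - T z t| <= 2 * 2^-1 ^+ n / 2.
    by apply: (contr _ _ _ t (cy n) cz) => s; rewrite distrC; exact: zP.
  by move: h1; rewrite exprS; lra.
exists z; have [op0 dop] := opP _ (cyB _ cz); split.
  by rewrite zT /T clE ?subrr ?normr0 ?ltW // op0 addr0.
move=> t td.
have nT : \near t, qone + op (fun s => z s ** B s) t = z t.
  have nb : nbhs t (ball t (delta - `|t - b|)) by apply: nbhsx_ballx; rewrite subr_gt0.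
  apply: filterS nb => s; rewrite -ball_normE /= => ts.
  rewrite [RHS]zT /T clE //.
  rewrite -(subrK t s) -addrA (le_trans (ler_normD _ _)) //.
  by move: ts; rewrite distrC; lra.
apply: (near_eq_is_derive nT).
have dop_t : is_derive t 1 (op (fun s => z s ** B s)) (z t ** B t).
  by apply: dop; move: td; rewrite ltr_distl; lra.
have := is_deriveD (is_derive_cst qone t 1) dop_t; rewrite add0r; exact.
Qed.

End PicardIteration.

(** * Flat connections on plane domains *)

Section PlanarPartials.
Context {R : realType}.

Lemma addr_e_u (u v : R) : (0, v) + u *: e_u = (u, v) :> R * R.
Proof. by rewrite /e_u; congr pair; rewrite /= ?[u *: 1]mulr1 ?[u *: 0]mulr0 ?add0r ?addr0. Qed.

Lemma addr_e_v (u v : R) : (u, 0) + v *: e_v = (u, v) :> R * R.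
Proof. by rewrite /e_v; congr pair; rewrite /= ?[v *: 1]mulr1 ?[v *: 0]mulr0 ?add0r ?addr0. Qed.

Lemma is_derive_e_u (W : normedModType R) (f : R * R -> W) u v d :
  is_derive (u, v) e_u f d <-> is_derive u 1 (fun s => f (s, v)) d.
Proof.
have := is_derive_line f (0, v) e_u u d; rewrite addr_e_u => ->.
by rewrite (_ : (fun t => _) = fun s => f (s, v)) //; apply/funext => s; rewrite addr_e_u.
Qed.

Lemma is_derive_e_v (W : normedModType R) (f : R * R -> W) u v d :
  is_derive (u, v) e_v f d <-> is_derive v 1 (fun s => f (u, s)) d.
Proof.
have := is_derive_line f (u, 0) e_v v d; rewrite addr_e_v => ->.
by rewrite (_ : (fun t => _) = fun s => f (u, s)) //; apply/funext => s; rewrite addr_e_v.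
Qed.

Lemma dir_planar (v : R * R) : v = v.1 *: e_u + v.2 *: e_v.
Proof.
case: v => a b; rewrite /e_u /e_v; congr pair => /=;
by rewrite ?[_ *: 1]mulr1 ?[_ *: 0]mulr0 ?add0r ?addr0.
Qed.

Lemma ball_planar (a b r u v : R) : ball (a, b) r (u, v) <-> `|u - a| < r /\ `|v - b| < r.
Proof.
split=> -[h1 h2]; first by split; rewrite distrC; [exact: h1 | exact: h2].
by split; [move: h1 | move: h2]; rewrite distrC.
Qed.

Lemma is_derive_planar (C : set (R * R)) (f fu fv : R * R -> R) (x v : R * R) : open C ->
  (forall y, C y -> is_derive y e_u f (fu y)) -> C x -> {for x, continuous fu} ->
  is_derive x e_v f (fv x) -> is_derive x v f (v.1 * fu x + v.2 * fv x).
Proof.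
move=> oC df Cx cfu dfv; rewrite [v in is_derive _ v _ _]dir_planar.
have dfs y : C y -> is_derive y (v.1 *: e_u) f (v.1 * fu y).
  by move=> Cy; exact: is_derive_scale (df y Cy).
have nC : nbhs x C by exact: open_nbhs_nbhs.
have dv := is_derive_scale v.2 dfv; case: (dv) => dv1 dv2.
have [_ dux] := dfs x Cx.
have p1 : \forall y \near x, derivable f y (v.1 *: e_u).
  by apply: filterS nC => y /dfs[].
have p2 : {for x, continuous ('D_(v.1 *: e_u) f)}.
  apply: (@near_eq_continuous _ _ (fun y => v.1 * fu y)).
    by apply: filterS nC => y /dfs[_ ->].
  by apply: cvgM; [exact: cvg_cst | exact: cfu].
have H := is_derive_dirD p1 p2 dv1.
by apply: is_derive_eq H _; rewrite dux dv2.
Qed.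

Lemma is_derive_planar_q (C : set (R * R)) (f fu fv : R * R -> quat R) (x v : R * R) :
  open C -> (forall y, C y -> is_derive y e_u f (fu y)) -> C x -> {for x, continuous fu} ->
  is_derive x e_v f (fv x) -> is_derive x v f (v.1 *: fu x + v.2 *: fv x).
Proof.
move=> oC df Cx cfu dfv; apply/is_derive_quatP => j; rewrite !mxE.
apply: (@is_derive_planar C (fun y => f y 0 j) (fun y => fu y 0 j) (fun y => fv y 0 j)) => //.
- by move=> y /df /is_derive_quatP.
- exact: (continuous_comp cfu (@coord_continuous _ _ _ 0 j _)).
- by move/is_derive_quatP : dfv.
Qed.

(** After division by h the first term of the bound is of order h, and the second
    tends to 0 because f0 has the derivative d0. *)
Lemma is_derive_approx (f f0 : R -> quat R) (u C : R) d d0 : is_derive u 1 f0 d0 ->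
  0 <= C ->
  (\forall h \near 0, `|f u + h *: d - f (u + h)|
     <= C * (h ^+ 2 + `|f0 u + h *: d0 - f0 (u + h)|)) ->
  is_derive u 1 f d.
Proof.
move=> [df0 df0E] C0 Hf.
suff H : h^-1 *: ((f \o shift u) (h *: 1) - f u) @[h --> 0^'] --> d.
  by split; [apply/cvg_ex; exists d | apply: cvg_lim].
have /cvgrPdist_lt H0 : h^-1 *: ((f0 \o shift u) (h *: 1) - f0 u) @[h --> 0^'] --> d0.
  by rewrite -df0E; exact: df0.
have rateE (k : R -> quat R) h e : h != 0 ->
    `|e - h^-1 *: ((k \o shift u) (h *: 1) - k u)| = `|h|^-1 * `|k u + h *: e - k (u + h)|.
  move=> h0; rewrite -normfV -normrZ; congr (`|_|); rewrite /= [h *: 1]mulr1 [h + u]addrC.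
  rewrite !scalerDr !scalerN scalerA mulVf // scale1r opprB.
  by rewrite [in RHS]addrAC [in RHS]addrC.
apply/cvgrPdist_lt => e e0.
have C1 : 0 < C + 1 by rewrite ltr_wpDl.
have e1 : 0 < e / 2 / (C + 1) by rewrite !divr_gt0.
have H1 := H0 _ e1.
have H2 : \forall h \near (0 : R)^', `|h| < e / 2 / (C + 1) by exact: dnbhs0_lt.
have H3 : \forall h \near (0 : R)^', `|f u + h *: d - f (u + h)|
     <= C * (h ^+ 2 + `|f0 u + h *: d0 - f0 (u + h)|) by exact: cvg_within.
have H4 : \forall h \near (0 : R)^', h != 0 by exact: nbhs_dnbhs_neq.
near=> h.
have h0 : h != 0 by near: h.
have h1 : `|d0 - h^-1 *: ((f0 \o shift u) (h *: 1) - f0 u)| < e / 2 / (C + 1) by near: h; exact: H1.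
have h2 : `|h| < e / 2 / (C + 1) by near: h.
have h3 : `|f u + h *: d - f (u + h)|
     <= C * (h ^+ 2 + `|f0 u + h *: d0 - f0 (u + h)|) by near: h.
have hh : 0 < `|h| by rewrite normr_gt0.
rewrite rateE // mulrC ltr_pdivrMr //; apply: le_lt_trans h3 _.
move: h1; rewrite rateE // mulrC ltr_pdivrMr // => h1.
have -> : h ^+ 2 = `|h| * `|h| by rewrite -normrM -expr2 ger0_norm ?sqr_ge0.
set X := `|f0 u + _ - _| in h1 *.
have hk := ler_wpM2r (ltW hh) (ltW h2).
have HX : `|h| * `|h| + X <= e / (C + 1) * `|h|.
  have -> : e / (C + 1) * `|h| = e / 2 / (C + 1) * `|h| + e / 2 / (C + 1) * `|h| by rewrite -!mulrDl -mulr2n -[e *+ 2]mulr_natr mulfK ?pnatr_eq0.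
  by rewrite lerD // ltW.
apply: le_lt_trans (ler_wpM2l C0 HX) _; rewrite mulrA ltr_pM2r //.
by rewrite mulrA ltr_pdivrMr // mulrC ltr_pM2l // ltrDl.
Unshelve. all: by end_near. Qed.

End PlanarPartials.

Section FlatConnection.
Context {R : realType}.

Lemma segment_dist (r c x y t : R) : 0 <= t <= 1 -> `|x - c| < r -> `|y - c| < r ->
  `|x + t * (y - x) - c| < r.
Proof.
move=> /andP[t0 t1]; rewrite !ltr_distl => /andP[x1 x2] /andP[y1 y2].
have [xy|/ltW yx] := leP x y.
  have m1 : 0 <= t * (y - x) by rewrite mulr_ge0 // subr_ge0.
  have m2 : 0 <= (1 - t) * (y - x) by rewrite mulr_ge0 // subr_ge0.
  by apply/andP; split; lra.
have m1 : 0 <= t * (x - y) by rewrite mulr_ge0 // subr_ge0.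
have m2 : 0 <= (1 - t) * (x - y) by rewrite mulr_ge0 // subr_ge0.
by apply/andP; split; lra.
Qed.

Lemma unit_quat_norm (x : quat R) : qdot x x = 1 -> `|x| <= 1.
Proof.
rewrite qdotE; have h0 := sqr_ge0 (qre x); have h1 := sqr_ge0 (qi x).
have h2 := sqr_ge0 (qj x); have h3 := sqr_ge0 (qk x).
by move=> H; apply: quat_norm_le; rewrite ler_norml; nra.
Qed.

Lemma qconj_norm (x : quat R) : `|qconj x| <= `|x|.
Proof.
by apply: quat_norm_le; rewrite /qconj !quatE ?normrN; exact: quat_coord_le.
Qed.

Lemma qdot_skew (x a : quat R) : qre a = 0 -> qdot (x ** a) x + qdot x (x ** a) = 0.
Proof.
move=> a0; rewrite (qdotC (x ** a)) -{1 3}(qmulq1 x) !qdot_mull.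
by rewrite [qdot qone a]qdotE /qone !quatE a0; ring.
Qed.

Lemma qconj_im (a : quat R) : qre a = 0 -> qconj a = - a.
Proof. by move=> a0; apply: quatP; rewrite /qconj !quatE ?a0 ?oppr0. Qed.

(** The derivative of |y|^2 is 2 <y, y B> = 2 |y|^2 re B = 0. *)
Lemma ODE_norm (y B : R -> quat R) (b t : R) :
  (forall s, Num.min b t <= s <= Num.max b t -> is_derive s 1 y (y s ** B s)) ->
  (forall s, Num.min b t <= s <= Num.max b t -> qre (B s) = 0) ->
  qdot (y t) (y t) = qdot (y b) (y b).
Proof.
move=> dy B0.
have inI (h : R) := @segment_between R b t h.
have -> : t = b + (t - b) by rewrite addrC subrK.
apply/eqP; rewrite -subr_eq0; apply/eqP.
have [|c _ ->//] := @MVT_line R _ (fun s => qdot (y s) (y s)) (fun=> 0) b (t - b).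
move=> h /inI hI; have dyh := dy _ hI.
have := is_derive_scale (t - b) (is_derive_qdot dyh dyh).
rewrite [_ *: 1]mulr1 => H; apply: is_derive_eq H _.
by rewrite qdot_skew ?scaler0 // B0.
Qed.

Variables (U : set (R * R)) (A B : R * R -> quat R).
Hypotheses (oU : open U) (sA : smooth_on U A) (sB : smooth_on U B).
Hypotheses (A0 : forall z, U z -> qre (A z) = 0) (B0 : forall z, U z -> qre (B z) = 0).
Hypothesis flat : forall z, U z -> pd_v A z + B z ** A z = pd_u B z + A z ** B z.

Definition parallel (z : R * R) (S : R * R -> quat R) :=
  is_derive z e_u S (S z ** A z) /\ is_derive z e_v S (S z ** B z).

Let sum4_ge (x y z w : R) : 0 <= x -> 0 <= y -> 0 <= z -> 0 <= w ->
  [/\ x <= x + y + z + w + 1, y <= x + y + z + w + 1, z <= x + y + z + w + 1,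
      w <= x + y + z + w + 1 & 0 < x + y + z + w + 1].
Proof. by move=> *; split; lra. Qed.

(** Continuity bounds the coefficients near (a, b); the condition on 8 M r is the
    one under which the differential equations are solved on the whole square. *)
Let good_radius (a b : R) : U (a, b) -> exists r M : R,
  [/\ 0 < r, 0 < M, 8 * M * r <= 1,
      forall u v, `|u - a| <= r -> `|v - b| <= r -> U (u, v) &
      forall u v, `|u - a| <= r -> `|v - b| <= r ->
        [/\ `|A (u, v)| <= M, `|B (u, v)| <= M, `|pd_u B (u, v)| <= M &
            `|pd_u (pd_u B) (u, v)| <= M]].
Proof.
move=> Uab.
have bnd (f : R * R -> quat R) : smooth_on U f ->
    exists2 K, 0 <= K & \forall z \near (a, b), `|f z| <= K.
  move=> sf; exists (`|f (a, b)| + 1); first by rewrite addr_ge0.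
  have /cvgrPdist_lt /(_ 1 ltr01) := smooth_continuous sf Uab.
  apply: filterS => z Hz; rewrite -(subrK (f (a, b)) (f z)).
  by rewrite (le_trans (ler_normD _ _)) // addrC lerD2l distrC ltW.
have sBu : smooth_on U (pd_u B) by exact: smooth_derive.
have sBuu : smooth_on U (pd_u (pd_u B)) by exact: smooth_derive.
have [KA KA0 bA] := bnd A sA; have [KB KB0 bB] := bnd B sB.
have [KC KC0 bC] := bnd _ sBu; have [KD KD0 bD] := bnd _ sBuu.
have nU : nbhs (a, b) U by exact: open_nbhs_nbhs.
have N1 : nbhs (a, b) (fun z => U z /\ (`|A z| <= KA /\ `|B z| <= KB) /\
    (`|pd_u B z| <= KC /\ `|pd_u (pd_u B) z| <= KD)).
  exact: (filterI nU (filterI (filterI bA bB) (filterI bC bD))).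
have [r0 /= r00 Hr0] := (nbhs_ballP _ _).1 N1.
have [] := sum4_ge KA0 KB0 KC0 KD0; move: (_ + 1) => M MA MB MC MD M0.
pose r := Num.min (r0 / 2) (1 / (8 * M)).
have r_gt0 : 0 < r by rewrite lt_min !divr_gt0 // mulr_gt0.
have rr0 : r < r0.
  apply: (@le_lt_trans _ _ (r0 / 2)); first by rewrite ge_min lexx.
  by rewrite ltr_pdivrMr // ltr_pMr // ltr1n.
have inball u v : `|u - a| <= r -> `|v - b| <= r -> ball (a, b) r0 (u, v).
  by move=> ur vr; apply/ball_planar; split; apply: le_lt_trans rr0.
exists r, M; split=> //.
- have : r <= 1 / (8 * M) by rewrite ge_min lexx orbT.
  by rewrite ler_pdivlMr ?mulr_gt0 // mulrC.
- by move=> u v ur vr; have [] := Hr0 _ (inball u v ur vr).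
- move=> u v ur vr; have [_ [[h1 h2] [h3 h4]]] := Hr0 _ (inball u v ur vr).
  by split; [apply: le_trans h1 _|apply: le_trans h2 _|apply: le_trans h3 _|apply: le_trans h4 _].
Qed.

(** The second estimate is the mean value inequality for the difference of B and its
    linear part, the derivative of which is estimated in the same way. *)
Let taylor_B (u v h M : R) :
  (forall s, 0 <= s <= 1 -> U (u + s * h, v)) ->
  (forall s, 0 <= s <= 1 -> `|pd_u B (u + s * h, v)| <= M /\
     `|pd_u (pd_u B) (u + s * h, v)| <= M) ->
  `|B (u + h, v) - B (u, v)| <= M * `|h| /\
  `|B (u + h, v) - B (u, v) - h *: pd_u B (u, v)| <= M * h ^+ 2.
Proof.
move=> inU bM.
have pt s : (u, v) + s *: (h *: e_u) = (u + s * h, v) :> R * R.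
  rewrite /e_u; congr pair => /=; first by rewrite [h *: 1]mulr1.
  by rewrite [h *: 0]mulr0 scaler0 addr0.
have pt1 : (u, v) + h *: e_u = (u + h, v) :> R * R.
  by have := pt 1; rewrite scale1r mul1r.
have M0 : 0 <= M by have [/(le_trans (normr_ge0 _))] := bM 0 (introT andP (conj (lexx 0) ler01)).
have step (f : R * R -> quat R) t : smooth_on U f -> 0 <= t <= 1 ->
    (forall s, 0 <= s <= 1 -> `|pd_u f (u + s * h, v)| <= M) ->
    `|f (u + t * h, v) - f (u, v)| <= t * (M * `|h|).
  move=> sf t01 bf.
  have := @quat_MVT R _ f (fun z => (t * h) *: pd_u f z) (u, v) (t *: (h *: e_u)) (t * (M * `|h|)).
  rewrite pt; apply=> s s01; rewrite scalerA pt.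
    rewrite scalerA; apply: is_derive_scale; apply: smooth_is_derive sf _.
    by apply: inU; nra.
  rewrite normrZ normrM ger0_norm; last by case/andP: t01.
  rewrite -[leLHS]mulrA [M * _]mulrC; apply: ler_wpM2l; first by case/andP: t01.
  by apply: ler_wpM2l => //; apply: bf; nra.
split.
  have := step B 1 sB; rewrite !mul1r; apply; first by rewrite ler01 lexx.
  by move=> s /bM[].
pose F (z : R * R) := B z - (z.1 - u) *: pd_u B (u, v).
have -> : B (u + h, v) - B (u, v) - h *: pd_u B (u, v) = F ((u, v) + h *: e_u) - F (u, v).
  rewrite pt1 /F /= subrr scale0r subr0 [u + h]addrC addrK.
  by rewrite [LHS]addrAC.
apply: (@quat_MVT R _ F (fun z => h *: (pd_u B z - pd_u B (u, v)))) => s s01; rewrite pt.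
  have Us := inU s s01.
  have dB := is_derive_scale h (smooth_is_derive e_u sB Us).
  have d1 : is_derive (u + s * h, v) (h *: e_u) (fun z : R * R => (z.1 - u) *: pd_u B (u, v))
      (h *: pd_u B (u, v)).
    apply: is_derive_scale; apply/is_derive_e_u => /=.
    have di := is_deriveB (is_derive_id (u + s * h) (1 : R)) (is_derive_cst u (u + s * h) 1).
    have := is_derive_qscale di (is_derive_cst (pd_u B (u, v)) (u + s * h) 1).
    by rewrite scaler0 addr0 subr0 scale1r; exact.
  by apply: is_derive_eq (is_deriveB dB d1) _; rewrite scalerBr.
rewrite normrZ.
have sBu : smooth_on U (pd_u B) by exact: smooth_derive.
have := step (pd_u B) s sBu s01 (fun s' s'01 => (bM s' s'01).2).
have -> : M * h ^+ 2 = `|h| * (M * `|h|).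
  by rewrite [RHS]mulrCA -normrM -expr2 ger0_norm ?sqr_ge0.
move=> H; apply: ler_wpM2l => //; apply: le_trans H _.
by rewrite ler_piMl ?mulr_ge0 //; case/andP: s01.
Qed.

Let flat_defect (a b da : quat R) (bu b' : quat R) (h : R) : da + b ** a = bu + a ** b ->
  h *: da + b ** (qone + h *: a) - (qone + h *: a) ** b' =
  - (b' - b - h *: bu) - h *: (a ** (b' - b)).
Proof.
move=> fl; have -> : da = bu + a ** b - b ** a by rewrite -fl addrK.
by apply: quatP; rewrite /qmul /qone !quatE; ring.
Qed.

Let transport_defect (s b x y b' c : quat R) :
  (s ** b ** x + s ** y) ** c + s ** x ** (- b' ** c) = s ** (y + b ** x - x ** b') ** c.
Proof.
rewrite !qmulDr !qmulDl !qmulNl !qmulNr !qmulNl !qmulA.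
by rewrite [s ** b ** x ** c + _]addrC.
Qed.

(** Transport horizontally through the centre, then vertically. Flatness makes the
    result parallel in the horizontal direction as well: the discrepancy between
    S(u, v) (1 + h A) and S(u + h, v), read in the moving frame S(u + h, v), moves
    along a vertical line at a speed of order h^2, and it vanishes to first order
    at v = b, where S is the horizontal transport x. *)
Lemma local_parallel (a b : R) : U (a, b) -> exists r S,
  [/\ 0 < r, ball (a, b) r `<=` U & forall z, ball (a, b) r z ->
     parallel z S /\ qdot (S z) (S z) = 1].
Proof.
move=> Uab; have [r [M [r0 M0 Mr inU bM]]] := good_radius Uab.
pose cl c := clamp (c - r) (c + r).
have cl_in c t : `|cl c t - c| <= r by exact: clamp_dist.
have clE c t : `|t - c| <= r -> cl c t = t by rewrite ler_distl; exact: clampE.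
have ccl c : continuous (cl c) by exact: clamp_continuous.
have bb : `|b - b| <= r by rewrite subrr normr0 ltW.
have cA : continuous (fun t => A (cl a t, b)).
  move=> t; have cp : {for t, continuous (fun t : R => (cl a t, b))}.
    have h1 : (fun=> b) @ t --> b by exact: cvg_cst.
    exact: (cvg_pair (ccl a t) h1).
  exact: (continuous_comp cp (smooth_continuous sA (inU _ _ (cl_in a t) bb))).
have [|x [xa dx]] := linear_ODE a r0 cA _ Mr.
  by move=> t; have [] := bM _ _ (cl_in a t) bb.
have /choice[Y YP] : forall u, exists y : R -> quat R, `|u - a| <= r -> y b = qone /\
    forall t, `|t - b| < r -> is_derive t 1 y (y t ** B (u, t)).
  move=> u; have [ur|nur] := boolP (`|u - a| <= r); last by exists (fun=> qone).
  have cB : continuous (fun t => B (u, cl b t)).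
    move=> t; have cp : {for t, continuous (fun t : R => (u, cl b t))}.
      have h1 : (fun=> u) @ t --> u by exact: cvg_cst.
      exact: (cvg_pair h1 (ccl b t)).
    exact: (continuous_comp cp (smooth_continuous sB (inU _ _ ur (cl_in b t)))).
  have [|y [yb dy]] := linear_ODE b r0 cB _ Mr.
    by move=> t; have [] := bM _ _ ur (cl_in b t).
  by exists y => _; split=> // t tb; have := dy t tb; rewrite clE // ltW.
have between (c t s : R) := @between_dist R c r t s.
have dx' t : `|t - a| < r -> is_derive t 1 x (x t ** A (t, b)).
  by move=> ta; have := dx t ta; rewrite clE // ltW.
have qone1 : qdot qone qone = 1 :> R by rewrite qdotE /qone !quatE; ring.
have x1 u : `|u - a| < r -> qdot (x u) (x u) = 1.
  move=> ur; have -> : qdot (x u) (x u) = qdot (x a) (x a); last by rewrite xa.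
  apply: (@ODE_norm _ (fun t => A (t, b))).
    by move=> s /(between _ _ _ ur); exact: dx'.
  by move=> s /(between _ _ _ ur) /ltW sr; apply: A0; apply: inU.
have Y1 u v : `|u - a| <= r -> `|v - b| < r -> qdot (Y u v) (Y u v) = 1.
  move=> ur vr; have [Yb dY] := YP u ur.
  have -> : qdot (Y u v) (Y u v) = qdot (Y u b) (Y u b); last by rewrite Yb.
  apply: (@ODE_norm _ (fun t => B (u, t))).
    by move=> s /(between _ _ _ vr); exact: dY.
  by move=> s /(between _ _ _ vr) /ltW sr; apply: B0; apply: inU.
pose S (z : R * R) := x z.1 ** Y z.1 z.2.
have S1 u v : `|u - a| < r -> `|v - b| < r -> qdot (S (u, v)) (S (u, v)) = 1.
  by move=> ur vr; rewrite /S /= qdot_mull x1 // Y1 ?mulr1 // ltW.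
have dSv u v : `|u - a| < r -> `|v - b| < r ->
    is_derive v 1 (fun t => S (u, t)) (S (u, v) ** B (u, v)).
  move=> ur vr; have [_ dY] := YP u (ltW ur).
  have := is_derive_qmul (is_derive_cst (x u) v 1) (dY v vr).
  by rewrite qmul0q add0r qmulA; exact.
exists r, S; split=> //.
  by move=> [u v] /ball_planar[ur vr]; apply: inU; apply: ltW.
move=> [u v] /ball_planar[ur vr]; split; last exact: S1.
split; last by apply/is_derive_e_v; exact: dSv.
apply/is_derive_e_u.
pose K := 16 * (M + 4 * M ^+ 2).
have K0 : 0 <= K by rewrite /K; nra.
apply: (is_derive_approx (C := 4 * (K * r + 4)) (dx' u ur)).
  by rewrite mulr_ge0 // addr_ge0 // mulr_ge0 // ltW.
have nh : \forall h \near (0 : R), `|u + h - a| < r.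
  have := nbhsx_ballx (0 : R) (r - `|u - a|); rewrite subr_gt0 => /(_ ur).
  apply: filterS => h; rewrite -ball_normE /= sub0r normrN ltrBrDr => Hh.
  by rewrite addrAC addrC (le_lt_trans (ler_normD _ _)).
apply: filterS nh => h uhr.
pose D t := S (u, t) + h *: (S (u, t) ** A (u, t)) - S (u + h, t).
have DE t : D t = S (u, t) ** (qone + h *: A (u, t)) - S (u + h, t).
  by rewrite /D qmulDr qmulq1 qmulZr.
pose T t := S (u, t) ** (qone + h *: A (u, t)) ** qconj (S (u + h, t)).
have TE t : `|t - b| < r -> T t = D t ** qconj (S (u + h, t)) + qone.
  by move=> tr; rewrite DE qmulDl qmulNl qmul_conj S1 // scale1r subrK.
have S_le u' t : `|u' - a| < r -> `|t - b| < r -> `|S (u', t)| <= 1.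
  by move=> u'r tr; apply: unit_quat_norm; exact: S1.
have Sc_le t : `|t - b| < r -> `|qconj (S (u + h, t))| <= 1.
  by move=> tr; apply: le_trans (qconj_norm _) _; exact: S_le.
pose rest t := B (u + h, t) - B (u, t) - h *: pd_u B (u, t).
pose dT t := S (u, t) ** (- rest t - h *: (A (u, t) ** (B (u + h, t) - B (u, t))))
  ** qconj (S (u + h, t)).
have derT t : `|t - b| < r -> is_derive t 1 T (dT t).
  move=> tr; have Ut : U (u, t) by apply: inU; apply: ltW.
  have dA : is_derive t 1 (fun t => A (u, t)) (pd_v A (u, t)).
    by apply/is_derive_e_v; exact: smooth_is_derive sA Ut.
  have dhA := is_deriveD (is_derive_cst qone t 1) (is_deriveZ h dA).
  have H := is_derive_qmul (is_derive_qmul (dSv u t ur tr) dhA) (is_derive_qconj (dSv _ t uhr tr)).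
  apply: is_derive_eq H _ => /=.
  rewrite qconjM [qconj (B _)]qconj_im; last by apply: B0; apply: inU; apply: ltW.
  rewrite add0r /dT /rest -(@flat_defect _ _ (pd_v A (u, t))); last exact: flat.
  exact: transport_defect.
have between_h s : 0 <= s <= 1 -> `|u + s * h - a| < r.
  by move=> s01; have := segment_dist s01 ur uhr; rewrite [u + h]addrC addrK.
have bound_dT t : `|t - b| < r -> `|dT t| <= K * h ^+ 2.
  move=> tr; have [||B1 B2] := @taylor_B u t h M.
  - by move=> s s01; apply: inU; apply: ltW => //; exact: between_h.
  - by move=> s s01; have [_ _ h1 h2] := bM _ _ (ltW (between_h s s01)) (ltW tr); split.
  have [bA _ _ _] := bM u t (ltW ur) (ltW tr).
  have n1 : `|A (u, t) ** (B (u + h, t) - B (u, t))| <= 4 * M * (M * `|h|).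
    rewrite (le_trans (qmul_norm _ _)) // ler_pM // ?mulr_ge0 //.
    by rewrite ler_wpM2l.
  have n2 : `|- rest t - h *: (A (u, t) ** (B (u + h, t) - B (u, t)))|
      <= (M + 4 * M ^+ 2) * h ^+ 2.
    rewrite (le_trans (ler_normB _ _)) // normrN normrZ.
    have -> : (M + 4 * M ^+ 2) * h ^+ 2 = M * h ^+ 2 + `|h| * (4 * M * (M * `|h|)).
      have -> : h ^+ 2 = `|h| * `|h| by rewrite -normrM -expr2 ger0_norm ?sqr_ge0.
      by ring.
    by rewrite lerD // ler_wpM2l.
  rewrite /dT (le_trans (qmul_norm _ _)) //.
  have -> : K * h ^+ 2 = 4 * (4 * 1 * ((M + 4 * M ^+ 2) * h ^+ 2)) * 1 by rewrite /K; ring.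
  rewrite ler_pM // ?mulr_ge0 //; last exact: Sc_le.
  rewrite ler_wpM2l // (le_trans (qmul_norm _ _)) // ler_pM // ?mulr_ge0 //.
  by rewrite ler_wpM2l //; exact: S_le.
have Tvb : `|T v - T b| <= K * h ^+ 2 * r.
  have := @quat_MVT1 R T dT b v (K * h ^+ 2) => H.
  apply: le_trans (H _ _) _.
  - by move=> s /(between _ _ _ vr); exact: derT.
  - by move=> s /(between _ _ _ vr); exact: bound_dT.
  - by apply: ler_wpM2l; [rewrite mulr_ge0 // sqr_ge0 | exact: ltW].
have br : `|b - b| < r by rewrite subrr normr0.
have Db : D b = x u + h *: (x u ** A (u, b)) - x (u + h).
  have [Yb _] := YP u (ltW ur); have [Yb' _] := YP (u + h) (ltW uhr).
  by rewrite /D /S /= Yb Yb' !qmulq1.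
have Tb : `|T b - qone| <= 4 * `|D b|.
  rewrite TE // addrK (le_trans (qmul_norm _ _)) // -[leRHS]mulr1.
  by apply: ler_wpM2l; [rewrite mulr_ge0 | exact: Sc_le].
have Dv : D v = (T v - qone) ** S (u + h, v).
  rewrite TE // addrK -qmulA qconj_mul S1 // scale1r qmulq1 //.
have goalE : S (u, v) + h *: (S (u, v) ** A (u, v)) - S (u + h, v) = D v by [].
rewrite goalE Dv (le_trans (qmul_norm _ _)) //.
have step1 : 4 * `|T v - qone| * `|S (u + h, v)| <= 4 * `|T v - qone|.
  by rewrite -[leRHS]mulr1; apply: ler_wpM2l; [rewrite mulr_ge0 | exact: S_le].
apply: le_trans step1 _; rewrite -mulrA; apply: ler_wpM2l => //.
have tri : `|T v - qone| <= K * h ^+ 2 * r + 4 * `|D b|.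
  by rewrite (le_trans (ler_distD (T b) _ _)) // lerD.
apply: le_trans tri _; rewrite -Db; move: (`|D b|) (normr_ge0 (D b)) => X X0.
have -> : (K * r + 4) * (h ^+ 2 + X) = K * h ^+ 2 * r + 4 * X + (4 * h ^+ 2 + K * r * X).
  by ring.
by rewrite lerDl addr_ge0 // mulr_ge0 ?sqr_ge0 // mulr_ge0 // ltW.
Qed.

Let parallelB z S S' : parallel z S -> parallel z S' -> parallel z (fun y => S y - S' y).
Proof.
move=> [u1 v1] [u2 v2]; split.
- by apply: is_derive_eq (is_deriveB u1 u2) _; rewrite qmulDl qmulNl.
- by apply: is_derive_eq (is_deriveB v1 v2) _; rewrite qmulDl qmulNl.
Qed.

Let parallelM z (c : quat R) S : parallel z S -> parallel z (fun y => c ** S y).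
Proof.
move=> [u1 v1]; split.
- by apply: is_derive_eq (is_derive_qmul (is_derive_cst c z e_u) u1) _; rewrite qmul0q add0r qmulA.
- by apply: is_derive_eq (is_derive_qmul (is_derive_cst c z e_v) v1) _; rewrite qmul0q add0r qmulA.
Qed.

Let parallel_eq z S S' : (\near z, S z = S' z) -> parallel z S -> parallel z S'.
Proof.
by move=> nS [u1 v1]; rewrite /parallel -(nbhs_singleton nS); split;
  [apply: near_eq_is_derive u1 | apply: near_eq_is_derive v1].
Qed.

Let parallel_norm C S z v : open C -> C `<=` U -> (forall z, C z -> parallel z S) -> C z ->
  is_derive z v (fun y => qdot (S y) (S y)) 0.
Proof.
move=> oC CU pS Cz.
have du y : C y -> is_derive y e_u (fun y => qdot (S y) (S y)) 0.
  move=> Cy; have [u1 _] := pS y Cy; apply: is_derive_eq (is_derive_qdot u1 u1) _.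
  by rewrite qdot_skew // A0 //; exact: CU.
have dv : is_derive z e_v (fun y => qdot (S y) (S y)) 0.
  have [_ v1] := pS z Cz; apply: is_derive_eq (is_derive_qdot v1 v1) _.
  by rewrite qdot_skew // B0 //; exact: CU.
have := @is_derive_planar R C _ (fun=> 0) (fun=> 0) z v oC du Cz _ dv.
by rewrite !mulr0 addr0; apply; exact: cvg_cst.
Qed.

Let segment_closed_ball (z : R * R) (r : R) : segment_closed (ball z r).
Proof.
case: z => a b [u v] [u' v'] t /ball_planar[h1 h2] /ball_planar[h3 h4] t01.
have -> : (u, v) + t *: ((u', v') - (u, v)) = (u + t * (u' - u), v + t * (v' - v)) by [].
by apply/ball_planar; split; apply: segment_dist.
Qed.

Lemma parallel_locally_trivial : locally_trivial U (fun z S => U z /\ parallel z S).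
Proof.
split.
- by move=> z S S' nS [Uz pS]; split=> //; exact: parallel_eq pS.
- move=> C S S' y z oC sC pS pS' Cy Cz Syz.
  have CU : C `<=` U by move=> w /pS[].
  have pD w : C w -> parallel w (fun y => S y - S' y).
    by move=> Cw; apply: parallelB; [have [] := pS w Cw | have [] := pS' w Cw].
  have [|c _] := @MVT_line R _ (fun w => qdot (S w - S' w) (S w - S' w)) (fun=> 0) y (z - y).
    by move=> h h01; apply: (parallel_norm _ oC CU pD); exact: sC.
  have q00 : qdot 0 0 = 0 :> R by rewrite qdotE !quatE !mulr0 !addr0.
  rewrite [y + (z - y)]addrC subrK Syz subrr q00 subr0.
  by move=> /qdot_eq0 /eqP; rewrite subr_eq0 => /eqP.
move=> [a b] Uab; have [r [S [r0 rU pS]]] := local_parallel Uab.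
exists (ball (a, b) r); split=> //.
- exact: ball_open.
- exact: ballxx.
move=> y c By; exists (fun z => c ** qconj (S y) ** S z).
  by move=> z Bz; split; [exact: rU | apply: parallelM; have [] := pS z Bz].
by have [_ S1] := pS y By; rewrite -qmulA qconj_mul S1 scale1r qmulq1.
Qed.

Let parallel_continuous S z : (forall z, U z -> parallel z S) ->
  (forall z, U z -> qdot (S z) (S z) = 1) -> U z -> {for z, continuous S}.
Proof.
case: z => a b pS S1 Uab; have [r [M [r0 M0 _ inU bM]]] := good_radius Uab.
have aa : `|a - a| <= r by rewrite subrr normr0 ltW.
have rate (C : R * R -> quat R) z : U z -> `|C z| <= M -> `|S z ** C z| <= 4 * M.
  move=> Uz bC; rewrite (le_trans (qmul_norm _ _)) // ler_pM // ?mulr_ge0 //.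
  by rewrite -[leRHS]mulr1 ler_wpM2l // unit_quat_norm // S1.
have between (c t s : R) := @between_dist_le R c r t s.
apply/cvgrPdist_lt => e e0; pose d := Num.min r (e / (8 * M + 1)).
have M8 : 0 < 8 * M + 1 by lra.
have d0 : 0 < d by rewrite lt_min r0 divr_gt0.
have nd : nbhs (a, b) (ball (a, b) d) by exact: nbhsx_ballx.
apply: filterS nd => -[u v] /ball_planar[ud vd].
have ur : `|u - a| <= r by apply: ltW; apply: lt_le_trans ud _; rewrite ge_min lexx.
have vr : `|v - b| <= r by apply: ltW; apply: lt_le_trans vd _; rewrite ge_min lexx.
have h1 : `|S (u, v) - S (a, v)| <= 4 * M * `|u - a|.
  apply: (@quat_MVT1 R (fun s => S (s, v)) (fun s => S (s, v) ** A (s, v))).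
    move=> s /(between _ _ _ ur) sr; have [du _] := pS _ (inU _ _ sr vr).
    exact/is_derive_e_u.
  by move=> s /(between _ _ _ ur) sr; have [bA _ _ _] := bM _ _ sr vr; apply: rate; first exact: inU.
have h2 : `|S (a, v) - S (a, b)| <= 4 * M * `|v - b|.
  apply: (@quat_MVT1 R (fun s => S (a, s)) (fun s => S (a, s) ** B (a, s))).
    move=> s /(between _ _ _ vr) sr; have [_ dv] := pS _ (inU _ _ aa sr).
    exact/is_derive_e_v.
  by move=> s /(between _ _ _ vr) sr; have [_ bB _ _] := bM _ _ aa sr; apply: rate; first exact: inU.
rewrite distrC; apply: le_lt_trans (ler_distD (S (a, v)) _ _) _.
apply: le_lt_trans (lerD h1 h2) _; rewrite -mulrDr.
have dM : d * (8 * M + 1) <= e by rewrite -ler_pdivlMr // ge_min lexx orbT.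
have h3 : `|u - a| + `|v - b| <= 2 * d by rewrite mulr_natl mulr2n lerD // ltW.
have M4 : 0 <= 4 * M by rewrite mulr_ge0 // ltW.
apply: le_lt_trans (ler_wpM2l M4 h3) _; apply: lt_le_trans dM.
have -> : 4 * M * (2 * d) = d * (8 * M + 1) - d by ring.
by rewrite ltrBlDr ltrDl.
Qed.

(** A parallel section of class C^k has first derivatives of class C^k, as they are
    combinations of S A and S B. *)
Let parallel_smooth S : (forall z, U z -> parallel z S) ->
  (forall z, U z -> qdot (S z) (S z) = 1) -> smooth_on U S.
Proof.
move=> pS S1.
have cS z : U z -> {for z, continuous S} by exact: parallel_continuous.
have dS z w : U z -> is_derive z w S (w.1 *: (S z ** A z) + w.2 *: (S z ** B z)).
  move=> Uz; apply: (@is_derive_planar_q R U S (fun z => S z ** A z) (fun z => S z ** B z)) => //.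
  - by move=> y /pS[].
  - by apply: qmul_continuous; [exact: cS | exact: smooth_continuous sA Uz].
  - by have [] := pS z Uz.
elim=> [|k IH]; first by split=> // z /cS.
split=> [z /cS //|w]; split=> [z Uz|]; first by have [] := dS z w Uz.
have H1 := Ck_qscale oU (Ck_cst k U (w.1 : R)) (Ck_qmul oU IH (sA k)).
have H2 := Ck_qscale oU (Ck_cst k U (w.2 : R)) (Ck_qmul oU IH (sB k)).
by apply: (Ck_eq oU _ (CkD oU H1 H2)) => z Uz; have [_ ->] := dS z w Uz.
Qed.

(** Local parallel sections are determined by one value up to left multiplication,
    so that they form a local system, and monodromy continues one of them over
    U. Its length is constant because A and B are imaginary. *)
Theorem flat_section : connected U -> U !=set0 -> simply_connected R U ->
  exists S, [/\ smooth_on U S, forall z, U z -> parallel z S &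
    forall z, U z -> qdot (S z) (S z) = 1].
Proof.
move=> cU [z0 Uz0] scU.
have [S [pS S0]] := monodromy parallel_locally_trivial qone scU Uz0.
have {}pS z : U z -> parallel z S by move=> /pS[].
have S1 z : U z -> qdot (S z) (S z) = 1.
  move=> Uz; have -> : qdot (S z) (S z) = qdot (S z0) (S z0).
    apply: (@derive0_connected R _ U U (fun y => qdot (S y) (S y))) => //.
    by move=> x v Ux; apply: (@parallel_norm U).
  by rewrite S0 qdotE /qone !quatE; ring.
by exists S; split=> //; exact: parallel_smooth.
Qed.

End FlatConnection.

(** * Frames of quaternions *)

Section QuaternionFrames.
Context {R : realType}.

(** Two orthogonal imaginary quaternions of square length e and their vector
    product n. The conditions are products rather than inner products because
    the multiplication table of a, b, n follows from them by associativity. *)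
Definition frame (e : R) (a b n : quat R) :=
  [/\ qre a = 0, qre b = 0, a ** a = - e *: qone, b ** b = - e *: qone &
      a ** b = n /\ b ** a = - n].

Lemma frame_cross (e : R) (a b : quat R) : qre a = 0 -> qre b = 0 ->
  qdot a a = e -> qdot b b = e -> qdot a b = 0 -> frame e a b (qcross a b).
Proof.
rewrite !qdotE => a0 b0; rewrite a0 b0 !mul0r !add0r => ae be ab.
have E (x y z t : R) : x + y + z = t -> 0 * 0 - x - y - z = - t * 1.
  by move=> <-; ring.
split=> //.
- by apply: quatP; rewrite /qmul /qone !quatE ?a0 ?(E _ _ _ _ ae) //; ring.
- by apply: quatP; rewrite /qmul /qone !quatE ?b0 ?(E _ _ _ _ be) //; ring.
- split; apply: quatP; rewrite /qcross /qim /qmul !quatE ?a0 ?b0; try ring.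
  + by move: ab; lra.
  + by move: ab; lra.
Qed.

Definition comb (a b n : quat R) (x0 x1 x2 x3 : R) : quat R :=
  x0 *: qone + x1 *: a + x2 *: b + x3 *: n.

Variables (e : R) (a b n : quat R).
Hypothesis fr : frame e a b n.
Local Notation cb := (comb a b n).

Let products : [/\ a ** n = - e *: b, n ** a = e *: b, b ** n = e *: a, n ** b = - e *: a &
  n ** n = - e ^+ 2 *: qone].
Proof.
have [_ _ aa bb [ab ba]] := fr.
have an : a ** n = - e *: b by rewrite -ab qmulA aa qmulZl qmul1q.
have nb : n ** b = - e *: a by rewrite -ab -qmulA bb qmulZr qmulq1.
have na : n ** a = e *: b.
  by rewrite -ab -qmulA ba qmulNr an scaleNr opprK.
have bn : b ** n = e *: a.
  by rewrite -ab qmulA ba qmulNl nb scaleNr opprK.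
split=> //; rewrite -{1}ab -qmulA bn qmulZr aa scalerA; congr (_ *: _); ring.
Qed.

Lemma frame_re : qre n = 0.
Proof.
have [a0 b0 aa bb [ab ba]] := fr.
have h1 := congr1 qre ab; have h2 := congr1 qre ba; move: h1 h2.
by rewrite /qmul !quatE a0 b0; lra.
Qed.

Lemma comb_mul x0 x1 x2 x3 y0 y1 y2 y3 : cb x0 x1 x2 x3 ** cb y0 y1 y2 y3 =
  cb (x0 * y0 - e * x1 * y1 - e * x2 * y2 - e ^+ 2 * x3 * y3)
     (x0 * y1 + x1 * y0 + e * (x2 * y3 - x3 * y2))
     (x0 * y2 + x2 * y0 + e * (x3 * y1 - x1 * y3))
     (x0 * y3 + x3 * y0 + x1 * y2 - x2 * y1).
Proof.
have [a0 b0 aa bb [ab ba]] := fr; have [an na bn nb nn] := products.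
rewrite /comb !qmulDl !qmulDr !qmulZl !qmulZr !qmul1q !qmulq1 aa bb ab ba an na bn nb nn.
by apply: quatP; rewrite !quatE; ring.
Qed.

Lemma combD x0 x1 x2 x3 y0 y1 y2 y3 : cb x0 x1 x2 x3 + cb y0 y1 y2 y3 =
  cb (x0 + y0) (x1 + y1) (x2 + y2) (x3 + y3).
Proof. by apply: quatP; rewrite /comb !quatE; ring. Qed.

Lemma comb1 : qone = cb 1 0 0 0.
Proof. by apply: quatP; rewrite /comb !quatE; ring. Qed.
Lemma comb_a : a = cb 0 1 0 0.
Proof. by apply: quatP; rewrite /comb !quatE; ring. Qed.
Lemma comb_b : b = cb 0 0 1 0.
Proof. by apply: quatP; rewrite /comb !quatE; ring. Qed.
Lemma comb_n : n = cb 0 0 0 1.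
Proof. by apply: quatP; rewrite /comb !quatE; ring. Qed.

Lemma comb_conj x0 x1 x2 x3 : qconj (cb x0 x1 x2 x3) = cb x0 (- x1) (- x2) (- x3).
Proof.
have [a0 b0 _ _ _] := fr.
by apply: quatP; rewrite /comb /qconj /qone !quatE ?a0 ?b0 ?frame_re; ring.
Qed.

Lemma comb_re x0 x1 x2 x3 : qre (cb x0 x1 x2 x3) = x0.
Proof.
by have [a0 b0 _ _ _] := fr; rewrite /comb /qone !quatE a0 b0 frame_re; ring.
Qed.

Lemma comb_dot x0 x1 x2 x3 y0 y1 y2 y3 : qdot (cb x0 x1 x2 x3) (cb y0 y1 y2 y3) =
  x0 * y0 + e * x1 * y1 + e * x2 * y2 + e ^+ 2 * x3 * y3.
Proof. by rewrite qdot_conj comb_conj comb_mul comb_re; ring. Qed.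

(** An imaginary quaternion orthogonal to a and b anticommutes with them, hence
    commutes with n = a b; orthogonal to n, it also anticommutes with n. *)
Lemma frame_orthogonal d : e != 0 ->
  qdot d qone = 0 -> qdot d a = 0 -> qdot d b = 0 -> qdot d n = 0 -> d = 0.
Proof.
move=> e0 d1 da db dn; have [a0 b0 aa bb [ab ba]] := fr.
have d0 : qre d = 0 by move: d1; rewrite qdotE /qone !quatE !mulr0 mulr1 !addr0.
have anti x : qre x = 0 -> qdot d x = 0 -> d ** x = - (x ** d).
  rewrite qdotE d0 => x0; rewrite x0 => H.
  by apply: quatP; rewrite /qmul !quatE d0 x0; [lra | ring | ring | ring].
have h1 : d ** n = n ** d.
  by rewrite -ab qmulA (anti a) // qmulNl -qmulA (anti b) // qmulNr opprK qmulA.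
have h2 := anti n frame_re dn.
have nd : n ** d = 0.
  apply: quatP; move: h2; rewrite h1 => /eqP; rewrite -subr_eq0 opprK => /eqP h;
  by have := congr1 qre h; have := congr1 qi h; have := congr1 qj h; have := congr1 qk h;
    rewrite !quatE; lra.
have [_ _ _ _ nn] := products.
have : n ** (n ** d) = 0 by rewrite nd qmulq0.
rewrite qmulA nn qmulZl qmul1q => /eqP; rewrite scaler_eq0 oppr_eq0 expf_eq0 /= (negbTE e0).
by move=> /eqP.
Qed.

Lemma frame_expand w : e != 0 -> w = cb (qdot w qone) (qdot w a / e) (qdot w b / e)
  (qdot w n / e ^+ 2).
Proof.
move=> e0; apply/eqP; rewrite -subr_eq0; apply/eqP; apply: frame_orthogonal => //;
  rewrite qdotDl qdotNl; apply/eqP; rewrite subr_eq0; apply/eqP.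
- have H x0 x1 x2 x3 := comb_dot x0 x1 x2 x3 1 0 0 0.
  by rewrite -comb1 in H; rewrite H; ring.
- have H x0 x1 x2 x3 := comb_dot x0 x1 x2 x3 0 1 0 0.
  by rewrite -comb_a in H; rewrite H; field.
- have H x0 x1 x2 x3 := comb_dot x0 x1 x2 x3 0 0 1 0.
  by rewrite -comb_b in H; rewrite H; field.
- have H x0 x1 x2 x3 := comb_dot x0 x1 x2 x3 0 0 0 1.
  by rewrite -comb_n in H; rewrite H; field.
Qed.

End QuaternionFrames.

(** * The equations of Gauss and Weingarten *)

Section SurfaceAlgebra.
Context {R : realType}.

Lemma qconj_isometry (P x y : quat R) : qdot P P = 1 ->
  qdot (qconj P ** x) (qconj P ** y) = qdot x y.
Proof.
move=> P1; rewrite qdot_mull; have -> : qdot (qconj P) (qconj P) = qdot P P.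
  by rewrite !qdotE /qconj !quatE; ring.
by rewrite P1 mul1r.
Qed.

Lemma gauss_expand (P Pu Pv D : quat R) (E : R) (n : quat R) : qdot P P = 1 -> E != 0 ->
  frame (2 * E) (qconj P ** Pu) (qconj P ** Pv) n ->
  qconj P ** D = comb (qconj P ** Pu) (qconj P ** Pv) n (qdot D P) (qdot D Pu / (2 * E))
     (qdot D Pv / (2 * E)) (qdot D (P ** ((2 * E)^-1 *: n)) / (2 * E)).
Proof.
move=> P1 E0 fr.
have isom x y := @qconj_isometry P x y P1.
have e0 : 2 * E != 0 by rewrite mulf_neq0.
have c1 : qconj P ** P = qone by rewrite qconj_mul P1 scale1r.
have n1 : qdot (qconj P ** D) qone = qdot D P by rewrite -c1 isom.
have n4 : qdot (qconj P ** D) n = 2 * E * qdot D (P ** ((2 * E)^-1 *: n)).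
  by rewrite -(isom D) qmulA c1 qmul1q qdotZr mulrA divff // mul1r.
rewrite [LHS](frame_expand fr (qconj P ** D) e0) n1 !isom n4.
by congr (comb _ _ _ _ _ _ _); field.
Qed.

(** Since p conj p = 1, a product of two derivatives of p can be computed from the
    components of conj p p_w in the frame. *)
Lemma frame_turn (P x y : quat R) : qdot P P = 1 ->
  qconj x ** y = qconj (qconj P ** x) ** (qconj P ** y).
Proof.
move=> P1; rewrite qconjM qconjK qmulA -[_ ** P ** qconj P]qmulA qmul_conj P1 scale1r.
by rewrite qmulq1.
Qed.

Lemma turn_sum (e : R) (a b n X Y C : quat R) (x1 x2 y1 y2 c0 c1 c2 c3 : R) :
  frame e a b n -> X = comb a b n 0 x1 x2 0 -> Y = comb a b n 0 y1 y2 0 ->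
  C = comb a b n c0 c1 c2 c3 ->
  qconj X ** Y + C = comb a b n (e * (x1 * y1 + x2 * y2) + c0) c1 c2 (x2 * y1 - x1 * y2 + c3).
Proof.
move=> fr -> -> ->; rewrite (comb_conj fr) (comb_mul fr) combD.
by congr (comb _ _ _ _ _ _ _); ring.
Qed.

Lemma mul_sum (e : R) (a b n X Y : quat R) (x0 x1 x2 x3 y0 y1 y2 y3 : R) :
  frame e a b n -> X = comb a b n x0 x1 x2 x3 -> Y = comb a b n y0 y1 y2 y3 ->
  X ** b + a ** Y = comb a b n (- e * x2 - e * y1) (y0 - e * x3) (x0 - e * y3) (x1 + y2).
Proof.
move=> fr -> ->; rewrite {2}(comb_b a b n) {3}(comb_a a b n) !(comb_mul fr) combD.
by congr (comb _ _ _ _ _ _ _); ring.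
Qed.

Lemma half_inner (x x' d E w : R) : x + x' = d -> x' = x -> d = 2 * E * w -> x = E * w.
Proof. by move=> <- ->; lra. Qed.

Lemma cross_inner (x y y' d E w : R) : x + y = d -> d = 0 -> y = y' -> y' = E * w ->
  x = - (E * w).
Proof. by move=> h1 h2 h3 h4; lra. Qed.

Lemma normal_algebra (x y w e : R) : e != 0 ->
  2^-1 * 2^-1 * x - - 2^-1 * - 2^-1 * w = -1 ->
  2^-1 * - 2^-1 * y + - 2^-1 * 2^-1 * y = - 0 ->
  (x * e - 2 * (y * 0) + w * e) / (2 * (e * e - 0 ^+ 2)) = 0 ->
  [/\ x = - 2, y = 0 & w = 2].
Proof.
move=> e0 Hr Hi /eqP; have e20 : 2 * (e * e - 0 ^+ 2) != 0.
  by rewrite expr0n /= subr0 !mulf_neq0.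
rewrite mulf_eq0 invr_eq0 (negbTE e20) orbF => /eqP H.
have xw : x + w = 0 by apply: (mulfI e0); rewrite mulr0 -[RHS]H; ring.
by rewrite oppr0 in Hi; split; lra.
Qed.

Lemma qdot_swap (x b c : quat R) : b = c -> qdot x c = qdot b x.
Proof. by move=> ->; exact: qdotC. Qed.

Lemma qdot_subst (x b c : quat R) : b = c -> qdot b x = qdot c x.
Proof. by move=> ->. Qed.

Lemma qdot1q (x : quat R) : qdot qone x = qre x.
Proof. by rewrite qdotE /qone !quatE; ring. Qed.

End SurfaceAlgebra.

Section GaussWeingarten.
Context {R : realType}.

Lemma is_derive_unique (E W : normedModType R) (f : E -> W) x v d d' :
  is_derive x v f d -> is_derive x v f d' -> d = d'.
Proof. by move=> [_ <-] [_ <-]. Qed.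

Lemma is_derive_eq_on (E W : normedModType R) (A : set E) (f g : E -> W) x v d :
  open A -> A x -> (forall y, A y -> f y = g y) -> is_derive x v f d -> is_derive x v g d.
Proof.
move=> oA Ax fg; apply: near_eq_is_derive.
have nA : nbhs x A by exact: open_nbhs_nbhs.
exact: filterS fg nA.
Qed.

Variables (U : set (R * R)) (omega : R * R -> R) (p : R * R -> quat R).
Hypotheses (oU : open U) (sO : smooth_on U omega).
Hypothesis mp : associated_minimal_surface U omega p.

Local Notation a2 := (alpha2 p).
Local Notation a3 := (alpha3 p).
Local Notation nu z := (qcross (alpha2 p z) (alpha3 p z)).
Local Notation E z := (expR (omega z)).

Let sp : smooth_on U p. Proof. by have [[sp _] _ _ _ _] := mp. Qed.

Let p1 z : U z -> qdot (p z) (p z) = 1.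
Proof. by have [_ h _ _ _] := mp; exact: h. Qed.

Let dp v z : U z -> is_derive z v p ('D_v p z).
Proof. exact: smooth_is_derive. Qed.

Let ddp v w z : U z -> is_derive z w ('D_v p) ('D_w ('D_v p) z).
Proof. by apply: smooth_is_derive; exact: smooth_derive. Qed.

Let dE v z : U z -> is_derive z v (fun z => E z) (E z * 'D_v omega z).
Proof.
move=> Uz; exact: is_derive_comp1 (is_derive_expR _) (smooth_is_derive v sO Uz).
Qed.

Let dot_p v z : U z -> qdot (p z) ('D_v p z) = 0.
Proof.
move=> Uz; have h1 := is_derive_qdot (dp v Uz) (dp v Uz).
have h2 := is_derive_eq_on oU Uz (fun y Uy => esym (p1 Uy)) (is_derive_cst (1 : R) z v).
have := is_derive_unique h1 h2; rewrite qdotC; lra.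
Qed.

Let conf z : U z -> [/\ qdot ('D_e_u p z) ('D_e_u p z) = 2 * E z,
  qdot ('D_e_v p z) ('D_e_v p z) = 2 * E z & qdot ('D_e_u p z) ('D_e_v p z) = 0].
Proof. by have [_ _ _ h _] := mp; exact: h. Qed.

Lemma surface_frame z : U z -> frame (2 * E z) (a2 z) (a3 z) (nu z).
Proof.
move=> Uz; have [h1 h2 h3] := conf Uz.
have dotc x y := @qconj_isometry R (p z) x y (p1 Uz).
apply: frame_cross.
- by rewrite /alpha2 -qdot_conj; exact: dot_p.
- by rewrite /alpha3 -qdot_conj; exact: dot_p.
- by rewrite /alpha2 dotc; exact: h1.
- by rewrite /alpha3 dotc; exact: h2.
- by rewrite /alpha2 /alpha3 dotc; exact: h3.
Qed.

Let E_neq0 z : 2 * E z != 0. Proof. by rewrite mulf_neq0 // gt_eqF // expR_gt0. Qed.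

(* The components of the second derivatives of p are their inner products with p,
   p_u, p_v and N. The first three come from differentiating <p, p> = 1 and the
   conformality relations, the last one from the two equations on the second
   fundamental form. *)
Let dotDD v w v' z : U z ->
  qdot ('D_w ('D_v p) z) ('D_v' p z) + qdot ('D_v p z) ('D_w ('D_v' p) z) =
  'D_w (fun y => qdot ('D_v p y) ('D_v' p y)) z.
Proof. by move=> Uz; have [_ <-] := is_derive_qdot (ddp v w Uz) (ddp v' w Uz). Qed.

Let dotDDp v w z : U z ->
  qdot ('D_w ('D_v p) z) (p z) = - qdot ('D_v p z) ('D_w p z).
Proof.
move=> Uz; have h1 := is_derive_qdot (ddp v w Uz) (dp w Uz).
have h2 := is_derive_eq_on oU Uz (fun y (Uy : U y) => esym (etrans (qdotC ('D_v p y) (p y)) (dot_p v Uy)))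
  (is_derive_cst (0 : R) z w).
by have := is_derive_unique h1 h2; lra.
Qed.

Let conf_derive (w v z : R * R) : (forall y, U y -> qdot ('D_w p y) ('D_w p y) = 2 * E y) ->
  U z -> 'D_v (fun y => qdot ('D_w p y) ('D_w p y)) z = 2 * E z * 'D_v omega z.
Proof.
move=> h Uz; have H : is_derive z v (fun y => 2 * E y) (2 * E z * 'D_v omega z).
  by apply: is_derive_eq (is_deriveM (is_derive_cst (2 : R) z v) (dE v Uz)) _;
    rewrite /GRing.scale /=; ring.
by have [] := is_derive_eq_on oU Uz (fun y Uy => esym (h y Uy)) H.
Qed.

Let Duu v z (Uz : U z) := conf_derive v (fun y Uy => let: And3 h _ _ := conf Uy in h) Uz.
Let Dvv v z (Uz : U z) := conf_derive v (fun y Uy => let: And3 _ h _ := conf Uy in h) Uz.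

Let Duv v z : U z -> 'D_v (fun y => qdot ('D_e_u p y) ('D_e_v p y)) z = 0.
Proof.
move=> Uz; have H := is_derive_cst (0 : R) z v.
have [] // := is_derive_eq_on oU Uz (fun y (Uy : U y) => esym (let: And3 _ _ h := conf Uy in h)) H.
Qed.

Let comm z : U z -> 'D_e_v ('D_e_u p) z = 'D_e_u ('D_e_v p) z :> quat R.
Proof. by move=> Uz; exact: derive_comm_q oU _ _ _ _ sp Uz. Qed.

Let second_ffE z X Y : U z ->
  second_ff omega p z X Y = qdot ('D_X ('D_Y p) z) (unit_normal omega p z).
Proof.
move=> Uz; rewrite /second_ff /tan_proj qdotDl qdotNl qdotZl.
have -> : qdot (p z) (unit_normal omega p z) = 0; last by rewrite mulr0 subr0.
rewrite /unit_normal -{1}(qmulq1 (p z)) qdot_mull qdotZr qdot1q.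
by rewrite (frame_re (surface_frame Uz)) !mulr0.
Qed.

Let DDZ (c d : R) X Y z : U z ->
  'D_(c *: X) ('D_(d *: Y) p) z = (c * d) *: 'D_X ('D_Y p) z :> quat R.
Proof.
move=> Uz; have H := is_derive_scale c (is_deriveZ d (ddp Y X Uz)).
have [_ ->] := is_derive_eq_on oU Uz
  (fun y (Uy : U y) => esym (smooth_deriveZ d Y sp Uy)) H.
by rewrite scalerA.
Qed.

(** Minimality says that the trace of the second fundamental form vanishes, and
    sigma(dz, dz) = -1 fixes the difference of its diagonal entries and the
    off-diagonal one. *)
Let normal_components z : U z ->
  [/\ qdot ('D_e_u ('D_e_u p) z) (unit_normal omega p z) = - 2,
      qdot ('D_e_u ('D_e_v p) z) (unit_normal omega p z) = 0 &
      qdot ('D_e_v ('D_e_v p) z) (unit_normal omega p z) = 2].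
Proof.
move=> Uz; have [_ _ /(_ z Uz) H0 _ /(_ z Uz) Hs] := mp.
have [h1 h2 h3] := conf Uz.
have I1 : first_ff p z e_u e_u = 2 * E z := h1.
have I2 : first_ff p z e_v e_v = 2 * E z := h2.
have I3 : first_ff p z e_u e_v = 0 := h3.
have II (c d : R) X Y : second_ff omega p z (c *: X) (d *: Y) = c * d * second_ff omega p z X Y.
  rewrite (second_ffE (c *: X) (d *: Y) Uz) (second_ffE X Y Uz) -qdotZl.
  exact: (congr1 (fun w => qdot w _) (DDZ c d X Y Uz)).
have sym : second_ff omega p z e_v e_u = second_ff omega p z e_u e_v.
  rewrite (second_ffE e_v e_u Uz) (second_ffE e_u e_v Uz).
  exact: (congr1 (fun w => qdot w _) (comm Uz)).
suff [r1 r2 r3] : [/\ second_ff omega p z e_u e_u = - 2, second_ff omega p z e_u e_v = 0 &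
    second_ff omega p z e_v e_v = 2].
  split; [apply: etrans (esym (second_ffE e_u e_u Uz)) r1 |
    apply: etrans (esym (second_ffE e_u e_v Uz)) r2 |
    apply: etrans (esym (second_ffE e_v e_v Uz)) r3].
move: Hs; rewrite /complexify /partial_z /= -!scaleNr !II sym => Hs.
have Hr : 2^-1 * 2^-1 * second_ff omega p z e_u e_u -
    - 2^-1 * - 2^-1 * second_ff omega p z e_v e_v = -1.
  exact: (congr1 (@complex.Re R) Hs).
have Hi : 2^-1 * - 2^-1 * second_ff omega p z e_u e_v +
    - 2^-1 * 2^-1 * second_ff omega p z e_u e_v = - 0.
  exact: (congr1 (@complex.Im R) Hs).
move: H0; rewrite /mean_curvature /= I1 I2 I3 => H0.
exact: normal_algebra (E_neq0 z) Hr Hi H0.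
Qed.

Local Notation cb z := (comb (a2 z) (a3 z) (nu z)).

Let E0 z : E z != 0. Proof. by rewrite gt_eqF // expR_gt0. Qed.

Let gauss D z (x y w t : R) : U z -> qdot D (p z) = x -> qdot D ('D_e_u p z) = E z * y ->
  qdot D ('D_e_v p z) = E z * w -> qdot D (unit_normal omega p z) = t ->
  qconj (p z) ** D = cb z x (y / 2) (w / 2) (t / (2 * E z)).
Proof.
move=> Uz h1 h2 h3 h4; have := gauss_expand D (p1 Uz) (E0 z) (surface_frame Uz).
have -> : qdot D (p z ** ((2 * E z)^-1 *: nu z)) = t := h4.
rewrite h1 h2 h3 => H; apply: etrans H _.
by congr (comb _ _ _ _ _ _ _); field; exact: E0.
Qed.

Let P_uu z : U z -> qconj (p z) ** 'D_e_u ('D_e_u p) z =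
  cb z (- (2 * E z)) ('D_e_u omega z / 2) (- 'D_e_v omega z / 2) (- 2 / (2 * E z)).
Proof.
move=> Uz; have [r1 r2 r3] := normal_components Uz; have [h1 h2 h3] := conf Uz.
apply: (gauss Uz) r1.
- exact: etrans (dotDDp e_u e_u Uz) (congr1 _ h1).
- exact: half_inner (dotDD e_u e_u e_u Uz) (qdotC _ _) (Duu e_u Uz).
- have k := qdot_swap ('D_e_u p z) (comm Uz).
  rewrite mulrN; apply: cross_inner (dotDD e_u e_u e_v Uz) (Duv e_u Uz) k _.
  exact: half_inner (dotDD e_u e_v e_u Uz) (qdotC _ _) (Duu e_v Uz).
Qed.

Let P_uv z : U z -> qconj (p z) ** 'D_e_u ('D_e_v p) z =
  cb z 0 ('D_e_v omega z / 2) ('D_e_u omega z / 2) (0 / (2 * E z)).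
Proof.
move=> Uz; have [r1 r2 r3] := normal_components Uz; have [h1 h2 h3] := conf Uz.
apply: (gauss Uz) r2.
- apply: etrans (dotDDp e_v e_u Uz) _.
  by apply: etrans (congr1 _ (etrans (qdotC _ _) h3)) _; rewrite oppr0.
- apply: etrans (qdot_subst ('D_e_u p z) (esym (comm Uz))) _.
  exact: half_inner (dotDD e_u e_v e_u Uz) (qdotC _ _) (Duu e_v Uz).
- exact: half_inner (dotDD e_v e_u e_v Uz) (qdotC _ _) (Dvv e_u Uz).
Qed.

Let P_vv z : U z -> qconj (p z) ** 'D_e_v ('D_e_v p) z =
  cb z (- (2 * E z)) (- 'D_e_u omega z / 2) ('D_e_v omega z / 2) (2 / (2 * E z)).
Proof.
move=> Uz; have [r1 r2 r3] := normal_components Uz; have [h1 h2 h3] := conf Uz.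
apply: (gauss Uz) r3.
- exact: etrans (dotDDp e_v e_v Uz) (congr1 _ h2).
- rewrite mulrN.
  have H : qdot ('D_e_u p z) ('D_e_v ('D_e_v p) z) + qdot ('D_e_v ('D_e_u p) z) ('D_e_v p z)
      = 'D_e_v (fun y => qdot ('D_e_u p y) ('D_e_v p y)) z.
    exact: etrans (addrC _ _) (dotDD e_u e_v e_v Uz).
  apply: etrans (qdotC _ _) _; apply: cross_inner H (Duv e_v Uz) (qdot_subst ('D_e_v p z) (comm Uz)) _.
  exact: half_inner (dotDD e_v e_u e_v Uz) (qdotC _ _) (Dvv e_u Uz).
- exact: half_inner (dotDD e_v e_v e_v Uz) (qdotC _ _) (Dvv e_v Uz).
Qed.

Let turn v w z : U z ->
  is_derive z w (fun y => qconj (p y) ** 'D_v p y)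
    (qconj (qconj (p z) ** 'D_w p z) ** (qconj (p z) ** 'D_v p z)
     + qconj (p z) ** 'D_w ('D_v p) z).
Proof.
move=> Uz; have H := is_derive_qmul (is_derive_qconj (dp w Uz)) (ddp v w Uz).
by apply: is_derive_eq H _; congr (_ + _); exact: frame_turn (p1 Uz).
Qed.

(** The derivative of conj p p_v along w is conj p_w p_v + conj p p_vw. The first
    term is a product of two vectors of the frame, and the second one is given by
    the equations of Gauss. *)
Lemma weingarten z : U z ->
  [/\ is_derive z e_u a2 (cb z 0 ('D_e_u omega z / 2) (- 'D_e_v omega z / 2) (- (E z)^-1)),
      is_derive z e_v a2 (cb z 0 ('D_e_v omega z / 2) ('D_e_u omega z / 2) 1),
      is_derive z e_u a3 (cb z 0 ('D_e_v omega z / 2) ('D_e_u omega z / 2) (- 1)) &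
      is_derive z e_v a3 (cb z 0 (- 'D_e_u omega z / 2) ('D_e_v omega z / 2) (E z)^-1)].
Proof.
move=> Uz; have fr := surface_frame Uz; have e0 := E0 z.
have cuv : qconj (p z) ** 'D_e_v ('D_e_u p) z = cb z 0 ('D_e_v omega z / 2)
   ('D_e_u omega z / 2) (0 / (2 * E z)).
  exact: etrans (congr1 (fun w => qconj (p z) ** w) (comm Uz)) (P_uv Uz).
have A2 : qconj (p z) ** 'D_e_u p z = cb z 0 1 0 0 by exact: comb_a.
have A3 : qconj (p z) ** 'D_e_v p z = cb z 0 0 1 0 by exact: comb_b.
split.
- apply: is_derive_eq (turn e_u e_u Uz) _; apply: etrans (turn_sum fr A2 A2 (P_uu Uz)) _.
  by congr (comb _ _ _ _ _ _ _); move: (E z) e0 => e e0; field.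
- apply: is_derive_eq (turn e_u e_v Uz) _; apply: etrans (turn_sum fr A3 A2 cuv) _.
  by congr (comb _ _ _ _ _ _ _); move: (E z) e0 => e e0; field.
- apply: is_derive_eq (turn e_v e_u Uz) _; apply: etrans (turn_sum fr A2 A3 (P_uv Uz)) _.
  by congr (comb _ _ _ _ _ _ _); move: (E z) e0 => e e0; field.
- apply: is_derive_eq (turn e_v e_v Uz) _; apply: etrans (turn_sum fr A3 A3 (P_vv Uz)) _.
  by congr (comb _ _ _ _ _ _ _); move: (E z) e0 => e e0; field.
Qed.

Lemma weingarten_normal z : U z ->
  is_derive z e_u (fun y => nu y) (cb z 0 2 (2 * E z) ('D_e_u omega z)) /\
  is_derive z e_v (fun y => nu y) (cb z 0 (- (2 * E z)) (- 2) ('D_e_v omega z)).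
Proof.
move=> Uz; have fr := surface_frame Uz; have e0 := E0 z.
have nuE y : U y -> a2 y ** a3 y = nu y.
  by move=> /surface_frame [_ _ _ _ []].
have [u2 v2 u3 v3] := weingarten Uz.
split; apply: (is_derive_eq_on oU Uz nuE).
- apply: is_derive_eq (is_derive_qmul u2 u3) _; apply: etrans (mul_sum fr erefl erefl) _.
  move: (E z) ('D_e_u omega z) ('D_e_v omega z) e0 => e x y e0.
  by congr (comb _ _ _ _ _ _ _); field.
- apply: is_derive_eq (is_derive_qmul v2 v3) _; apply: etrans (mul_sum fr erefl erefl) _.
  move: (E z) ('D_e_u omega z) ('D_e_v omega z) e0 => e x y e0.
  by congr (comb _ _ _ _ _ _ _); field.
Qed.

End GaussWeingarten.

(** * The flat connection of a pair of solutions *)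

Section AssociatedConnection.
Context {R : realType}.

Lemma is_derive_comb (V : normedModType R) (a b n : V -> quat R) (x1 x2 x3 : V -> R) (z v : V)
    (dx1 dx2 dx3 a0 a1 a2 a3 b0 b1 b2 b3 n0 n1 n2 n3 : R) :
  is_derive z v a (comb (a z) (b z) (n z) a0 a1 a2 a3) ->
  is_derive z v b (comb (a z) (b z) (n z) b0 b1 b2 b3) ->
  is_derive z v n (comb (a z) (b z) (n z) n0 n1 n2 n3) ->
  is_derive z v x1 dx1 -> is_derive z v x2 dx2 -> is_derive z v x3 dx3 ->
  is_derive z v (fun y => comb (a y) (b y) (n y) 0 (x1 y) (x2 y) (x3 y))
    (comb (a z) (b z) (n z)
       (x1 z * a0 + x2 z * b0 + x3 z * n0) (dx1 + x1 z * a1 + x2 z * b1 + x3 z * n1)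
       (dx2 + x1 z * a2 + x2 z * b2 + x3 z * n2) (dx3 + x1 z * a3 + x2 z * b3 + x3 z * n3)).
Proof.
move=> da db dn d1 d2 d3.
have H := is_deriveD (is_deriveD (is_deriveD (is_derive_cst (0 *: qone : quat R) z v)
  (is_derive_qscale d1 da)) (is_derive_qscale d2 db)) (is_derive_qscale d3 dn).
by apply: is_derive_eq H _; apply: quatP; rewrite /comb !quatE; ring.
Qed.

(** The components of the zero curvature equation along a and b hold identically;
    the one along n is the sum of the Sinh-Gordon equation and of the Liouville
    equation, where expR mu = m ^ 2 E. *)
Lemma flat_algebra (a b n : quat R) (E F eps m wu wv mu_u mu_v suu svv : R) :
  E != 0 -> F = E^-1 -> eps ^+ 2 = 1 -> frame (2 * E) a b n ->
  suu + svv = - 4 * (E - E^-1) - m ^+ 2 * E ->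
  let x1 := 2^-1 + - (eps / 4) * m in let x2 := - (2^-1 * F) in
  let x3 := 8^-1 * F * (mu_v + wv) in
  let y1 := - (2^-1 * F) in let y2 := 2^-1 + eps / 4 * m in
  let y3 := - (8^-1 * F * (mu_u + wu)) in
  let A := comb a b n 0 x1 x2 x3 in let B := comb a b n 0 y1 y2 y3 in
  let dA := comb a b n (x1 * 0 + x2 * 0 + x3 * 0)
    (- (eps / 4) * (m * ((mu_v - wv) / 2)) + x1 * (wv / 2) + x2 * (- wu / 2) + x3 * (- (2 * E)))
    (2^-1 * (E^-1 * wv) + x1 * (wu / 2) + x2 * (wv / 2) + x3 * (- 2))
    (8^-1 * E^-1 * (svv - wv * (mu_v + wv)) + x1 * 1 + x2 * E^-1 + x3 * wv) in
  let dB := comb a b n (y1 * 0 + y2 * 0 + y3 * 0)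
    (2^-1 * (E^-1 * wu) + y1 * (wu / 2) + y2 * (wv / 2) + y3 * 2)
    (eps / 4 * (m * ((mu_u - wu) / 2)) + y1 * (- wv / 2) + y2 * (wu / 2) + y3 * (2 * E))
    (- (8^-1 * E^-1 * (suu - wu * (mu_u + wu))) + y1 * (- E^-1) + y2 * (- 1) + y3 * wu) in
  dA + B ** A = dB + A ** B.
Proof.
move=> E0 -> eps2 fr lap; have -> : svv = - 4 * (E - E^-1) - m ^+ 2 * E - suu by lra.
move=> x1 x2 x3 y1 y2 y3 A B dA dB.
rewrite /A /B /dA /dB !(comb_mul fr) !combD.
rewrite /x1 /x2 /x3 /y1 /y2 /y3; congr (comb _ _ _ _ _ _ _).
- by field.
- by field.
- by field.
- have : (eps ^+ 2 - 1) * (m ^+ 2 / 8) = 0 by rewrite eps2 subrr mul0r.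
  move=> H; apply/eqP; rewrite -subr_eq0; apply/eqP; rewrite -[RHS]H.
  by field.
Qed.

Lemma sum_laplacians (a b c d x y s : R) : a + b = x -> c + d = y -> x + y = s ->
  (c + a) + (d + b) = s.
Proof. by move=> <- <- <-; ring. Qed.

Variables (U : set (R * R)) (omega mu : R * R -> R) (p : R * R -> quat R) (eps : R).

Local Notation cb z := (comb (alpha2 p z) (alpha3 p z) (qcross (alpha2 p z) (alpha3 p z))).

Definition conf_factor (z : R * R) : R := expR ((mu z - omega z) / 2).

(** The connection whose parallel sections, multiplied by a rotation about the
    normal, solve the system for q; eps is the sign of the square root taken in
    the equation for the angle. The parameter t does not occur in it. *)
Definition conn_u (z : R * R) : quat R :=
  cb z 0
    (2^-1 + - (eps / 4) * conf_factor z) (- (2^-1 * expR (- omega z)))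
    (8^-1 * expR (- omega z) * (pd_v mu z + pd_v omega z)).

Definition conn_v (z : R * R) : quat R :=
  cb z 0
    (- (2^-1 * expR (- omega z))) (2^-1 + eps / 4 * conf_factor z)
    (- (8^-1 * expR (- omega z) * (pd_u mu z + pd_u omega z))).

Hypotheses (oU : open U) (sg : sinh_gordon U omega) (lv : liouville U mu).
Hypotheses (mp : associated_minimal_surface U omega p) (eps2 : eps ^+ 2 = 1).

Let sO : smooth_on U omega. Proof. by case: sg. Qed.
Let sM : smooth_on U mu. Proof. by case: lv. Qed.
Let sp : smooth_on U p. Proof. by have [[h _] _ _ _ _] := mp. Qed.

Lemma smooth_alpha2 : smooth_on U (alpha2 p).
Proof. by apply: smooth_qmul => //; [exact: smooth_qconj | exact: smooth_derive]. Qed.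

Lemma smooth_alpha3 : smooth_on U (alpha3 p).
Proof. by apply: smooth_qmul => //; [exact: smooth_qconj | exact: smooth_derive]. Qed.

Lemma smooth_cross : smooth_on U (fun z => qcross (alpha2 p z) (alpha3 p z)).
Proof.
by apply: smooth_qim => //; apply: smooth_qmul => //; [exact: smooth_alpha2 | exact: smooth_alpha3].
Qed.

Let smooth_exp (f : R * R -> R) : smooth_on U f -> smooth_on U (fun z => expR (f z)).
Proof. by move=> sf; apply: (smooth_comp1 oU smooth_expR) sf. Qed.

Let smooth_conf : smooth_on U conf_factor.
Proof.
apply: smooth_exp; apply: smoothM => //; last exact: smooth_cst.
exact: smoothB.
Qed.

Let smooth_comb (x1 x2 x3 : R * R -> R) : smooth_on U x1 -> smooth_on U x2 -> smooth_on U x3 ->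
  smooth_on U (fun z => cb z 0
    (x1 z) (x2 z) (x3 z)).
Proof.
move=> s1 s2 s3; apply: smoothD => //; last by apply: smooth_qscale => //; exact: smooth_cross.
apply: smoothD => //; last by apply: smooth_qscale => //; exact: smooth_alpha3.
apply: smoothD => //; first exact: smooth_cst.
by apply: smooth_qscale => //; exact: smooth_alpha2.
Qed.

Let smooth_F : smooth_on U (fun z => expR (- omega z)).
Proof. by apply: smooth_exp; exact: smoothN. Qed.

Lemma smooth_conn_u : smooth_on U conn_u.
Proof.
apply: smooth_comb.
- apply: smoothD => //; first exact: smooth_cst.
  by apply: smoothM => //; exact: smooth_cst.
- by apply: smoothN => //; apply: smoothM => //; exact: smooth_cst.
- apply: smoothM => //; first by apply: smoothM => //; exact: smooth_cst.
  by apply: smoothD => //; exact: smooth_derive.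
Qed.

Lemma smooth_conn_v : smooth_on U conn_v.
Proof.
apply: smooth_comb.
- by apply: smoothN => //; apply: smoothM => //; exact: smooth_cst.
- apply: smoothD => //; first exact: smooth_cst.
  by apply: smoothM => //; exact: smooth_cst.
- apply: smoothN => //; apply: smoothM => //; first by apply: smoothM => //; exact: smooth_cst.
  by apply: smoothD => //; exact: smooth_derive.
Qed.

Let fr z : U z -> frame (2 * expR (omega z)) (alpha2 p z) (alpha3 p z)
  (qcross (alpha2 p z) (alpha3 p z)).
Proof. by move=> Uz; exact: surface_frame oU mp z Uz. Qed.

Lemma conn_u_im z : U z -> qre (conn_u z) = 0.
Proof. by move=> Uz; exact: comb_re (fr Uz) _ _ _ _. Qed.

Lemma conn_v_im z : U z -> qre (conn_v z) = 0.
Proof. by move=> Uz; exact: comb_re (fr Uz) _ _ _ _. Qed.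

Let dF v z : U z -> is_derive z v (fun z => expR (- omega z)) (expR (- omega z) * - 'D_v omega z).
Proof.
move=> Uz; apply: is_derive_comp1 (is_derive_expR _) _.
exact: is_deriveN (smooth_is_derive v sO Uz).
Qed.

Let dconf v z : U z ->
  is_derive z v conf_factor (conf_factor z * (('D_v mu z - 'D_v omega z) / 2)).
Proof.
move=> Uz; apply: is_derive_comp1 (is_derive_expR _) _.
have H := is_deriveM (is_deriveB (smooth_is_derive v sM Uz) (smooth_is_derive v sO Uz))
  (is_derive_cst (2^-1 : R) z v).
by apply: is_derive_eq H _; rewrite /GRing.scale /= mulr0 add0r mulrC.
Qed.

Let FE z : expR (- omega z) = (expR (omega z))^-1. Proof. exact: expRN. Qed.

Let d1 v z (c : R) : U z -> is_derive z v (fun z => 2^-1 + c * conf_factor z)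
  (c * (conf_factor z * (('D_v mu z - 'D_v omega z) / 2))).
Proof.
move=> Uz; have H := is_deriveD (is_derive_cst (2^-1 : R) z v)
  (is_deriveM (is_derive_cst (c : R) z v) (dconf v Uz)).
apply: is_derive_eq H _; rewrite /GRing.scale /=.
by move: (conf_factor z) ('D_v mu z) ('D_v omega z) => x y w; ring.
Qed.

Let d2 v z : U z -> is_derive z v (fun z => - (2^-1 * expR (- omega z)))
  (2^-1 * ((expR (omega z))^-1 * 'D_v omega z)).
Proof.
move=> Uz; have H := is_deriveN (is_deriveM (is_derive_cst (2^-1 : R) z v) (dF v Uz)).
apply: is_derive_eq H _; rewrite /GRing.scale /= FE.
by move: ((expR (omega z))^-1) ('D_v omega z) => x y; ring.
Qed.

Let d3 v w z : U z -> is_derive z w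
  (fun z => 8^-1 * expR (- omega z) * ('D_v mu z + 'D_v omega z))
  (8^-1 * (expR (omega z))^-1 * (('D_w ('D_v mu) z + 'D_w ('D_v omega) z)
    - 'D_w omega z * ('D_v mu z + 'D_v omega z))).
Proof.
move=> Uz; have H := is_deriveM (is_deriveM (is_derive_cst (8^-1 : R) z w) (dF w Uz))
  (is_deriveD (smooth_is_derive w (smooth_derive v sM) Uz)
    (smooth_is_derive w (smooth_derive v sO) Uz)).
apply: is_derive_eq H _; change (8^-1 * expR (- omega z) * ('D_w ('D_v mu) z + 'D_w ('D_v omega) z)
  + ('D_v mu z + 'D_v omega z) * (8^-1 * (expR (- omega z) * - 'D_w omega z) + expR (- omega z) * 0) =
  8^-1 * (expR (omega z))^-1 * (('D_w ('D_v mu) z + 'D_w ('D_v omega) z)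
    - 'D_w omega z * ('D_v mu z + 'D_v omega z))); rewrite FE.
move: ((expR (omega z))^-1) ('D_v omega z) ('D_v mu z) ('D_w omega z)
  ('D_w ('D_v mu) z) ('D_w ('D_v omega) z) => x y a b c d; ring.
Qed.

Let laplacian_sum z : U z ->
  (('D_e_u ('D_e_u mu) z : R) + ('D_e_u ('D_e_u omega) z : R)) +
  (('D_e_v ('D_e_v mu) z : R) + ('D_e_v ('D_e_v omega) z : R)) =
  - 4 * (expR (omega z) - (expR (omega z))^-1) - conf_factor z ^+ 2 * expR (omega z).
Proof.
move=> Uz; have h1 : ('D_e_u ('D_e_u omega) z : R) + ('D_e_v ('D_e_v omega) z : R) =
  - 8 * sinhR (omega z) by case: sg => _ h; exact: h.
have h2 : ('D_e_u ('D_e_u mu) z : R) + ('D_e_v ('D_e_v mu) z : R) = - expR (mu z).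
  by case: lv => _ h; exact: h.
apply: sum_laplacians h1 h2 _.
have <- : conf_factor z ^+ 2 * expR (omega z) = expR (mu z).
  by rewrite /conf_factor expr2 -!expRD -splitr subrK.
by rewrite /sinhR FE; lra.
Qed.

Lemma conn_flat z : U z ->
  pd_v conn_u z + conn_v z ** conn_u z = pd_u conn_v z + conn_u z ** conn_v z.
Proof.
move=> Uz; have [u2 v2 u3 v3] := weingarten oU sO mp Uz.
have [un vn] := weingarten_normal oU sO mp Uz.
have [_ H1] := is_derive_comb v2 v3 vn (d1 e_v (- (eps / 4)) Uz) (d2 e_v Uz) (d3 e_v e_v Uz).
have [_ H2] := is_derive_comb u2 u3 un (d2 e_u Uz) (d1 e_u (eps / 4) Uz)
  (is_deriveN (d3 e_u e_u Uz)).
have L := laplacian_sum Uz.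
have K := @flat_algebra (alpha2 p z) (alpha3 p z) (qcross (alpha2 p z) (alpha3 p z))
  (expR (omega z)) (expR (- omega z)) eps (conf_factor z) ('D_e_u omega z) ('D_e_v omega z)
  ('D_e_u mu z) ('D_e_v mu z) (('D_e_u ('D_e_u mu) z : R) + ('D_e_u ('D_e_u omega) z : R))
  (('D_e_v ('D_e_v mu) z : R) + ('D_e_v ('D_e_v omega) z : R)).
have {}K := K (lt0r_neq0 (expR_gt0 (omega z))) (FE z) eps2 (fr Uz) L.
have h1 : pd_v conn_u z = _ := H1.
have h2 : pd_u conn_v z = _ := H2.
apply: etrans (etrans K _); first by apply: f_equal2; [exact: h1 | reflexivity].
by apply: f_equal2; [exact: esym h2 | reflexivity].
Qed.

End AssociatedConnection.

(** * The angle of rotation *)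

Section HalfAngle.
Context {R : realType}.

(** With a = atan (2 cos 2t / S), the complex number S + 2 I cos 2t has modulus h
    and argument a, up to the sign eps; both identities then expand the doubled
    angle 2 (t - a / 2) = 2 t - a. *)
Lemma half_angle (t S h eps : R) : 0 < h -> eps ^+ 2 = 1 -> 0 < eps * S ->
  S ^+ 2 + 4 * cos (2 * t) ^+ 2 = h ^+ 2 ->
  let th := t - atan (2 * cos (2 * t) / S) / 2 in
  cos (2 * t) * (S + 2 * sin (2 * t)) = eps * h * (cos th ^+ 2 - sin th ^+ 2) /\
  sin (2 * t) * (S + 2 * sin (2 * t)) = eps * h * (2 * (cos th * sin th)) + 2.
Proof.
move=> h0 e2 eS Sh th; set c := cos (2 * t) in Sh *; set s := sin (2 * t).
have S0 : S != 0 by apply: contraL eS => /eqP ->; rewrite mulr0 ltxx.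
have hn0 := lt0r_neq0 h0.
have ca : cos (atan (2 * c / S)) = eps * S / h.
  rewrite cos_atan; have -> : 1 + (2 * c / S) ^+ 2 = (h / (eps * S)) ^+ 2.
    rewrite !expr_div_n (exprMn 2 eps S) e2 mul1r -Sh; field; exact: S0.
  by rewrite sqrtr_sqr ger0_norm ?invf_div // divr_ge0 // ltW.
have sa : sin (atan (2 * c / S)) = 2 * c * eps / h.
  have k := atanK (2 * c / S); have ca0 : cos (atan (2 * c / S)) != 0.
    by rewrite ca mulf_neq0 ?invr_eq0 // lt0r_neq0.
  move: k; rewrite /tan => /(congr1 (fun x => x * cos (atan (2 * c / S)))).
  by rewrite divfK // => ->; rewrite ca; field; apply/andP.
have th2 : 2 * t - atan (2 * c / S) = th *+ 2 by rewrite /th -/c; field.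
have c2 : cos th ^+ 2 - sin th ^+ 2 = c * (eps * S / h) + s * (2 * c * eps / h).
  by rewrite -ca -sa -[RHS](cosB (2 * t)) th2 mulr2n (cosD th th); ring.
have s2 : 2 * (cos th * sin th) = s * (eps * S / h) - c * (2 * c * eps / h).
  by rewrite -ca -sa -[RHS](sinB (2 * t)) th2 (sin_mulr2n th); ring.
have cs : c ^+ 2 = 1 - s ^+ 2 by rewrite -(cos2Dsin2 (2 * t)) addrK.
rewrite c2 s2; split.
  have -> : eps * h * (c * (eps * S / h) + s * (2 * c * eps / h)) =
    eps ^+ 2 * (c * S + s * (2 * c)) by field.
  by rewrite e2; ring.
have -> : eps * h * (s * (eps * S / h) - c * (2 * c * eps / h)) =
    eps ^+ 2 * (s * S - 2 * c ^+ 2) by field.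
by rewrite e2 cs; ring.
Qed.

(** The three lemmas rotation_u, rotation_v and rotation_t say that the rotation
    r = c - s F n / 2 about the normal is a gauge transformation: A r + D r = r W,
    where A is the connection above and W the form of the system. In the first
    two, half_angle identifies the trigonometric coefficients of W. *)
Lemma rotation_u (a b n : quat R) (E F c s eps h su sv S c2 : R) :
  frame (2 * E) a b n -> E != 0 -> F = E^-1 -> c ^+ 2 + s ^+ 2 = 1 -> S != 0 ->
  let k := - (s * F / 2) in let d := c2 * su / (2 * S) in
  comb a b n 0 (2^-1 + - (eps / 4) * (h * F)) (- (2^-1 * F)) (8^-1 * F * sv) ** comb a b n c 0 0 k
  + comb a b n (- s * d) (k * 2) (k * (2 * E)) (- (c * d * F / 2)) =
  comb a b n c 0 0 k ** comb a b n 0 (2^-1 - F / 4 * (eps * h * (c ^+ 2 - s ^+ 2)))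
    (- (4^-1 * F * (eps * h * (2 * (c * s)) + 2))) (8^-1 * F * (sv - 2 * su * c2 / S)).
Proof.
move=> fr E0 -> cs S0 k d; rewrite !(comb_mul fr) combD.
have z x : (c ^+ 2 + s ^+ 2 - 1) * x = 0 by rewrite cs subrr mul0r.
rewrite /k /d; congr (comb _ _ _ _ _ _ _); apply/eqP; rewrite -subr_eq0; apply/eqP.
- by field; rewrite ?E0 ?S0.
- by rewrite -[RHS](z (c * E^-1 * eps * h / 4)); field; rewrite ?E0 ?S0 ?oner_neq0.
- by rewrite -[RHS](z (s * E^-1 * eps * h / 4)); field; rewrite ?E0 ?S0 ?oner_neq0.
- by field; rewrite ?E0 ?S0.
Qed.

Lemma rotation_v (a b n : quat R) (E F c s eps h su sv S c2 : R) :
  frame (2 * E) a b n -> E != 0 -> F = E^-1 -> c ^+ 2 + s ^+ 2 = 1 -> S != 0 ->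
  let k := - (s * F / 2) in let d := c2 * sv / (2 * S) in
  comb a b n 0 (- (2^-1 * F)) (2^-1 + eps / 4 * (h * F)) (- (8^-1 * F * su)) ** comb a b n c 0 0 k
  + comb a b n (- s * d) (k * - (2 * E)) (k * - 2) (- (c * d * F / 2)) =
  comb a b n c 0 0 k ** comb a b n 0 (- (4^-1 * F * (eps * h * (2 * (c * s)) + 2)))
    (2^-1 + F / 4 * (eps * h * (c ^+ 2 - s ^+ 2))) (- (8^-1 * F * (su + 2 * sv * c2 / S))).
Proof.
move=> fr E0 -> cs S0 k d; rewrite !(comb_mul fr) combD.
have z x : (c ^+ 2 + s ^+ 2 - 1) * x = 0 by rewrite cs subrr mul0r.
rewrite /k /d; congr (comb _ _ _ _ _ _ _); apply/eqP; rewrite -subr_eq0; apply/eqP.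
- by field; rewrite ?E0 ?S0.
- by rewrite -[RHS](z (s * E^-1 * eps * h / 4)); field; rewrite ?E0 ?S0 ?oner_neq0.
- by rewrite -[RHS](z (- (c * E^-1 * eps * h / 4))); field; rewrite ?E0 ?S0 ?oner_neq0.
- by field; rewrite ?E0 ?S0.
Qed.

Lemma rotation_t (a b n : quat R) (E F c s S s2 : R) :
  frame (2 * E) a b n -> E != 0 -> F = E^-1 -> S != 0 ->
  let k := - (s * F / 2) in let d := 1 + 2 * s2 / S in
  comb a b n (- s * d) 0 0 (- (c * d * F / 2)) =
  comb a b n c 0 0 k ** comb a b n 0 0 0 (- (F * (S + 2 * s2) / (2 * S))).
Proof.
move=> fr E0 -> S0 k d; rewrite !(comb_mul fr) /k /d.
by congr (comb _ _ _ _ _ _ _); field; rewrite ?E0 ?S0 ?oner_neq0.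
Qed.

End HalfAngle.

Section SpinAngle.
Context {R : realType}.
Variables (U : set (R * R)) (omega mu : R * R -> R) (Lambda : (R * R) * R -> R).
Hypotheses (oU : open U) (sO : smooth_on U omega) (sM : smooth_on U mu).

Local Notation V := (lift_domain omega mu U).

Let W : set ((R * R) * R) := [set x | U x.1].

Let oW : open W.
Proof. by apply: open_comp => // x _; exact: cvg_fst. Qed.

Let smooth_base (f : R * R -> R) : smooth_on U f -> smooth_on W (fun x => f x.1).
Proof. exact: smooth_fst. Qed.

Let smooth_time (f : R -> R) : smooth_on setT f -> smooth_on W (fun x => f x.2).
Proof. by move=> /(@smooth_snd _ (R * R)%type); apply: smooth_sub. Qed.

Let smooth_mul (c : R) : smooth_on setT (fun t : R => c * t).
Proof. by apply: smoothM; [exact: openT | exact: smooth_cst | exact/smooth_id/openT]. Qed.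

Lemma open_lift_domain : open V.
Proof.
pose g (x : (R * R) * R) : R := expR (omega x.1 + mu x.1) - 2 - 2 * cos (4 * x.2).
have sg : smooth_on W g.
  apply: smoothB => //; first apply: smoothB => //; first 2 [exact: smooth_cst].
    apply: (smooth_comp1 oW (@smooth_expR R)) => //.
    by apply: smoothD => //; exact: smooth_base.
  apply: smoothM => //; first exact: smooth_cst.
  apply: (smooth_time (f := fun t => cos (4 * t))).
exact: (smooth_comp1 openT (@smooth_cos_sin R).1 (fun _ _ => I) (smooth_mul 4)).
exact: (open_pos oW sg).
Qed.

Hypotheses (sL : smooth_on V Lambda) (aL : angle_equation omega mu Lambda V).

(** The square root of exp (omega + mu) - 2 - 2 cos (4 t) chosen by Lambda. *)
Definition angle_root (x : (R * R) * R) : R :=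
  2 * Num.sqrt 3 * expR (omega x.1) / tan (Lambda x) - 2 * sin (2 * x.2).

(** The angle by which a parallel section is turned about the normal. *)
Definition spin_angle (x : (R * R) * R) : R :=
  x.2 - atan (2 * cos (2 * x.2) / angle_root x) / 2.

Local Notation S := angle_root.

Lemma angle_root_sqr x : V x ->
  S x ^+ 2 + 4 * cos (2 * x.2) ^+ 2 = expR (omega x.1 + mu x.1).
Proof.
case: x => z t Vx; have [_ _] := aL Vx; rewrite /S /= => ->.
have -> : 4 * t = (2 * t) *+ 2 by ring.
by rewrite cos_mulr2n; ring.
Qed.

Lemma angle_root_neq0 x : V x -> S x != 0.
Proof.
case: x => z t Vx; have [_ _] := aL Vx; rewrite -/(S (z, t)) => h; case: Vx => _ /=.
by rewrite -h; apply: contraL => /eqP ->; rewrite expr0n ltxx.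
Qed.

Let VW : V `<=` W. Proof. by move=> x []. Qed.

Let oV := open_lift_domain.

Lemma smooth_angle_root : smooth_on V S.
Proof.
apply: (@smooth_eq _ _ _ V (fun x => 2 * Num.sqrt 3 * expR (omega x.1) *
    (cos (Lambda x) * (sin (Lambda x))^-1) - 2 * sin (2 * x.2))) => //.
  by move=> x _; rewrite /S /tan invf_div.
apply: smoothB => //; first apply: smoothM => //.
- apply: smoothM => //; first exact: smooth_cst.
  apply: (smooth_sub VW); apply: (smooth_base (f := fun z => expR (omega z))).
  by apply: (smooth_comp1 oU (@smooth_expR R)).
- apply: smoothM => //; first by apply: (smooth_comp1 oV (@smooth_cos_sin R).1).
  apply: (smooth_comp1 oV (@smooth_inv R)); last by apply: (smooth_comp1 oV (@smooth_cos_sin R).2).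
  case=> z t Vx /=; have [_ + _] := aL Vx.
  by apply: contra_neq => /eqP; rewrite /tan => /eqP ->; rewrite mul0r.
- apply: smoothM => //; first exact: smooth_cst.
  apply: (smooth_sub VW); apply: (smooth_time (f := fun t => sin (2 * t))).
  exact: (smooth_comp1 openT (@smooth_cos_sin R).2 (fun _ _ => I) (smooth_mul 2)).
Qed.

Lemma smooth_spin_angle : smooth_on V spin_angle.
Proof.
apply: smoothB => //.
  by apply: (smooth_sub VW); apply: (smooth_time (f := id)); exact/smooth_id/openT.
apply: smoothM => //; last exact: smooth_cst.
apply: (smooth_comp1 oV (@smooth_atan R)) => //; apply: smoothM => //.
  apply: smoothM => //; first exact: smooth_cst.
  apply: (smooth_sub VW); apply: (smooth_time (f := fun t => cos (2 * t))).
  exact: (smooth_comp1 openT (@smooth_cos_sin R).1 (fun _ _ => I) (smooth_mul 2)).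
by apply: (smooth_comp1 oV (@smooth_inv R)) smooth_angle_root; exact: angle_root_neq0.
Qed.

Lemma spin_angle_algebra (c s S h2 t sig dS : R) : S != 0 -> S ^+ 2 + 4 * c ^+ 2 = h2 -> h2 != 0 ->
  2 * S * dS - 16 * c * s * t = h2 * sig ->
  t - (1 + (2 * c / S) ^+ 2)^-1 * (2 * ((- s) * (2 * t)) / S - 2 * c * dS / S ^+ 2) / 2 =
  t * (1 + 2 * s / S) + c * sig / (2 * S).
Proof.
move=> S0 h h0 H.
have -> : dS = (h2 * sig + 16 * c * s * t) / (2 * S) by rewrite -H; field.
have -> : (1 + (2 * c / S) ^+ 2)^-1 = S ^+ 2 / h2.
  have -> : 1 + (2 * c / S) ^+ 2 = h2 / S ^+ 2 by rewrite -h; field.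
  by rewrite invf_div.
rewrite -h in h0 *; field; by rewrite S0.
Qed.

(** The derivative of the root S is found by differentiating
    S ^ 2 + 4 cos (2 t) ^ 2 = exp (omega + mu) and dividing by 2 S. *)
Lemma is_derive_spin_angle x (w : (R * R) * R) : V x ->
  is_derive x w spin_angle (w.2 * (1 + 2 * sin (2 * x.2) / S x) +
    cos (2 * x.2) * ('D_(w.1) omega x.1 + 'D_(w.1) mu x.1) / (2 * S x)).
Proof.
move=> Vx; have S0 := angle_root_neq0 Vx; have Ux : U x.1 by case: Vx.
have dt : is_derive x w (fun x => x.2) w.2.
  exact: (is_derive_comp_snd (is_derive_id x.2 w.2)).
have d2t : is_derive x w (fun x => 2 * x.2) (2 * w.2).
  by apply: is_derive_eq (is_deriveM (is_derive_cst (2 : R) x w) dt) _; rewrite /GRing.scale /=; ring.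
have dc : is_derive x w (fun x => 2 * cos (2 * x.2)) (2 * (- sin (2 * x.2) * (2 * w.2))).
  have dc : is_derive x w (fun x => cos (2 * x.2)) (- sin (2 * x.2) * (2 * w.2)).
    exact: (is_derive_comp1 (is_derive_cos _)).
  by apply: is_derive_eq (is_deriveM (is_derive_cst (2 : R) x w) dc) _; rewrite /GRing.scale /=; ring.
have dS := smooth_is_derive w smooth_angle_root Vx.
have dh : is_derive x w (fun x => expR (omega x.1 + mu x.1))
    (expR (omega x.1 + mu x.1) * ('D_(w.1) omega x.1 + 'D_(w.1) mu x.1)).
  have ds : is_derive x w (fun x => omega x.1 + mu x.1) ('D_(w.1) omega x.1 + 'D_(w.1) mu x.1).
    exact: (is_deriveD (is_derive_comp_fst (smooth_is_derive w.1 sO Ux))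
      (is_derive_comp_fst (smooth_is_derive w.1 sM Ux))).
  exact: (is_derive_comp1 (is_derive_expR _) ds).
have dh' : is_derive x w (fun x => expR (omega x.1 + mu x.1))
    (2 * S x * 'D_w S x - 16 * cos (2 * x.2) * sin (2 * x.2) * w.2).
  apply: (@is_derive_eq_on _ _ _ V (fun x => S x * S x + 2 * cos (2 * x.2) * (2 * cos (2 * x.2)))) => //.
    by move=> y Vy; rewrite -(angle_root_sqr Vy); ring.
  apply: is_derive_eq (is_deriveD (is_deriveM dS dS) (is_deriveM dc dc)) _.
  by move: ('D_w S x : R) => D; rewrite /GRing.scale /=; ring.
have dq : is_derive x w (fun x => 2 * cos (2 * x.2) / S x)
    (2 * (- sin (2 * x.2) * (2 * w.2)) / S x - 2 * cos (2 * x.2) * 'D_w S x / S x ^+ 2).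
  have di (r : R) : r != 0 -> is_derive r 1 (fun r => r^-1) (- r ^- 2 *: 1).
    by move=> r0; exact: (is_deriveV r0 (is_derive_id r (1 : R))).
  have dV := is_derive_comp1 (di _ S0) dS.
  apply: is_derive_eq (is_deriveM dc dV) _.
  by move: ('D_w S x : R) => D; rewrite /GRing.scale /=; field.
have da := is_derive_comp1 (is_derive1_atan _) dq.
have H := is_deriveB dt (is_deriveM da (is_derive_cst (2^-1 : R) x w)).
apply: is_derive_eq H _.
have K := spin_angle_algebra S0 (angle_root_sqr Vx) (lt0r_neq0 (expR_gt0 _)) (is_derive_unique dh' dh).
apply: etrans K.
rewrite /GRing.scale /=; congr (_ - _).
by rewrite mulr0 add0r mulrC.
Qed.

End SpinAngle.

(** * The system as a parallelism condition *)

Section SystemAlgebra.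
Context {R : realType}.

(** Here T is tan L: these two identities eliminate the angle in favour of S. *)
Lemma system_coefficients (s3 E T s2 S : R) : E != 0 -> T != 0 -> S = 2 * s3 * E / T - 2 * s2 ->
  s3 = (S + 2 * s2) * T / (2 * E) /\ s3 * E - s2 * T = S * T / 2.
Proof. by move=> E0 T0 ->; split; field; rewrite ?T0 ?E0. Qed.

Lemma system_u (q a b n : quat R) (s3 E F T C s2 c2 S su sv : R) : E != 0 -> F = E^-1 ->
  T != 0 -> C = T^-1 -> S != 0 -> S = 2 * s3 * E / T - 2 * s2 ->
  8^-1 *: ((F * (sv - su * c2 * T / (s3 * E - s2 * T))) *: (q ** n)
    - (4 * (s3 * C * c2 - 1)) *: (q ** a) - (4 * s3 * s2 * C) *: (q ** b)) =
  q ** comb a b n 0 (2^-1 - F / 4 * (c2 * (S + 2 * s2)))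
    (- (4^-1 * F * (s2 * (S + 2 * s2)))) (8^-1 * F * (sv - 2 * su * c2 / S)).
Proof.
move=> E0 -> T0 -> S0 HS; have [h1 ->] := system_coefficients E0 T0 HS; rewrite h1.
rewrite /comb !qmulDr !qmulZr !qmulq1.
move: (q ** a) (q ** b) (q ** n) => A B N.
by apply: quatP; rewrite !quatE; field; rewrite ?E0 ?T0 ?S0.
Qed.

Lemma system_v (q a b n : quat R) (s3 E F T C s2 c2 S su sv : R) : E != 0 -> F = E^-1 ->
  T != 0 -> C = T^-1 -> S != 0 -> S = 2 * s3 * E / T - 2 * s2 ->
  8^-1 *: (- (F * (su + sv * c2 * T / (s3 * E - s2 * T))) *: (q ** n)
    - (4 * s3 * C * s2) *: (q ** a) + (4 * (1 + s3 * c2 * C)) *: (q ** b)) =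
  q ** comb a b n 0 (- (4^-1 * F * (s2 * (S + 2 * s2))))
    (2^-1 + F / 4 * (c2 * (S + 2 * s2))) (- (8^-1 * F * (su + 2 * sv * c2 / S))).
Proof.
move=> E0 -> T0 -> S0 HS; have [h1 ->] := system_coefficients E0 T0 HS; rewrite h1.
rewrite /comb !qmulDr !qmulZr !qmulq1.
move: (q ** a) (q ** b) (q ** n) => A B N.
by apply: quatP; rewrite !quatE; field; rewrite ?E0 ?T0 ?S0.
Qed.

Lemma system_t (q a b n : quat R) (s3 E F T s2 S : R) : E != 0 -> F = E^-1 ->
  T != 0 -> S != 0 -> S = 2 * s3 * E / T - 2 * s2 ->
  - (s3 / (2 * s3 * E - 2 * s2 * T)) *: (q ** n) =
  q ** comb a b n 0 0 0 (- (F * (S + 2 * s2) / (2 * S))).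
Proof.
move=> E0 -> T0 S0 HS; have [h1 h2] := system_coefficients E0 T0 HS.
have -> : 2 * s3 * E - 2 * s2 * T = S * T by rewrite -!mulrA -mulrBr h2; field.
rewrite h1 /comb !qmulDr !qmulZr !qmulq1.
move: (q ** a) (q ** b) (q ** n) => A B N.
by apply: quatP; rewrite !quatE; field; rewrite ?E0 ?T0 ?S0.
Qed.

End SystemAlgebra.

Section System.
Context {R : realType}.
Variables (U : set (R * R)) (omega mu : R * R -> R) (p : R * R -> quat R).
Variable Lambda : (R * R) * R -> R.

Local Notation S := (angle_root omega Lambda).
Local Notation V := (lift_domain omega mu U).
Local Notation cb z := (comb (alpha2 p z) (alpha3 p z) (qcross (alpha2 p z) (alpha3 p z))).

Definition system_form_u (x : (R * R) * R) : quat R :=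
  cb x.1 0
    (2^-1 - expR (- omega x.1) / 4 * (cos (2 * x.2) * (S x + 2 * sin (2 * x.2))))
    (- (4^-1 * expR (- omega x.1) * (sin (2 * x.2) * (S x + 2 * sin (2 * x.2)))))
    (8^-1 * expR (- omega x.1) * ((pd_v mu x.1 + pd_v omega x.1)
      - 2 * (pd_u mu x.1 + pd_u omega x.1) * cos (2 * x.2) / S x)).

Definition system_form_v (x : (R * R) * R) : quat R :=
  cb x.1 0
    (- (4^-1 * expR (- omega x.1) * (sin (2 * x.2) * (S x + 2 * sin (2 * x.2)))))
    (2^-1 + expR (- omega x.1) / 4 * (cos (2 * x.2) * (S x + 2 * sin (2 * x.2))))
    (- (8^-1 * expR (- omega x.1) * ((pd_u mu x.1 + pd_u omega x.1)
      + 2 * (pd_v mu x.1 + pd_v omega x.1) * cos (2 * x.2) / S x))).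

Definition system_form_t (x : (R * R) * R) : quat R :=
  cb x.1 0 0 0
    (- (expR (- omega x.1) * (S x + 2 * sin (2 * x.2)) / (2 * S x))).

Hypothesis aL : angle_equation omega mu Lambda V.

(** Once the coefficients are expressed by the root S, each equation of the system
    says that q is parallel for one of the three forms. *)
Lemma q_systemP (q : (R * R) * R -> quat R) : q_system omega mu p Lambda V q <->
  forall x, V x -> [/\ 'D_((0, 0), 1) q x = q x ** system_form_t x,
    'D_(e_u, 0) q x = q x ** system_form_u x & 'D_(e_v, 0) q x = q x ** system_form_v x].
Proof.
have cotE y : cot y = (tan y)^-1 :> R by rewrite /cot /tan invf_div.
split=> Q x Vx; have := Q x Vx; have S0 := angle_root_neq0 aL Vx;
  case: x Vx S0 => z t Vx S0 [q1 q2 q3]; have [_ T0 _] := aL Vx;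
  have E0 := lt0r_neq0 (expR_gt0 (omega z)).
- split; [apply: etrans q1 _ | apply: etrans q2 _ | apply: etrans q3 _].
  + exact: (system_t _ _ _ _ E0 (expRN _) T0 S0 erefl).
  + exact: (system_u _ _ _ _ _ _ _ E0 (expRN _) T0 (cotE _) S0 erefl).
  + exact: (system_v _ _ _ _ _ _ _ E0 (expRN _) T0 (cotE _) S0 erefl).
- split; [apply: etrans q1 (esym _) | apply: etrans q2 (esym _) | apply: etrans q3 (esym _)].
  + exact: (system_t _ _ _ _ E0 (expRN _) T0 S0 erefl).
  + exact: (system_u _ _ _ _ _ _ _ E0 (expRN _) T0 (cotE _) S0 erefl).
  + exact: (system_v _ _ _ _ _ _ _ E0 (expRN _) T0 (cotE _) S0 erefl).
Qed.

End System.

(** * Solutions of the system *)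

Section SolutionAlgebra.
Context {R : realType}.

Lemma comb_1n (a b n : quat R) x0 x3 : comb a b n x0 0 0 x3 = x0 *: qone + x3 *: n.
Proof. by apply: quatP; rewrite /comb !quatE; ring. Qed.

Lemma comb0 (a b n : quat R) : comb a b n 0 0 0 0 = 0.
Proof. by apply: quatP; rewrite /comb !quatE; ring. Qed.

Lemma base_speed (a c u m s : R) : 0 * a + c * (u + m) / s = c * (m + u) / s.
Proof. by rewrite mul0r add0r (addrC u). Qed.

Lemma time_speed (a c u m s : R) : u = 0 -> m = 0 -> 1 * a + c * (u + m) / s = a.
Proof. by move=> -> ->; rewrite addr0 mulr0 mul0r addr0 mul1r. Qed.

End SolutionAlgebra.

Section Solution.
Context {R : realType}.
Variables (U : set (R * R)) (omega mu : R * R -> R) (p : R * R -> quat R).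
Variable Lambda : (R * R) * R -> R.
Hypotheses (oU : open U) (sg : sinh_gordon U omega) (lv : liouville U mu).
Hypothesis mp : associated_minimal_surface U omega p.

Local Notation V := (lift_domain omega mu U).
Local Notation S := (angle_root omega Lambda).
Local Notation th := (spin_angle omega Lambda).
Local Notation cb z := (comb (alpha2 p z) (alpha3 p z) (qcross (alpha2 p z) (alpha3 p z))).

Hypotheses (sL : smooth_on V Lambda) (aL : angle_equation omega mu Lambda V).

Let sO : smooth_on U omega. Proof. by case: sg. Qed.
Let sM : smooth_on U mu. Proof. by case: lv. Qed.
Let oV : open V. Proof. exact: open_lift_domain oU sO sM. Qed.

(** The rotation cos th - sin th n about the unit vector n = e^-omega nu / 2. *)
Definition rotor (x : (R * R) * R) : quat R :=
  cb x.1 (cos (th x)) 0 0 (- (sin (th x) * expR (- omega x.1) / 2)).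

Let fr x : V x -> frame (2 * expR (omega x.1)) (alpha2 p x.1) (alpha3 p x.1)
  (qcross (alpha2 p x.1) (alpha3 p x.1)).
Proof. by case=> Ux _; exact: (surface_frame oU mp Ux). Qed.

Lemma smooth_rotor : smooth_on V rotor.
Proof.
have sub (W : normedModType R) (f : R * R -> W) : smooth_on U f -> smooth_on V (fun x => f x.1).
  by move=> /(@smooth_fst _ _ R); apply: smooth_sub => x [].
have st := smooth_spin_angle oU sO sM sL aL.
have sF : smooth_on U (fun z => expR (- omega z)).
  by apply: (smooth_comp1 oU (@smooth_expR R)) => //; exact: smoothN.
apply: smoothD => //; last first.
  apply: smooth_qscale => //; last exact: sub (smooth_cross oU mp).
  apply: smoothN => //; apply: smoothM => //; last exact: smooth_cst.
  apply: smoothM => //; last exact: sub sF.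
  exact: (smooth_comp1 oV (@smooth_cos_sin R).2).
apply: smoothD => //; last by apply: smooth_qscale => //; [exact: smooth_cst | exact: sub (smooth_alpha3 oU mp)].
apply: smoothD => //; last by apply: smooth_qscale => //; [exact: smooth_cst | exact: sub (smooth_alpha2 oU mp)].
apply: smooth_qscale => //; last exact: smooth_cst.
exact: (smooth_comp1 oV (@smooth_cos_sin R).1).
Qed.

Lemma rotor_norm x : V x -> qdot (rotor x) (rotor x) = 1.
Proof.
move=> Vx; rewrite (comb_dot (fr Vx)) expRN; apply: etrans (cos2Dsin2 (th x)).
have := lt0r_neq0 (expR_gt0 (omega x.1)); move: (cos (th x)) (sin (th x)) (expR _) => c s E E0.
by field.
Qed.

(** The derivative of the factor e^-omega cancels the component along nu of the
    derivative of nu. *)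
Lemma is_derive_rotor x (w : (R * R) * R) (d n1 n2 : R) : V x ->
  is_derive x w th d ->
  is_derive x.1 w.1 (fun z => qcross (alpha2 p z) (alpha3 p z)) (cb x.1 0 n1 n2 ('D_(w.1) omega x.1)) ->
  let k := - (sin (th x) * expR (- omega x.1) / 2) in
  is_derive x w rotor (cb x.1 (- sin (th x) * d) (k * n1) (k * n2)
    (- (cos (th x) * d * expR (- omega x.1) / 2))).
Proof.
move=> Vx dth dn k; have Ux : U x.1 by case: Vx.
have rE : rotor = fun x => cos (th x) *: qone +
    - (sin (th x) * expR (- omega x.1) / 2) *: qcross (alpha2 p x.1) (alpha3 p x.1).
  by apply: funext => y; exact: comb_1n.
have dF : is_derive x w (fun x => expR (- omega x.1)) (expR (- omega x.1) * - 'D_(w.1) omega x.1).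
  have h := is_deriveN (is_derive_comp_fst (smooth_is_derive w.1 sO Ux)).
  exact: (is_derive_comp1 (is_derive_expR _) h).
have dc : is_derive x w (fun x => cos (th x)) (- sin (th x) * d).
  exact: (is_derive_comp1 (is_derive_cos _) dth).
have ds : is_derive x w (fun x => sin (th x)) (cos (th x) * d).
  exact: (is_derive_comp1 (is_derive_sin _) dth).
have dk : is_derive x w (fun x => - (sin (th x) * expR (- omega x.1) / 2))
    (- (cos (th x) * d * expR (- omega x.1) / 2) - k * 'D_(w.1) omega x.1).
  have h := is_deriveN (is_deriveM (is_deriveM ds dF) (is_derive_cst (2^-1 : R) x w)).
  apply: is_derive_eq h _.
  by rewrite /k; move: ('D_(w.1) omega x.1 : R) => D; rewrite /GRing.scale /=; field.
rewrite rE; have H := is_deriveD (is_derive_qscale dc (is_derive_cst (qone : quat R) x w))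
  (is_derive_qscale dk (is_derive_comp_fst dn)).
apply: is_derive_eq H _.
rewrite -/k /comb; clear dk; move: ('D_(w.1) omega x.1 : R) (cos (th x)) (sin (th x)) => D c s.
move: (expR (- omega x.1)) (alpha2 p x.1) (alpha3 p x.1) k => F a b k'.
by move: (qcross a b) => n; apply: quatP; rewrite !quatE; ring.
Qed.

Section Sign.
Variables (eps : R) (q0 : R * R -> quat R).
Hypothesis eps2 : eps ^+ 2 = 1.
Hypothesis q0P : forall z, U z -> parallel (conn_u omega mu p eps) (conn_v omega mu p eps) z q0.

Let q x := q0 x.1 ** rotor x.

(* This is the modulus h of half_angle, and conf_factor is h e^-omega. *)
Let h (x : (R * R) * R) : R := expR ((omega x.1 + mu x.1) / 2).

Let conf_h (x : (R * R) * R) : conf_factor omega mu x.1 = h x * expR (- omega x.1).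
Proof. by rewrite /conf_factor /h -expRD; congr expR; field. Qed.

Let halves x : V x -> 0 < eps * S x ->
  cos (2 * x.2) * (S x + 2 * sin (2 * x.2)) =
    eps * h x * (cos (th x) ^+ 2 - sin (th x) ^+ 2) /\
  sin (2 * x.2) * (S x + 2 * sin (2 * x.2)) = eps * h x * (2 * (cos (th x) * sin (th x))) + 2.
Proof.
move=> Vx eS; apply: half_angle => //; first exact: expR_gt0.
by rewrite (angle_root_sqr aL Vx) /h expr2 -expRD -splitr.
Qed.

(** By the product rule the derivative of q0 r is q0 (A r + D r), and the gauge
    transformation turns it into q0 r W. *)
Lemma is_derive_solution x : V x -> 0 < eps * S x ->
  [/\ is_derive x ((0, 0), 1) q (q x ** system_form_t omega p Lambda x),
      is_derive x (e_u, 0) q (q x ** system_form_u omega mu p Lambda x) &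
      is_derive x (e_v, 0) q (q x ** system_form_v omega mu p Lambda x)].
Proof.
move=> Vx eS; have Ux : U x.1 by case: Vx.
have S0 := angle_root_neq0 aL Vx; have E0 := lt0r_neq0 (expR_gt0 (omega x.1)).
have [nu_u nu_v] := weingarten_normal oU sO mp Ux.
have dth w := is_derive_spin_angle oU sO sM sL aL w Vx.
have [hc hs] := halves Vx eS; have cs := cos2Dsin2 (th x).
have [pu pv] := q0P Ux.
have D0 : 'D_(0, 0) omega x.1 = 0 :> R /\ 'D_(0, 0) mu x.1 = 0 :> R.
  have e : (0, 0) = (0 : R) *: (0, 0) :> R * R by rewrite scaler0.
  by split; rewrite e (smooth_deriveZ _ _ _ Ux) ?scale0r.
have turn (w : (R * R) * R) d n1 n2 A Om dq : is_derive x w th d ->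
    is_derive x.1 w.1 (fun z => qcross (alpha2 p z) (alpha3 p z)) (cb x.1 0 n1 n2 ('D_(w.1) omega x.1)) ->
    is_derive x.1 w.1 q0 (q0 x.1 ** A) ->
    (let k := - (sin (th x) * expR (- omega x.1) / 2) in
     A ** rotor x + cb x.1 (- sin (th x) * d) (k * n1) (k * n2)
       (- (cos (th x) * d * expR (- omega x.1) / 2)) = rotor x ** Om) ->
    dq = q x ** Om -> is_derive x w q dq.
  move=> hd hn hq e ->.
  apply: is_derive_eq (is_derive_qmul (is_derive_comp_fst hq) (is_derive_rotor Vx hd hn)) _.
  by rewrite -!qmulA -qmulDr e.
have dt : is_derive x ((0, 0), 1) th (1 + 2 * sin (2 * x.2) / S x).
  by apply: is_derive_eq (dth ((0, 0), 1)) _; exact: time_speed D0.1 D0.2.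
have du : is_derive x (e_u, 0) th (cos (2 * x.2) * (pd_u mu x.1 + pd_u omega x.1) / (2 * S x)).
  by apply: is_derive_eq (dth (e_u, 0)) _; exact: base_speed.
have dv : is_derive x (e_v, 0) th (cos (2 * x.2) * (pd_v mu x.1 + pd_v omega x.1) / (2 * S x)).
  by apply: is_derive_eq (dth (e_v, 0)) _; exact: base_speed.
have nu_t : is_derive x.1 (0, 0) (fun z => qcross (alpha2 p z) (alpha3 p z))
    (cb x.1 0 0 0 ('D_(0, 0) omega x.1)).
  apply: is_derive_eq (smooth_is_derive (0, 0) (smooth_cross oU mp) Ux) _; rewrite D0.1.
  have e : (0, 0) = (0 : R) *: (0, 0) :> R * R by rewrite scaler0.
  by rewrite {1}e (smooth_deriveZ _ _ (smooth_cross oU mp) Ux) scale0r comb0.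
have pt : is_derive x.1 (0, 0) q0 (q0 x.1 ** 0).
  have e : (0, 0) = (0 : R) *: e_u :> R * R by rewrite scale0r.
  by rewrite e; apply: is_derive_eq (is_derive_scale 0 pu) _; rewrite scale0r qmulq0.
split.
- apply: (turn _ _ 0 0 0 _ _ dt nu_t pt) erefl.
  rewrite /= qmul0q add0r !mulr0.
  exact: rotation_t (fr Vx) E0 (expRN _) S0.
- apply: (turn _ _ 2 (2 * expR (omega x.1)) _ _ _ du nu_u pu) erefl.
  have K := rotation_u eps (h x) (pd_u mu x.1 + pd_u omega x.1)
    (pd_v mu x.1 + pd_v omega x.1) (cos (2 * x.2)) (fr Vx) E0 (expRN _) cs S0.
  rewrite /conn_u conf_h /system_form_u hc hs; exact: K.
- apply: (turn _ _ (- (2 * expR (omega x.1))) (- 2) _ _ _ dv nu_v pv) erefl.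
  have K := rotation_v eps (h x) (pd_u mu x.1 + pd_u omega x.1)
    (pd_v mu x.1 + pd_v omega x.1) (cos (2 * x.2)) (fr Vx) E0 (expRN _) cs S0.
  rewrite /conn_v conf_h /system_form_v hc hs; exact: K.
Qed.

End Sign.
End Solution.

(** * Lagrangian immersions *)

Section NearlyKahlerForm.
Context {R : realType}.

Lemma comb_inj (e : R) (a b n : quat R) (x0 x1 x2 x3 y0 y1 y2 y3 : R) : frame e a b n -> e != 0 ->
  comb a b n x0 x1 x2 x3 = comb a b n y0 y1 y2 y3 -> [/\ x1 = y1, x2 = y2 & x3 = y3].
Proof.
move=> fr e0 H; have k z1 z2 z3 := congr1 (fun x => qdot x (comb a b n 0 z1 z2 z3)) H.
have e20 : e ^+ 2 != 0 by rewrite expf_neq0.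
split.
- by apply: (mulfI e0); have := k 1 0 0; rewrite !(comb_dot fr) !mulr0 !mulr1 !addr0 !add0r.
- by apply: (mulfI e0); have := k 0 1 0; rewrite !(comb_dot fr) !mulr0 !mulr1 !addr0 !add0r.
- by apply: (mulfI e20); have := k 0 0 1; rewrite !(comb_dot fr) !mulr0 !mulr1 !add0r.
Qed.

Lemma nkJ_unit (p q A B : quat R) : qdot p p = 1 -> qdot q q = 1 ->
  nkJ (p, q) (p ** A, q ** B) =
  (p ** ((Num.sqrt 3)^-1 *: (2 *: B - A)), q ** ((Num.sqrt 3)^-1 *: (B - 2 *: A))).
Proof.
move=> p1 q1; rewrite /nkJ /qinv /= p1 q1 invr1 !scale1r; congr (_, _).
  rewrite -qmulA [qconj q ** _]qmulA qconj_mul q1 scale1r qmul1q.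
  by rewrite qmulZr qmulDr qmulNr qmulZr.
rewrite -qmulA [qconj p ** _]qmulA qconj_mul p1 scale1r qmul1q.
by rewrite qmulZr qmulDr qmulNr qmulZr addrC.
Qed.

(** Twice the metric of J Z and W is <J Z, W> + <J J Z, J W>, and J J Z = - Z. *)
Lemma nk_form (p q A B A' B' : quat R) : qdot p p = 1 -> qdot q q = 1 ->
  nkg (p, q) (nkJ (p, q) (p ** A, q ** B)) (p ** A', q ** B') =
  2 / Num.sqrt 3 * (qdot B A' - qdot A B').
Proof.
move=> p1 q1; have s0 : Num.sqrt 3 != 0 :> R by rewrite sqrtr_eq0 -ltNge.
have s2 : Num.sqrt 3 ^+ 2 = 3 :> R by rewrite sqr_sqrtr.
rewrite /nkg /euclid2 !nkJ_unit //= !qdot_mull p1 q1 !mul1r.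
rewrite !(qdotZl, qdotZr, qdotDl, qdotDr, qdotNl, qdotNr).
have r3 : (Num.sqrt 3 : R)^-1 ^+ 3 = (Num.sqrt 3)^-1 / 3.
  by rewrite exprS exprVn s2.
move: ((Num.sqrt 3)^-1) r3 => r r3.
move: (qdot A A') (qdot A B') (qdot B A') (qdot B B') => aa ab ba bb.
transitivity (2^-1 * (r * (2 * ba - aa + (bb - 2 * ab)) +
  r ^+ 3 * (- 3 * (2 * ab - aa) - 3 * (bb - 2 * ba)))); first by ring.
by rewrite r3; field.
Qed.

End NearlyKahlerForm.

Section LocalSmoothness.
Context {R : realType}.

Lemma smooth_setU (E F : normedModType R) (A B : set E) (f : E -> F) :
  smooth_on A f -> smooth_on B f -> smooth_on (A `|` B) f.
Proof.
move=> sA sB k; move: (sA k) (sB k) => {sA sB}; elim: k f => [|k IH] f [cA dA] [cB dB].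
  by split=> // x [/cA|/cB].
split=> [x [/cA|/cB] //|v]; have [hA kA] := dA v; have [hB kB] := dB v.
by split; [move=> x [/hA|/hB] | exact: IH].
Qed.

Lemma derive_three (A : set ((R * R) * R)) (g : (R * R) * R -> quat R) x (X : (R * R) * R) :
  open A -> smooth_on A g -> A x -> 'D_X g x =
    X.1.1 *: 'D_(e_u, 0) g x + X.1.2 *: 'D_(e_v, 0) g x + X.2 *: 'D_((0, 0), 1) g x :> quat R.
Proof.
move=> oA sg Ax; have {1}-> : X = X.1.1 *: (e_u, 0) + X.1.2 *: (e_v, 0) + X.2 *: ((0, 0), 1).
  have e : X = ((X.1.1 * 1 + X.1.2 * 0 + X.2 * 0, X.1.1 * 0 + X.1.2 * 1 + X.2 * 0),
      X.1.1 * 0 + X.1.2 * 0 + X.2 * 1).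
    by case: X => [[a b] c] /=; congr (_, _, _); ring.
  exact: e.
rewrite (smooth_q_deriveD oA _ _ sg Ax) (smooth_q_deriveD oA _ _ sg Ax).
by rewrite !(smooth_deriveZ _ _ sg Ax).
Qed.

End LocalSmoothness.

Section Forms.
Context {R : realType}.

Lemma forms_comb (a b n : quat R) (X : (R * R) * R) (u1 u2 u3 v2 v3 t3 : R) :
  X.1.1 *: comb a b n 0 u1 u2 u3 + X.1.2 *: comb a b n 0 u2 v2 v3 + X.2 *: comb a b n 0 0 0 t3 =
  comb a b n 0 (X.1.1 * u1 + X.1.2 * u2) (X.1.1 * u2 + X.1.2 * v2)
    (X.1.1 * u3 + X.1.2 * v3 + X.2 * t3).
Proof. by apply: quatP; rewrite /comb !quatE; ring. Qed.

Lemma qmul_sum3 (q A B C : quat R) (x y z : R) :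
  q ** (x *: A + y *: B + z *: C) = x *: (q ** A) + y *: (q ** B) + z *: (q ** C).
Proof. by rewrite !qmulDr !qmulZr. Qed.

Lemma qre_sum3 (A B C : quat R) (x y z : R) : qre A = 0 -> qre B = 0 -> qre C = 0 ->
  qre (x *: A + y *: B + z *: C) = 0.
Proof. by move=> a b c; rewrite !quatE a b c !mulr0 !addr0. Qed.

Lemma qmulKV (c w : quat R) : qdot c c = 1 -> c ** (qconj c ** w) = w.
Proof. by move=> c1; rewrite qmulA qmul_conj c1 scale1r qmul1q. Qed.

Lemma qmul_plane (c a b n : quat R) (x y z : R) :
  x *: (c ** a) + y *: (c ** b) + z *: 0 = c ** comb a b n 0 x y 0.
Proof.
by rewrite /comb !qmulDr !qmulZr; move: (c ** _) (c ** a) (c ** b) => *;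
  apply: quatP; rewrite !quatE; ring.
Qed.

End Forms.

Section LagrangianSolution.
Context {R : realType}.
Variables (U : set (R * R)) (omega mu : R * R -> R) (p : R * R -> quat R).
Variable Lambda : (R * R) * R -> R.
Hypotheses (oU : open U) (sg : sinh_gordon U omega) (lv : liouville U mu).
Hypothesis mp : associated_minimal_surface U omega p.

Local Notation V := (lift_domain omega mu U).
Local Notation S := (angle_root omega Lambda).
Local Notation cb z := (comb (alpha2 p z) (alpha3 p z) (qcross (alpha2 p z) (alpha3 p z))).

Hypotheses (sL : smooth_on V Lambda) (aL : angle_equation omega mu Lambda V).

Let sO : smooth_on U omega. Proof. by case: sg. Qed.
Let sM : smooth_on U mu. Proof. by case: lv. Qed.
Let sp : smooth_on U p. Proof. by have [[h _] _ _ _ _] := mp. Qed.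
Let oV : open V. Proof. exact: open_lift_domain oU sO sM. Qed.

Let fr x : V x -> frame (2 * expR (omega x.1)) (alpha2 p x.1) (alpha3 p x.1)
  (qcross (alpha2 p x.1) (alpha3 p x.1)).
Proof. by case=> Ux _; exact: (surface_frame oU mp Ux). Qed.

Let e0 (x : (R * R) * R) : 2 * expR (omega x.1) != 0.
Proof. by rewrite mulf_neq0 // lt0r_neq0 // expR_gt0. Qed.

Let p1 x : V x -> qdot (p x.1) (p x.1) = 1.
Proof. by have [_ h _ _ _] := mp; case=> Ux _; exact: h. Qed.

Definition system_form (x X : (R * R) * R) : quat R :=
  X.1.1 *: system_form_u omega mu p Lambda x + X.1.2 *: system_form_v omega mu p Lambda x
    + X.2 *: system_form_t omega p Lambda x.

(** The symmetry of the coefficients (u2 occurs twice) makes the immersion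
    Lagrangian, and t3 is the reason why it is an immersion. *)
Lemma system_form_comb x : V x -> exists u1 u2 u3 v2 v3 t3 : R, t3 != 0 /\ forall X,
  system_form x X = cb x.1 0 (X.1.1 * u1 + X.1.2 * u2) (X.1.1 * u2 + X.1.2 * v2)
    (X.1.1 * u3 + X.1.2 * v3 + X.2 * t3).
Proof.
move=> Vx; do 6!eexists; split; last first.
  by move=> X; rewrite /system_form; exact: forms_comb.
have S0 := angle_root_neq0 aL Vx; case: x Vx S0 => z t Vx S0.
have [_ T0 _] := aL Vx.
rewrite oppr_eq0 !mulf_neq0 ?invr_eq0 ?mulf_neq0 ?S0 //=; first exact: lt0r_neq0 (expR_gt0 _).
rewrite /S /= subrK !mulf_neq0 ?invr_eq0 //; last exact: lt0r_neq0 (expR_gt0 _).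
Qed.

Definition solves (q : (R * R) * R -> quat R) := forall x, V x ->
  [/\ 'D_((0, 0), 1) q x = q x ** system_form_t omega p Lambda x,
    'D_(e_u, 0) q x = q x ** system_form_u omega mu p Lambda x &
    'D_(e_v, 0) q x = q x ** system_form_v omega mu p Lambda x].

Lemma solves_derive q x X : smooth_on V q -> solves q -> V x ->
  'D_X q x = q x ** system_form x X :> quat R.
Proof.
move=> sq Q Vx; have [ht hu hv] := Q x Vx.
rewrite (derive_three X oV sq Vx) ht hu hv.
exact: esym (qmul_sum3 _ _ _ _ _ _ _).
Qed.

Lemma system_form_im x X : V x -> qre (system_form x X) = 0.
Proof.
by move=> Vx; apply: qre_sum3; exact: comb_re (fr Vx) _ _ _ _.
Qed.

(** The difference d of two solutions satisfies D d = d W with W imaginary, so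
    that its length is constant. *)
Lemma solves_unique q q' (A : set ((R * R) * R)) x0 x :
  smooth_on V q -> smooth_on V q' -> solves q -> solves q' -> A `<=` V -> connected A ->
  A x0 -> q' x0 = q x0 -> A x -> q' x = q x.
Proof.
move=> sq sq' Q Q' AV cA Ax0 q0 Ax.
pose d y := q' y - q y.
have H y X : V y -> is_derive y X (fun y => qdot (d y) (d y)) 0.
  move=> Vy; have h1 := smooth_is_derive X sq' Vy; have h2 := smooth_is_derive X sq Vy.
  rewrite (solves_derive X sq' Q' Vy) in h1; rewrite (solves_derive X sq Q Vy) in h2.
  have h : is_derive y X d (d y ** system_form y X).
    by apply: is_derive_eq (is_deriveB h1 h2) _; rewrite /d qmulDl qmulNl.
  apply: is_derive_eq (is_derive_qdot h h) _.
  exact: qdot_skew (system_form_im X Vy).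
have d0 : d x0 = 0 by rewrite /d q0 subrr.
have h := derive0_connected oV H AV cA Ax0 Ax.
apply/eqP; rewrite -subr_eq0; apply/eqP; apply: qdot_eq0.
by apply: etrans h _; rewrite /= d0 qdotE !quatE; ring.
Qed.

Let pE x : V x -> p x.1 ** alpha2 p x.1 = pd_u p x.1 /\ p x.1 ** alpha3 p x.1 = pd_v p x.1.
Proof.
by move=> Vx; split; exact: qmulKV (p1 Vx).
Qed.

Let sp1 : smooth_on V (fun x => p x.1).
Proof. by apply: smooth_sub (@smooth_fst _ _ R _ _ _ sp) => x []. Qed.

Let derive_p x X : V x -> 'D_X (fun x => p x.1) x = p x.1 ** cb x.1 0 X.1.1 X.1.2 0 :> quat R.
Proof.
move=> Vx; have [hu hv] := pE Vx.
rewrite (derive_three X oV sp1 Vx) !derive_comp_fst /=.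
have -> : 'D_(0, 0) p x.1 = 0 :> quat R.
  have e : (0, 0) = (0 : R) *: e_u :> R * R by rewrite scale0r.
  by have Ux : U x.1 by [case: Vx]; rewrite e (smooth_deriveZ _ _ sp Ux) scale0r.
rewrite -/(pd_u p x.1) -/(pd_v p x.1) -hu -hv; exact: qmul_plane.
Qed.

(** In the frame the differential of f sends X to (p A, q B), where A has the components
    of X along alpha2 and alpha3 and B is the form of the system; nk_form
    reduces the Lagrangian condition to <B_X, A_Y> = <A_X, B_Y>. *)
Lemma solves_lagrangian q : smooth_on V q -> solves q -> (forall x, V x -> S3 R (q x)) ->
  lagrangian_immersion V (fun x => (p x.1, q x)).
Proof.
move=> sq Q q1.
have sf : smooth_on V (fun x => (p x.1, q x)) by exact: smooth_pair.
have Df x X : V x -> 'D_X (fun x => (p x.1, q x)) x =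
    (p x.1 ** cb x.1 0 X.1.1 X.1.2 0, q x ** system_form x X).
  move=> Vx; have [_ ->] := is_derive_pair (smooth_is_derive X sp1 Vx) (smooth_is_derive X sq Vx).
  by rewrite derive_p // (solves_derive X sq Q Vx).
split.
- split=> // x Vx X Y; rewrite !Df // => -[hp hq].
  have cancel (c A B : quat R) : qdot c c = 1 -> c ** A = c ** B -> A = B.
    move=> c1 /(congr1 (fun w => qconj c ** w)).
    by rewrite !qmulA qconj_mul c1 scale1r !qmul1q.
  have [h1 h2 _] := comb_inj (fr Vx) (e0 x) (cancel _ _ _ (p1 Vx) hp).
  have := cancel _ _ _ (q1 x Vx) hq.
  have [u1 [u2 [u3 [v2 [v3 [t3 [t0 E]]]]]]] := system_form_comb Vx.
  rewrite !E h1 h2 => /(comb_inj (fr Vx) (e0 x)) [_ _ /addrI /(mulIf t0)].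
  by case: X Y h1 h2 {hp hq} => [[a b] c] [[a' b'] c'] /= -> -> ->.
- by move=> x Vx; split; [exact: p1 | exact: q1].
- move=> x Vx X Y; rewrite !Df // nk_form; [|exact: p1|exact: q1].
  have [u1 [u2 [u3 [v2 [v3 [t3 [_ E]]]]]]] := system_form_comb Vx.
  by rewrite !E !(comb_dot (fr Vx)); ring.
Qed.

(** The connection depends on the sign of the root, which is locally constant on V:
    a parallel section is taken for each sign, and each of them serves where the
    root has its sign. *)
Lemma solves_exists : domain U -> simply_connected R U ->
  exists q, [/\ smooth_on V q, solves q & forall x, V x -> S3 R (q x)].
Proof.
move=> [_ U0 cU] scU.
have section (eps : R) : eps ^+ 2 = 1 -> exists q0 : R * R -> quat R, [/\ smooth_on U q0,
    forall z, U z -> parallel (conn_u omega mu p eps) (conn_v omega mu p eps) z q0 &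
    forall z, U z -> qdot (q0 z) (q0 z) = 1].
  move=> eps2; apply: flat_section => //.
  - exact: smooth_conn_u.
  - exact: smooth_conn_v.
  - by move=> z Uz; exact: (conn_u_im mu eps oU mp Uz).
  - by move=> z Uz; exact: (conn_v_im mu eps oU mp Uz).
  - by move=> z Uz; exact: (conn_flat oU sg lv mp eps2 Uz).
have [qp [sqp pqp qp1]] := section 1 (expr1n _ _).
have [qm [sqm pqm qm1]] := section (-1) (etrans (sqrrN 1) (expr1n _ _)).
pose q x := (if 0 < S x then qp x.1 else qm x.1) ** rotor omega p Lambda x.
pose Vp := [set x | V x /\ 0 < 1 * S x]; pose Vm := [set x | V x /\ 0 < -1 * S x].
have oS c : open [set x | V x /\ 0 < c * S x].
  apply: open_pos => //; apply: smoothM => //; first exact: smooth_cst.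
  exact: smooth_angle_root oU sO sM sL aL.
have VE : V = Vp `|` Vm.
  apply/seteqP; split=> [x Vx|x [[]|[]] //].
  have := angle_root_neq0 aL Vx; rewrite neq_lt => /orP[] h; [right | left]; split=> //.
    by rewrite mulN1r oppr_gt0.
  by rewrite mul1r.
have qpE x : Vp x -> qp x.1 ** rotor omega p Lambda x = q x.
  by move=> [_]; rewrite mul1r /q => ->.
have qmE x : Vm x -> qm x.1 ** rotor omega p Lambda x = q x.
  by move=> [_]; rewrite mulN1r oppr_gt0 /q ltNge le_eqVlt => /norP[_ /negbTE ->].
have sq0 (q0 : R * R -> quat R) W : W `<=` V -> smooth_on U q0 ->
    smooth_on W (fun x => q0 x.1 ** rotor omega p Lambda x).
  move=> WV s0; apply: (smooth_sub WV); apply: smooth_qmul => //.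
    by apply: smooth_sub (@smooth_fst _ _ R _ _ _ s0) => x [].
  exact: smooth_rotor oU sg lv mp sL aL.
exists q; split.
- rewrite VE; apply: smooth_setU.
    by apply: (smooth_eq (oS 1) qpE); apply: sq0 => // x [].
  by apply: (smooth_eq (oS (-1)) qmE); apply: sq0 => // x [].
- have eqs (eps : R) (q0 : R * R -> quat R) x : eps ^+ 2 = 1 ->
      (forall z, U z -> parallel (conn_u omega mu p eps) (conn_v omega mu p eps) z q0) ->
      (forall x, V x /\ 0 < eps * S x -> q0 x.1 ** rotor omega p Lambda x = q x) ->
      V x /\ 0 < eps * S x ->
      [/\ 'D_((0, 0), 1) q x = q x ** system_form_t omega p Lambda x,
        'D_(e_u, 0) q x = q x ** system_form_u omega mu p Lambda x &
        'D_(e_v, 0) q x = q x ** system_form_v omega mu p Lambda x].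
    move=> eps2 pq0 q0E Wx; have [Vx eS] := Wx.
    have [] := is_derive_solution oU sg lv mp sL aL eps2 pq0 Vx eS; rewrite q0E //.
    by do 3![case/(is_derive_eq_on (oS eps) Wx q0E) => _ ->].
  move=> x; rewrite {1}VE => -[Vx|Vx].
    exact: eqs (expr1n _ _) pqp qpE Vx.
  exact: eqs (etrans (sqrrN 1) (expr1n _ _)) pqm qmE Vx.
- move=> x Vx; have [Ux _] := Vx; rewrite /S3 /= /q qdot_mull (rotor_norm Lambda oU mp Vx) mulr1.
  by case: ifP => _; [exact: qp1 | exact: qm1].
Qed.

End LagrangianSolution.

Theorem theorem4 (R : realType) (U : set (R * R)) (omega mu : R * R -> R)
    (p : R * R -> quat R) (Lambda : (R * R) * R -> R) :
  domain U -> simply_connected R U ->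
  sinh_gordon U omega -> liouville U mu ->
  associated_minimal_surface U omega p ->
  let V := lift_domain omega mu U in
  smooth_on V Lambda -> angle_equation omega mu Lambda V ->
  exists q : (R * R) * R -> quat R,
    [/\ lagrangian_immersion V (fun x => (p x.1, q x)),
        q_system omega mu p Lambda V q &
        forall q' : (R * R) * R -> quat R,
          smooth_on V q' -> (forall x, V x -> S3 R (q' x)) ->
          q_system omega mu p Lambda V q' ->
          forall A : set ((R * R) * R), A `<=` V -> connected A ->
          forall x0, A x0 -> q' x0 = q x0 -> forall x, A x -> q' x = q x].
Proof.
move=> dU scU sg lv mp V sL aL; have [oU _ _] := dU.
have [q [sq Q q1]] := solves_exists oU sg lv mp sL aL dU scU.
exists q; split.
- exact: (solves_lagrangian oU sg lv mp aL sq Q q1).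
- exact/(q_systemP p aL).
- move=> q' sq' _ /(q_systemP p aL) Q' A AV cA x0 Ax0 q0 x Ax.
  exact: (solves_unique oU sg lv mp sq sq' Q Q' AV cA Ax0 q0 Ax).
Qed.
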